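(* Let $N\ge 5$ be an integer, $0<\beta<4$, $q_\beta=\frac{2(N-\beta)}{N-4}$, $2^{**}=\frac{2N}{N-4}$, $\mu_1=\left(\frac{N(N-4)}{4}\right)^2$, and let $-(N-2)^2\le\mu<\mu_1$. Then there exists at least one non-trivial weak solution $u\in D^{2,2}(\mathbb{R}^N)\cap C^4(\mathbb{R}^N\setminus\{0\})$ of $$\Delta^2u-\mu\frac{u}{|x|^{4}}=\frac{|u|^{q_\beta-2}u}{|x|^{\beta}}+|u|^{2^{**}-2}u\quad\text{in }\mathbb{R}^N,$$ i.e. there is $u\in D^{2,2}(\mathbb{R}^N)\cap C^4(\mathbb{R}^N\setminus\{0\})$ with $u\not\equiv0$ such that $$\int_{\mathbb{R}^N}\left[\Delta u\,\Delta\phi-\mu\frac{u\phi}{|x|^{4}}\right]dx=\int_{\mathbb{R}^N}\frac{|u|^{q_\beta-2}u\,\phi}{|x|^{\beta}}dx+\int_{\mathbb{R}^N}|u|^{2^{**}-2}u\,\phi\,dx\qquad\text{for all }\phi\in C_0^\infty(\mathbb{R}^N).$$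
   Context: Functions are real-valued. $D^{2,2}(\mathbb{R}^N)$ is the closure (completion) of $C_0^\infty(\mathbb{R}^N)$ with respect to the norm $\left(\int_{\mathbb{R}^N}|\Delta u|^2dx\right)^{1/2}$; for $N\ge5$ it embeds continuously in $L^{2^{**}}(\mathbb{R}^N)$, so its elements are regarded as functions. $\Delta^2u=\Delta(\Delta u)$ is the biharmonic operator. By the Rellich inequality $\mu_1\int|x|^{-4}|u|^2dx\le\int|\Delta u|^2dx$ and the inequality $C\left(\int|x|^{-\beta}|u|^{q_\beta}dx\right)^{2/q_\beta}\le\int|\Delta u|^2dx$ (with $C=C(N,\beta)>0$), valid on $D^{2,2}(\mathbb{R}^N)$, all integrals in the weak formulation are well defined. *)

(* Defs.v *)
From HB Require Import structures.
From mathcomp Require Import all_boot all_order all_algebra.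
From mathcomp Require Import all_classical all_reals all_analysis.

Set Implicit Arguments.
Unset Strict Implicit.
Unset Printing Implicit Defensive.
Import Order.TTheory GRing.Theory Num.Theory.
Import numFieldNormedType.Exports.

Local Open Scope classical_set_scope.
Local Open Scope ring_scope.

(* R^n is 'rV[R]_n.  Its sigma-algebra is the product of the Borel
   sigma-algebras of the coordinates, i.e. the Borel sigma-algebra of R^n. *)
Definition rV_display : measure_display. Proof. exact. Qed.

Section measurable_rV.
Variables (R : realType) (n : nat).

Definition rV_coord (i : 'I_n) (x : 'rV[R]_n) : measurableTypeR R := x ord0 i.

Let rV_set0 : g_sigma_preimage rV_coord set0.
Proof. exact: sigma_algebra0. Qed.

Let rV_setC A : g_sigma_preimage rV_coord A -> g_sigma_preimage rV_coord (~` A).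
Proof. exact: sigma_algebraC. Qed.

Let rV_bigcup (F : (set 'rV[R]_n)^nat) :
  (forall i, g_sigma_preimage rV_coord (F i)) ->
  g_sigma_preimage rV_coord (\bigcup_i (F i)).
Proof. exact: sigma_algebra_bigcup. Qed.

HB.instance Definition _ := @isMeasurable.Build rV_display
  'rV[R]_n (g_sigma_preimage rV_coord) rV_set0 rV_setC rV_bigcup.

Lemma measurable_rV_coord (i : 'I_n) :
  measurable_fun [set: 'rV[R]_n] (rV_coord i).
Proof.
move=> _ Y mY; rewrite setTI; apply: sub_sigma_algebra => /=.
rewrite -bigcup_seq/=; exists i => /=; first by rewrite mem_index_enum.
by exists Y => //; rewrite setTI.
Qed.

Lemma measurable_fun_rVP d (T : measurableType d) (f : T -> 'rV[R]_n) :
  (forall i, measurable_fun [set: T] (rV_coord i \o f)) ->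
  measurable_fun [set: T] f.
Proof.
move=> mf; apply: (measurability
  (\big[setU/set0]_(i < n) preimage_set_system setT (rV_coord i) measurable)).
  by [].
move=> _ [B + <-].
rewrite -bigcup_seq => -[i _ [C mC <-]].
by rewrite setTI; have := mf i measurableT C mC; rewrite !setTI.
Qed.

End measurable_rV.

Section lebesgue_rV.
Variable R : realType.

Definition rV_cons n (p : measurableTypeR R * 'rV[R]_n) : 'rV[R]_n.+1 :=
  row_mx (const_mx p.1 : 'rV[R]_1) p.2.

Definition rV_uncons n (x : 'rV[R]_n.+1) : measurableTypeR R * 'rV[R]_n :=
  (x ord0 ord0, \row_(i < n) x ord0 (lift ord0 i)).

Lemma rV_cons0 n (p : measurableTypeR R * 'rV[R]_n) :
  rV_cons p ord0 ord0 = p.1.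
Proof.
rewrite /rV_cons (_ : ord0 = lshift n (ord0 : 'I_1)); last exact: val_inj.
by rewrite (@row_mxEl _ 1 1 n) mxE.
Qed.

Lemma rV_consS n (p : measurableTypeR R * 'rV[R]_n) (i : 'I_n) :
  rV_cons p ord0 (lift ord0 i) = p.2 ord0 i.
Proof.
rewrite /rV_cons (_ : lift ord0 i = rshift 1 i); last exact: val_inj.
by rewrite (@row_mxEr _ 1 1 n).
Qed.

Lemma rV_unconsK n : cancel (@rV_cons n) (@rV_uncons n).
Proof.
move=> [a x]; rewrite /rV_uncons rV_cons0; congr pair.
by apply/rowP => i; rewrite mxE rV_consS.
Qed.

Lemma measurable_rV_cons n : measurable_fun setT (@rV_cons n).
Proof.
apply: measurable_fun_rVP => i.
have [j ->|->] := unliftP ord0 i.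
  rewrite (_ : _ \o _ = rV_coord j \o snd).
    apply: measurableT_comp => //; exact: measurable_rV_coord.
  by apply/funext => p /=; rewrite /rV_coord rV_consS.
rewrite (_ : _ \o _ = fst)//.
by apply/funext => p /=; rewrite /rV_coord rV_cons0.
Qed.

Lemma measurable_rV_uncons n : measurable_fun setT (@rV_uncons n).
Proof.
apply/measurable_fun_pairP; split; first exact: measurable_rV_coord.
apply: measurable_fun_rVP => i.
rewrite (_ : _ \o _ = rV_coord (lift ord0 i)); first exact: measurable_rV_coord.
by apply/funext => x /=; rewrite /rV_coord mxE.
Qed.

Section lebesgue_rV_succ.
Local Open Scope ereal_scope.
Variables (n : nat) (mu : {sigma_finite_measure set 'rV[R]_n -> \bar R}).

Definition lebesgue_rV_succ : set 'rV[R]_n.+1 -> \bar R :=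
  pushforward (@lebesgue_measure R \x mu) (@rV_cons n).

Let mcons := @measurable_rV_cons n.

Let succ0 : lebesgue_rV_succ set0 = 0.
Proof. exact: measure0. Qed.

Let succ_ge0 A : 0 <= lebesgue_rV_succ A.
Proof. exact: measure_ge0. Qed.

Let succ_sigma_additive : semi_sigma_additive lebesgue_rV_succ.
Proof. exact: measure_semi_sigma_additive. Qed.

HB.instance Definition _ := isMeasure.Build _ _ _ lebesgue_rV_succ
  succ0 succ_ge0 succ_sigma_additive.

Let succ_sigma_finite : sigma_finite setT lebesgue_rV_succ.
Proof.
have /sigma_finiteP[F [TF ndF Foo]] := sigma_finiteT (@lebesgue_measure R).
have /sigma_finiteP[G [TG ndG Goo]] := sigma_finiteT mu.
exists (fun k => @rV_uncons n @^-1` (F k `*` G k)).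
  apply/esym/seteqP; split => // x _.
  have [k _ Fk] : (\bigcup_k F k) (rV_uncons x).1 by rewrite -TF.
  have [l _ Gl] : (\bigcup_k G k) (rV_uncons x).2 by rewrite -TG.
  exists (maxn k l) => //; split.
    by move: Fk; exact/subsetPset/ndF/leq_maxl.
  by move: Gl; exact/subsetPset/ndG/leq_maxr.
move=> k; have [mF Fk] := Foo k; have [mG Gk] := Goo k; split.
  rewrite -[X in measurable X]setTI.
  by apply: measurable_rV_uncons => //; exact: measurableX.
rewrite /lebesgue_rV_succ /pushforward -comp_preimage.
rewrite (_ : _ \o _ = id) ?preimage_id; last first.
  by apply/funext => p /=; rewrite rV_unconsK.
by rewrite product_measure1E// lte_mul_pinfty// ge0_fin_numE.
Qed.

HB.instance Definition _ := Measure_isSigmaFinite.Build _ _ _ lebesgue_rV_succ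
  succ_sigma_finite.

End lebesgue_rV_succ.

(* Lebesgue measure on R^n; see lebesgue_rV_box for its value on boxes. *)
Fixpoint lebesgue_rV n : {sigma_finite_measure set 'rV[R]_n -> \bar R} :=
  match n with
  | 0%N => \d_(0 : 'rV[R]_0)
  | m.+1 => lebesgue_rV_succ (lebesgue_rV m)
  end.

Lemma measurable_rV_box n (A : 'I_n -> set (measurableTypeR R)) :
  (forall i, measurable (A i)) ->
  measurable [set x : 'rV[R]_n | forall i, A i (x ord0 i)].
Proof.
move=> mA.
rewrite (_ : [set _ | _] = \bigcap_(i in [set: 'I_n]) (rV_coord i @^-1` A i)).
  apply: fin_bigcap_measurable => // i _.
  by rewrite -[X in measurable X]setTI; exact: measurable_rV_coord.
by apply/seteqP; split => [x Ax i _ |x Ax i]; exact: Ax.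
Qed.

Lemma lebesgue_rV_box n (A : 'I_n -> set (measurableTypeR R)) :
  (forall i, measurable (A i)) ->
  (lebesgue_rV n [set x | forall i, A i (x ord0 i)] =
   \prod_(i < n) lebesgue_measure (A i))%E.
Proof.
elim: n A => [|n IH] A mA.
  rewrite big_ord0 /= diracE (_ : _ \in _ = true)//.
  by apply: mem_set => i; case: i.
rewrite big_ord_recl -IH//= /lebesgue_rV_succ /pushforward.
rewrite -product_measure1E//; last first.
  exact: (@measurable_rV_box _ (fun i => A (lift ord0 i))).
congr (product_measure1 _ _ _); apply/seteqP; split => -[a x] /=.
  move=> Aax; split=> [|i]; first by have := Aax ord0; rewrite rV_cons0.
  by have := Aax (lift ord0 i); rewrite rV_consS.
move=> [Aa Ax] i; have [j ->|->] := unliftP ord0 i.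
  by rewrite rV_consS.
by rewrite rV_cons0.
Qed.

End lebesgue_rV.

Section function_spaces.
Variables (R : realType) (N : nat).
Implicit Types (f g u v phi : 'rV[R]_N -> R) (A : set 'rV[R]_N).

(* The norm `|x| provided by the library on 'rV[R]_N is the sup norm. *)
Definition euclid (x : 'rV[R]_N) : R := Num.sqrt (\sum_(i < N) x ord0 i ^+ 2).

Definition partial (i : 'I_N) f : 'rV[R]_N -> R := 'D_(delta_mx ord0 i) f.

Definition partials (s : seq 'I_N) f : 'rV[R]_N -> R := foldr partial f s.

Definition laplacian f : 'rV[R]_N -> R :=
  fun x => \sum_(i < N) partial i (partial i f) x.

(* f is of class C^k on the open set A: all its partial derivatives of order
   at most k exist and are continuous at every point of A. *)
Definition class_C (k : nat) A f : Prop :=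
  forall (s : seq 'I_N) (x : 'rV[R]_N), A x ->
    ((size s <= k)%N -> {for x, continuous (partials s f)}) /\
    ((size s < k)%N ->
      forall i, derivable (partials s f) x (delta_mx ord0 i)).

Definition test_function phi : Prop :=
  (forall k, class_C k setT phi) /\ compact (closure [set x | phi x != 0]).

Definition crit_exp : R := 2 * N%:R / (N%:R - 4).

(* u is an element of D^{2,2}(R^N) and v is its Laplacian: some sequence of
   test functions whose Laplacians converge in L^2 -- i.e. a Cauchy sequence
   for the norm of D^{2,2} -- defines u through the embedding of the completion
   in L^{2N/(N-4)}, and v is the L^2 limit of these Laplacians. *)
Definition D22_laplacian u v : Prop :=
  [/\ u \in Lfun (lebesgue_rV R N) crit_exp%:E,
      v \in Lfun (lebesgue_rV R N) 2%:E &
      exists phi : nat -> 'rV[R]_N -> R,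
        [/\ forall n, test_function (phi n),
            'N[lebesgue_rV R N]_(2%:E)[EFin \o (laplacian (phi n) \- v)%R]%E
              @[n --> \oo] --> 0%E &
            'N[lebesgue_rV R N]_(crit_exp%:E)[EFin \o (phi n \- u)%R]%E
              @[n --> \oo] --> 0%E]].

Definition D22 u : Prop := exists v, D22_laplacian u v.

Definition q_exp (beta : R) : R := 2 * (N%:R - beta) / (N%:R - 4).

Definition weak_solution (mu beta : R) u : Prop :=
  exists2 v, D22_laplacian u v &
    forall phi, test_function phi ->
      \int[lebesgue_rV R N]_x
        (v x * laplacian phi x - mu * (u x * phi x / euclid x ^+ 4)) =
      \int[lebesgue_rV R N]_x
        (`|u x| `^ (q_exp beta - 2) * u x * phi x / euclid x `^ beta) +
      \int[lebesgue_rV R N]_x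
        (`|u x| `^ (crit_exp - 2) * u x * phi x).

End function_spaces.

(* Main.v *)
(* With t = ln |x|^2 and u(x) = |x|^(-(N - 4)/2) W(t), the equation becomes the
   autonomous equation (l1^2 - D^2)(l2^2 - D^2) W = (W^(q-1) + W^(p-1)) / 16, where
   D = d/dt and p = 2N / (N - 4); the lower bound on mu makes l1^2 and l2^2 real, the
   upper one makes them positive.  Hence W = T (f W), where T is the convolution with a
   positive, even, unimodal, positive definite kernel.

   A positive solution minimizes the energy among the even w >= 0, nonincreasing in
   |t|, such that <f w, T (f w)> >= <f w, w>.  Replacing w by the multiple of T (f w)
   on the Nehari manifold does not increase the energy, by Young's inequality and
   the positivity of T; it makes minimizing sequences equicontinuous, tight and
   bounded away from 0, and it decreases the energy strictly unless w = T (f w).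

   The solution and its derivatives decay exponentially, so cutting W off at |t| = n
   gives test functions that converge to u in D^{2,2}, because |x|^(-N) e^(-d |t|) is
   integrable; Green's formula for these test functions passes to the limit. *)

From HB Require Import structures.
Require Import Defs.
From mathcomp Require Import all_boot all_order all_algebra.
From mathcomp Require Import all_classical all_reals all_analysis.
From mathcomp Require Import measurable_realfun.
From mathcomp Require Import ring lra.

Set Implicit Arguments.
Unset Strict Implicit.
Unset Printing Implicit Defensive.
Import Order.TTheory GRing.Theory Num.Theory.
Import numFieldNormedType.Exports.
Local Open Scope classical_set_scope.
Local Open Scope ring_scope.

(** On the line neither power is critical: the dilation invariance behind the exponent 2N / (N - 4)
    has become invariance under translations of t, and evenness together with monotonicity breaks
    it. Rearrangement does not control second derivatives, so the symmetry is imposed on the class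
    from the start; it survives because the convolution of two even unimodal functions is again even
    and unimodal. The integral equation keeps derivatives out of the argument until a solution is
    known. Competitors are plain nonnegative bounded measurable functions, limits are pointwise
    under a fixed envelope, and no Lagrange multiplier appears: the energy lost in one step controls
    a weighted L^2 distance between w and T (f w), which must vanish at a minimizer. The origin and
    infinity of R^N are the two ends of the line, so a single cutoff in t removes the singularity
    and makes the support bounded. *)

(** * Real-valued integrals *)

(* Locked: otherwise the unifier unfolds integrals when comparing them. *)
HB.lock Definition lint d (T : measurableType d) (R : realType)
  (mu : {measure set T -> \bar R}) (f : T -> R) : R := \int[mu]_x f x.

Section real_integrals.
Context d (T : measurableType d) (R : realType).
Variable mu : {measure set T -> \bar R}.
Implicit Types f g : T -> R.

Definition itg (f : T -> R) : Prop := mu.-integrable setT (EFin \o f).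
Local Notation lint := (lint mu).

Lemma itg_meas f : itg f -> measurable_fun setT f.
Proof. by move=> /integrableP[/measurable_EFinP]. Qed.

Lemma int_EFin f : itg f -> (lint f)%:E = (\int[mu]_x (f x)%:E)%E.
Proof. by move=> h; rewrite !lint.unlock /Rintegral fineK//; exact: integrable_fin_num. Qed.

Lemma itg_le f g : measurable_fun setT f -> itg g ->
  (forall x, `|f x| <= g x) -> itg f.
Proof.
move=> mf ig fg; apply: (le_integrable measurableT _ _ ig).
  exact/measurable_EFinP.
by move=> x _ /=; rewrite lee_fin (le_trans (fg x))// ler_norm.
Qed.

Lemma itg_ge0 f (c : R) : measurable_fun setT f -> (forall x, 0 <= f x) ->
  (\int[mu]_x (f x)%:E <= c%:E)%E -> itg f.
Proof.
move=> mf f0 fc; apply/integrableP; split; first exact/measurable_EFinP.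
under eq_integral do rewrite /= ger0_norm//.
by rewrite (le_lt_trans fc)// ltry.
Qed.

Lemma itgD f g : itg f -> itg g -> itg (fun x => f x + g x).
Proof. by move=> h1 h2; exact: (integrableD _ h1 h2). Qed.

Lemma itgB f g : itg f -> itg g -> itg (fun x => f x - g x).
Proof. by move=> h1 h2; exact: (integrableB _ h1 h2). Qed.

Lemma itgZ f (c : R) : itg f -> itg (fun x => c * f x).
Proof. by move=> h1; exact: (integrableZl _ c h1). Qed.

Lemma itg0 : itg (fun=> 0).
Proof. exact: integrable0. Qed.

Lemma intD f g : itg f -> itg g -> lint (fun x => f x + g x) = lint f + lint g.
Proof. by move=> h1 h2; rewrite !lint.unlock RintegralD. Qed.

Lemma intB f g : itg f -> itg g -> lint (fun x => f x - g x) = lint f - lint g.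
Proof. by move=> h1 h2; rewrite !lint.unlock RintegralB. Qed.

Lemma intZ f (c : R) : itg f -> lint (fun x => c * f x) = c * lint f.
Proof. by move=> h1; rewrite !lint.unlock RintegralZl. Qed.

Lemma eq_int f g : f =1 g -> lint f = lint g.
Proof. by move=> fg; congr lint; exact/funext. Qed.

Lemma le_int f g : itg f -> itg g -> (forall x, f x <= g x) -> lint f <= lint g.
Proof. by move=> h1 h2 h; rewrite !lint.unlock; exact: le_Rintegral. Qed.

Lemma int_ge0 f : (forall x, 0 <= f x) -> 0 <= lint f.
Proof. by move=> h; rewrite lint.unlock; exact: Rintegral_ge0. Qed.

Lemma int0 : lint (fun=> 0) = 0.
Proof. by rewrite !lint.unlock /Rintegral integral0. Qed.

Lemma ge0_int_eq0 f : itg f -> (forall x, 0 <= f x) -> lint f <= 0 ->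
  {ae mu, forall x, f x = 0}.
Proof.
move=> h f0 fle; have e0 : lint f = 0 by apply/le_anti; rewrite fle int_ge0.
have : (\int[mu]_x `|(f x)%:E|)%E = 0%E.
  under eq_integral do rewrite /= ger0_norm//.
  by rewrite -int_EFin// e0.
have mf : measurable_fun setT (EFin \o f) by apply/measurable_EFinP; exact: itg_meas.
move=> /(ae_eq_integral_abs mu measurableT mf).
by apply: filterS => x /(_ Logic.I) /= [].
Qed.

Lemma dominated_int (f_ : nat -> T -> R) f g :
  (forall n, measurable_fun setT (f_ n)) -> itg g ->
  (forall n x, `|f_ n x| <= g x) ->
  (forall x, f_ n x @[n --> \oo] --> f x) ->
  itg f /\ lint (f_ n) @[n --> \oo] --> lint f.
Proof.
move=> mf ig fg ff.
have mf' : measurable_fun setT f.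
  by apply: (measurable_fun_cvg mf) => x _; exact: ff.
have fg' x : `|f x| <= g x.
  have : `|f_ n x| @[n --> \oo] --> `|f x| by apply: cvg_norm.
  by move=> h; apply: (cvgr_to_le h); exact: nearW.
have i_ n : itg (f_ n) by apply: itg_le ig _.
have i : itg f by exact: itg_le ig _.
split=> //.
have := @dominated_cvg _ _ _ mu setT measurableT (fun n => EFin \o f_ n)
  (EFin \o f) (EFin \o g).
move=> /(_ (fun n => (measurable_EFinP _ _).2 (mf n))) H.
have : (\int[mu]_x (f_ n x)%:E @[n --> \oo] --> \int[mu]_x (f x)%:E)%E.
  apply: H => //.
    by move=> x _; apply/fine_cvgP; split; [exact: nearW|exact: ff].
  by move=> n x _ /=; rewrite lee_fin.
rewrite -(int_EFin i) => /fine_cvgP[_].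
apply: cvg_trans; apply: near_eq_cvg; apply: nearW => n /=.
by rewrite !lint.unlock /Rintegral.
Qed.

End real_integrals.

(** * Change of variables under measure-preserving maps *)

Section measure_preserving.
Context d (T : measurableType d) (R : realType).
Variable mu : {measure set T -> \bar R}.
Variable phi : T -> T.
Hypothesis mphi : measurable_fun setT phi.
Hypothesis phi_pres : forall A, measurable A -> mu (phi @^-1` A) = mu A.

Lemma preserving_ge0 (f : T -> \bar R) : measurable_fun setT f ->
  (forall x, 0 <= f x)%E -> (\int[mu]_x f (phi x) = \int[mu]_x f x)%E.
Proof.
move=> mf f0; rewrite -(preimage_setT phi).
rewrite -(@ge0_integral_pushforward _ _ _ _ _ _ mphi mu setT f)//.
pose mphi' := isMeasurableFun.Build _ _ _ _ _ mphi.
pose psi : {mfun T >-> T} := HB.pack phi mphi'.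
apply: (@eq_measure_integral _ _ _ _ mu (pushforward mu psi)) => A mA _.
exact: phi_pres.
Qed.

Lemma preserving_int (f : T -> R) : itg mu f ->
  itg mu (f \o phi) /\ lint mu (f \o phi) = lint mu f.
Proof.
move=> i; have mf := itg_meas i.
have ge0 (g : T -> R) : itg mu g -> (forall x, 0 <= g x) ->
    itg mu (g \o phi) /\ lint mu (g \o phi) = lint mu g.
  move=> ig g0; have mg := itg_meas ig.
  have E : (\int[mu]_x (g (phi x))%:E = \int[mu]_x (g x)%:E)%E.
    by apply: (@preserving_ge0 (EFin \o g)) => //; exact/measurable_EFinP.
  have i' : itg mu (g \o phi).
    apply: (@itg_ge0 _ _ _ _ _ (lint mu g)) => //; first exact: measurableT_comp.
      by move=> x; exact: g0.
    by rewrite int_EFin// E.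
  by split=> //; apply: EFin_inj; rewrite !int_EFin.
(* f = (|f| + f) - |f| is a difference of nonnegative integrable functions, to which the nonnegative
   case applies. *)
pose g1 x := `|f x| + f x; pose g2 x := `|f x|.
have i2 : itg mu g2 by exact: integrable_norm.
have i1 : itg mu g1 by exact: itgD.
have [|j1 e1] := ge0 g1 i1.
  by move=> x; rewrite /g1 -lerBlDr sub0r (le_trans (ler_norm _))// normrN.
have [|j2 e2] := ge0 g2 i2; first by move=> x; exact: normr_ge0.
have E h : lint mu (f \o h) = lint mu (fun x => g1 (h x) - g2 (h x)).
  by apply: eq_int => x; rewrite /g1 /g2 addrAC subrr add0r.
split; last by rewrite (E phi) (E id) !intB// e1 e2.
rewrite (_ : f \o phi = fun x => g1 (phi x) - g2 (phi x)); first exact: itgB.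
by apply/funext => x; rewrite /g1 /g2 addrAC subrr add0r.
Qed.

End measure_preserving.

(** * Tonelli's theorem for real-valued integrals *)

Section tonelli.
Context d1 d2 (T1 : measurableType d1) (T2 : measurableType d2) (R : realType).
Variables (m1 : {sigma_finite_measure set T1 -> \bar R})
          (m2 : {sigma_finite_measure set T2 -> \bar R}).

Lemma tonelli_int (f : T1 * T2 -> R) : measurable_fun setT f ->
  (forall z, 0 <= f z) ->
  (forall x, itg m2 (fun y => f (x, y))) ->
  (forall y, itg m1 (fun x => f (x, y))) ->
  itg m1 (fun x => lint m2 (fun y => f (x, y))) ->
  itg m2 (fun y => lint m1 (fun x => f (x, y))) /\
  lint m1 (fun x => lint m2 (fun y => f (x, y))) =
  lint m2 (fun y => lint m1 (fun x => f (x, y))).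
Proof.
move=> mf f0 i2 i1 i12.
have mE : measurable_fun setT (EFin \o f) by exact/measurable_EFinP.
have f0E z : (0 <= (EFin \o f) z)%E by rewrite lee_fin.
have E := @fubini_tonelli _ _ _ _ _ m1 m2 _ mE f0E.
have E1 : (\int[m1]_x \int[m2]_y (EFin \o f) (x, y))%E =
    (\int[m1]_x (lint m2 (fun y => f (x, y)))%:E)%E.
  by apply: eq_integral => x _; rewrite int_EFin.
have E2 : (\int[m2]_y \int[m1]_x (EFin \o f) (x, y))%E =
    (\int[m2]_y (lint m1 (fun x => f (x, y)))%:E)%E.
  by apply: eq_integral => x _; rewrite int_EFin.
have m21 : measurable_fun setT (fun y => lint m1 (fun x => f (x, y))).
  apply/measurable_EFinP.
  rewrite (_ : _ \o _ = fubini_G m1 (EFin \o f)).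
    exact: measurable_fun_fubini_tonelli_G.
  by apply/funext => y; rewrite /fubini_G /= int_EFin.
have i21 : itg m2 (fun y => lint m1 (fun x => f (x, y))).
  apply: (@itg_ge0 _ _ _ _ _ (lint m1 (fun x => lint m2 (fun y => f (x, y))))) => //.
    by move=> y; exact: int_ge0.
  by rewrite -E2 -E E1 int_EFin.
split=> //; apply: EFin_inj; rewrite !int_EFin// -E1 -E2; exact: E.
Qed.

Lemma measurable_int (f : T1 * T2 -> R) : measurable_fun setT f ->
  (forall z, 0 <= f z) -> (forall x, itg m2 (fun y => f (x, y))) ->
  measurable_fun setT (fun x => lint m2 (fun y => f (x, y))).
Proof.
move=> mf f0 i2; apply/measurable_EFinP.
rewrite (_ : _ \o _ = fubini_F m2 (EFin \o f)).
  apply: measurable_fun_fubini_tonelli_F; first exact/measurable_EFinP.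
  by move=> z; rewrite lee_fin.
by apply/funext => y; rewrite /fubini_F /= int_EFin.
Qed.

End tonelli.

(** * Translations and reflections of the line *)

Section lebesgue_affine.
Variable R : realType.
Local Notation mu := (@lebesgue_measure R).

Lemma lebesgue_measure_shift (c : R) (A : set (measurableTypeR R)) : measurable A ->
  pushforward mu (fun x : measurableTypeR R => x + c : measurableTypeR R) A = mu A.
Proof.
move=> mA; have mc : measurable_fun setT (fun x : measurableTypeR R => x + c : measurableTypeR R).
  exact: measurable_funD.
pose mphi := isMeasurableFun.Build _ _ _ _ _ mc.
pose phi : {mfun measurableTypeR R >-> measurableTypeR R} := HB.pack (fun x => x + c) mphi.
apply/esym; apply: (@lebesgue_measure_unique R (pushforward mu phi)) => //= _ [[a b]] _ <-.
rewrite /pushforward (_ : _ @^-1` _ = `]a - c, b - c]%classic).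
  rewrite !lebesgue_measure_itv/= !lte_fin ltrD2r.
  by case: ifP => // _; rewrite -!EFinB opprB addrA subrK.
by apply/seteqP; split => x /=; rewrite !in_itv/= ltrBlDr lerBrDr.
Qed.

Lemma lebesgue_measure_reflect (c : R) (A : set (measurableTypeR R)) : measurable A ->
  mu ((fun x : measurableTypeR R => c - x : measurableTypeR R) @^-1` A) = mu A.
Proof.
move=> mA; rewrite (_ : _ @^-1` A = (-%R : _ -> measurableTypeR R) @^-1`
    ((fun x : measurableTypeR R => x + c : measurableTypeR R) @^-1` A)).
  rewrite -(lebesgue_measure_shift c mA) -[RHS]lebesgue_measureN//.
  rewrite -[X in measurable X]setTI; apply: measurable_funD => //.
by apply/seteqP; split => x /=; rewrite addrC.
Qed.

Lemma int_reflect (c : R) (f : R -> R) : itg mu f ->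
  itg mu (fun x => f (c - x)) /\ lint mu (fun x => f (c - x)) = lint mu f.
Proof.
apply: preserving_int; first exact: measurable_funB.
exact: lebesgue_measure_reflect.
Qed.

End lebesgue_affine.

(** * Convolution with nonnegative kernels *)

HB.lock Definition conv (R : realType) (k g : R -> R) : R -> R :=
  fun t => lint (@lebesgue_measure R) (fun s => k (t - s) * g s).

Section convolution.
Variable R : realType.
Local Notation mu := (@lebesgue_measure R).
Local Notation itg := (itg (@lebesgue_measure R)).
Local Notation lint := (lint (@lebesgue_measure R)).
Implicit Types k l g h : R -> R.

(** Nonnegativity makes Tonelli's theorem applicable; boundedness makes the convolution with an
    integrable kernel finite at every point. *)
Definition nnbm g : Prop :=
  measurable_fun setT g /\ exists M, forall x, 0 <= g x <= M.

(** Kernels are also bounded, so that a shifted kernel can itself be the test function [h] of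
    [conv_adjoint]. *)
Definition kern k : Prop := nnbm k /\ itg k.

Definition rflx k : R -> R := fun x => k (- x).

Lemma nnbm_ge0 g x : nnbm g -> 0 <= g x.
Proof. by move=> [_ [M /(_ x)/andP[]]]. Qed.

Lemma kern_ge0 k x : kern k -> 0 <= k x.
Proof. by move=> [/nnbm_ge0]. Qed.

Lemma nnbm_bound g : nnbm g -> exists2 M, 0 < M & forall x, `|g x| <= M.
Proof.
move=> [_ [M gM]]; exists (`|M| + 1); first by rewrite ltr_wpDl.
move=> x; have /andP[g0 gM'] := gM x.
by rewrite ger0_norm// (le_trans gM')// (le_trans (ler_norm _))// lerDl.
Qed.

Lemma nnbm_cst (c : R) : 0 <= c -> nnbm (fun=> c).
Proof. by move=> c0; split=> //; exists c => _; rewrite c0 lexx. Qed.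

Lemma nnbmM g h : nnbm g -> nnbm h -> nnbm (fun x => g x * h x).
Proof.
move=> [mg [M gM]] [mh [M' hM']]; split; first exact: measurable_funM.
exists (M * M') => x; have /andP[? ?] := gM x; have /andP[? ?] := hM' x.
by rewrite mulr_ge0//= ler_pM.
Qed.

Lemma nnbmD g h : nnbm g -> nnbm h -> nnbm (fun x => g x + h x).
Proof.
move=> [mg [M gM]] [mh [M' hM']]; split; first exact: measurable_funD.
exists (M + M') => x; have /andP[? ?] := gM x; have /andP[? ?] := hM' x.
by rewrite addr_ge0//= lerD.
Qed.

Lemma nnbmZ (c : R) g : 0 <= c -> nnbm g -> nnbm (fun x => c * g x).
Proof. by move=> c0; apply: nnbmM; exact: nnbm_cst. Qed.

Lemma itgMnnbm k g : itg k -> nnbm g -> itg (fun x => k x * g x).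
Proof.
move=> ik ng; have [M M0 gM] := nnbm_bound ng.
apply: (@itg_le _ _ _ mu _ (fun x => M * `|k x|)).
- by apply: measurable_funM; [exact: (itg_meas ik)|exact: ng.1].
- by apply: itgZ; exact: integrable_norm.
- by move=> x; rewrite normrM mulrC ler_wpM2r.
Qed.

Lemma measurable_rflx k : measurable_fun setT k -> measurable_fun setT (rflx k).
Proof. by move=> mk; apply: measurableT_comp. Qed.

Lemma kern_rflx k : kern k -> kern (rflx k).
Proof.
move=> [[mk [M kM]] ik]; split; first by split; [exact: measurable_rflx|exists M => x; exact: kM].
have [+ _] := int_reflect 0 ik.
by rewrite (_ : (fun x => _) = rflx k)//; apply/funext => x; rewrite /rflx sub0r.
Qed.

Lemma kern_shiftr k (t : R) : kern k -> kern (fun s => k (t - s)).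
Proof.
move=> [[mk [M kM]] ik]; split; last by have [] := int_reflect t ik.
split; last by exists M => x; exact: kM.
by apply: measurableT_comp => //; exact: measurable_funB.
Qed.

Lemma itg_conv k g t : kern k -> nnbm g -> itg (fun s => k (t - s) * g s).
Proof. by move=> /(kern_shiftr t)[_ ik] ng; exact: itgMnnbm. Qed.

Lemma measurable_kern2 k : measurable_fun setT k ->
  measurable_fun setT (fun z : R * R => k (z.1 - z.2)).
Proof. by move=> mk; apply: measurableT_comp => //; exact: measurable_funB. Qed.

Lemma nnbm_conv k g : kern k -> nnbm g -> nnbm (conv k g).
Proof.
move=> kk ng; rewrite conv.unlock; split.
  apply: (@measurable_int _ _ (measurableTypeR R) (measurableTypeR R) R mu (fun z => k (z.1 - z.2) * g z.2)).
  - apply: measurable_funM; first exact: measurable_kern2 kk.1.1.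
    exact: measurableT_comp ng.1 _.
  - by move=> z; rewrite mulr_ge0 ?(kern_ge0 _ kk) ?(nnbm_ge0 _ ng).
  - by move=> x; exact: itg_conv.
have [M M0 gM] := nnbm_bound ng; exists (M * lint k) => t; apply/andP; split.
  by apply: int_ge0 => s; rewrite mulr_ge0 ?(kern_ge0 _ kk) ?(nnbm_ge0 _ ng).
have [ik <-] := int_reflect t kk.2; rewrite -intZ//; apply: le_int.
- exact: itg_conv.
- exact: itgZ.
- move=> s; rewrite mulrC ler_wpM2r ?(kern_ge0 _ kk)//.
  exact: le_trans (ler_norm _) (gM s).
Qed.

Lemma conv_ge0 k g t : kern k -> nnbm g -> 0 <= conv k g t.
Proof. by move=> kk ng; apply: nnbm_ge0; exact: nnbm_conv. Qed.

Lemma le_conv k g h t : kern k -> nnbm g -> nnbm h -> (forall x, g x <= h x) ->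
  conv k g t <= conv k h t.
Proof.
move=> kk ng nh gh; rewrite !conv.unlock; apply: le_int; [exact: itg_conv..|].
by move=> s; rewrite ler_wpM2l ?(kern_ge0 _ kk).
Qed.

Lemma convZ k (c : R) g t : kern k -> nnbm g ->
  conv k (fun x => c * g x) t = c * conv k g t.
Proof.
move=> kk ng; rewrite !conv.unlock -intZ; last exact: itg_conv.
by apply: eq_int => s; rewrite mulrCA.
Qed.

Lemma convD k g h t : kern k -> nnbm g -> nnbm h ->
  conv k (fun x => g x + h x) t = conv k g t + conv k h t.
Proof.
move=> kk ng nh; rewrite !conv.unlock -intD; [|exact: itg_conv..].
by apply: eq_int => s; rewrite mulrDr.
Qed.

Lemma conv1 k t : kern k -> conv k (fun=> 1) t = lint k.
Proof.
move=> kk; have [_ <-] := int_reflect t kk.2; rewrite conv.unlock.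
by apply: eq_int => s; rewrite mulr1.
Qed.

Lemma convC k g t : kern k -> nnbm g ->
  itg (fun s => k s * g (t - s)) /\ conv k g t = lint (fun s => k s * g (t - s)).
Proof.
move=> kk ng; have [i E] := int_reflect t (itg_conv t kk ng).
rewrite !conv.unlock -E.
rewrite (_ : (fun x => _ * g (t - x)) = (fun x => k (t - (t - x)) * g (t - x))).
  by split.
by apply/funext => s; rewrite subKr.
Qed.

Lemma conv_adjoint k g h : kern k -> nnbm g -> nnbm h ->
  itg (fun t => h t * conv k g t) ->
  itg (fun s => conv (rflx k) h s * g s) /\
  lint (fun t => h t * conv k g t) = lint (fun s => conv (rflx k) h s * g s).
Proof.
move=> kk ng nh ih.
pose f (z : R * R) := h z.1 * (k (z.1 - z.2) * g z.2).
have mf : measurable_fun setT f.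
  apply: measurable_funM; first exact: measurableT_comp nh.1 _.
  apply: measurable_funM; first exact: measurable_kern2 kk.1.1.
  exact: measurableT_comp ng.1 _.
have f0 z : 0 <= f z.
  by rewrite !mulr_ge0 ?(kern_ge0 _ kk) ?(nnbm_ge0 _ ng) ?(nnbm_ge0 _ nh).
have E1 t : lint (fun s => f (t, s)) = h t * conv k g t.
  by rewrite conv.unlock -intZ//; exact: itg_conv.
have i1 t : itg (fun s => k (t - s) * g s) by exact: itg_conv.
have i2 s : itg (fun t => rflx k (s - t) * h t).
  by apply: itg_conv => //; exact: kern_rflx.
have E2 s : lint (fun t => f (t, s)) = conv (rflx k) h s * g s.
  rewrite mulrC conv.unlock -intZ//; apply: eq_int => t.
  by rewrite /f /= /rflx opprB; ring.
have [] := @tonelli_int _ _ (measurableTypeR R) (measurableTypeR R) R mu mu f mf f0.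
- by move=> t; exact: (itgZ (h t) (i1 t)).
- move=> s; have := itgZ (g s) (i2 s).
  rewrite (_ : (fun x => _) = fun t => f (t, s))//.
  apply/funext => t; rewrite /f /= /rflx opprB; ring.
- by rewrite (funext E1 : (fun t => _) = _).
by rewrite (funext E1 : (fun t => _) = _) (funext E2 : (fun t => _) = _).
Qed.

(** This is [conv_adjoint] with the shifted kernel [k (t - s)] as test function. *)
Lemma conv_conv k l g t : kern k -> kern l -> nnbm g ->
  conv k (conv l g) t = lint (fun s => lint (fun r => k (t - r) * l (r - s)) * g s).
Proof.
move=> kk kl ng.
have nkt := (kern_shiftr t kk).1.
have [i E] := conv_adjoint kl ng nkt (itg_conv t kk (nnbm_conv kl ng)).
transitivity (lint (fun s => k (t - s) * conv l g s)); first by rewrite conv.unlock.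
rewrite E; apply: eq_int => s; congr (_ * _).
rewrite conv.unlock; apply: eq_int => r; by rewrite /rflx opprB mulrC.
Qed.

(** The reflection r -> t + s - r exchanges the two factors of the composed kernel. *)
Lemma conv_comm k l g t : kern k -> kern l -> nnbm g ->
  conv k (conv l g) t = conv l (conv k g) t.
Proof.
move=> kk kl ng; rewrite !conv_conv//; apply: eq_int => s; congr (_ * _).
have i : itg (fun r => k (t - r) * l (r - s)).
  have := itgMnnbm (kern_shiftr t kk).2 (kern_shiftr s (kern_rflx kl)).1.
  rewrite (_ : (fun x => _) = fun r => k (t - r) * l (r - s))//.
  by apply/funext => r; rewrite /rflx opprB.
rewrite -[LHS](int_reflect (t + s) i).2; apply: eq_int => r.
by rewrite mulrC; congr (l _ * k _); ring.
Qed.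

(** Cauchy-Schwarz for the weight [k (t - s)], from 2 c h <= h^2 + c^2 with the optimal constant c,
    the weighted mean of h. *)
Lemma conv_sqr_le k h t : kern k -> nnbm h -> 0 < lint k ->
  conv k h t ^+ 2 <= lint k * conv k (fun x => h x ^+ 2) t.
Proof.
move=> kk nh k0; set v := conv k h t; set K := lint k; set c := v / K.
have n2 : nnbm (fun x => h x ^+ 2) by exact: nnbmM.
have c0 : 0 <= c by apply: divr_ge0; [exact: conv_ge0|exact: ltW].
have : 2 * c * v <= conv k (fun x => h x ^+ 2) t + c ^+ 2 * K.
  have -> : K = conv k (fun=> 1) t by rewrite conv1.
  rewrite -!convZ//; last exact: nnbm_cst.
  rewrite -convD//; last by apply: nnbm_cst; rewrite mulr1 exprn_ge0.
  apply: le_conv => //; first by apply: nnbmZ => //; rewrite mulr_ge0.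
    by apply: nnbmD => //; apply: nnbm_cst; rewrite mulr1 exprn_ge0.
  by move=> x; have := sqr_ge0 (h x - c); nra.
have -> : 2 * c * v = 2 * (v ^+ 2 / K) by rewrite /c; ring.
have -> : c ^+ 2 * K = v ^+ 2 / K by rewrite /c; field; exact: lt0r_neq0.
move=> le2; have : v ^+ 2 / K <= conv k (fun x => h x ^+ 2) t by lra.
by rewrite ler_pdivrMr// mulrC.
Qed.

Lemma conv_L1 k g : kern k -> nnbm g -> itg g ->
  itg (conv k g) /\ lint (conv k g) = lint k * lint g.
Proof.
move=> kk ng ig; have krk := kern_rflx kk.
have E1 t : g t * conv (rflx k) (fun=> 1) t = lint k * g t.
  rewrite conv1// mulrC; congr (_ * _).
  have [_ <-] := int_reflect 0 kk.2; apply: eq_int => x.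
  by rewrite /rflx sub0r.
have := @conv_adjoint (rflx k) (fun=> 1) g krk (nnbm_cst ler01) ng.
rewrite (_ : (fun t => g t * _) = fun t => lint k * g t); last exact/funext.
move=> /(_ (itgZ _ ig)).
rewrite (_ : rflx (rflx k) = k); last by apply/funext => x; rewrite /rflx opprK.
rewrite (_ : (fun s => _ * 1) = conv k g); last by apply/funext => x; rewrite mulr1.
by move=> [? <-]; rewrite intZ.
Qed.

Lemma conv_L2 k h : kern k -> nnbm h -> 0 < lint k -> itg (fun x => h x ^+ 2) ->
  itg (fun x => conv k h x ^+ 2) /\
  lint (fun x => conv k h x ^+ 2) <= lint k ^+ 2 * lint (fun x => h x ^+ 2).
Proof.
move=> kk nh k0 ih.
have n2 : nnbm (fun x => h x ^+ 2) by exact: nnbmM.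
have [i2 E2] := conv_L1 kk n2 ih.
have i : itg (fun x => conv k h x ^+ 2).
  apply: (@itg_le _ _ _ mu) (itgZ (lint k) i2) _; first exact: (nnbmM (nnbm_conv kk nh) (nnbm_conv kk nh)).1.
  by move=> x; rewrite ger0_norm ?sqr_ge0//; exact: conv_sqr_le.
split=> //; rewrite expr2 -mulrA -E2 -intZ//; apply: le_int => //; first exact: itgZ.
by move=> x; exact: conv_sqr_le.
Qed.

(** Evenness is included: |x| = |y| gives both inequalities. *)
Definition evdec g : Prop := forall x y, `|x| <= `|y| -> g y <= g x.

(** Averaging the integrand of the difference with its reflection s -> t + t' - s turns it into the
    product (k s - k (t + t' - s)) (g (t - s) - g (t' - s)), whose factors never have opposite
    signs. *)
Lemma evdec_conv k g : kern k -> nnbm g -> evdec k -> evdec g -> evdec (conv k g).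
Proof.
move=> kk ng dk dg t t' tt'.
have [i1 ->] := convC t kk ng; have [i2 ->] := convC t' kk ng.
rewrite -subr_ge0 -intB//.
set h := fun s => k s * g (t - s) - k s * g (t' - s).
have ih : itg h by exact: itgB.
have [ir Er] := int_reflect (t + t') ih.
suff : 0 <= lint h + lint (fun x => h (t + t' - x)) by rewrite Er; lra.
rewrite -intD//; apply: int_ge0 => s; rewrite /h.
have -> : t - (t + t' - s) = - (t' - s) by ring.
have -> : t' - (t + t' - s) = - (t - s) by ring.
have ev f x : evdec f -> f (- x) = f x.
  by move=> df; apply/le_anti; rewrite !df// normrN.
rewrite !(ev g)//.
have -> : forall a b c e : R, a * c - a * e + (b * e - b * c) = (a - b) * (c - e).
  by move=> *; ring.
have sq (x y : R) : x ^+ 2 <= y ^+ 2 -> `|x| <= `|y| 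
  by move=> xy; rewrite -ler_sqr ?nnegrE// !real_normK ?num_real.
have tt2 : t ^+ 2 <= t' ^+ 2 
  by rewrite -(real_normK (num_real t)) -(real_normK (num_real t')) ler_sqr ?nnegrE.
set m := t + t'.
(* The signs of the two factors are decided by differences of squares. Their product is nonnegative,
   so when one is negative and the other is not, the latter is 0 and the corresponding factor
   vanishes. *)
have A : 0 <= (m * (m - 2 * s)) * ((t' - t) * (m - 2 * s)).
  have -> : (m * (m - 2 * s)) * ((t' - t) * (m - 2 * s)) =
    (t' ^+ 2 - t ^+ 2) * (m - 2 * s) ^+ 2 by rewrite /m; ring.
  by rewrite mulr_ge0 ?sqr_ge0// subr_ge0.
have Ek : (m - s) ^+ 2 - s ^+ 2 = m * (m - 2 * s) by ring.
have Eg : (t' - s) ^+ 2 - (t - s) ^+ 2 = (t' - t) * (m - 2 * s) by rewrite /m; ring.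
have [p1|p1] := leP 0 (m * (m - 2 * s)); have [p2|p2] := leP 0 ((t' - t) * (m - 2 * s)).
- apply: mulr_ge0; rewrite subr_ge0; [apply: dk|apply: dg]; apply: sq; lra.
- have e0 : m * (m - 2 * s) = 0.
    by apply/eqP; rewrite eq_le p1 andbT; rewrite leNgt; apply/negP => q; nra.
  have -> : k (m - s) = k s by apply/le_anti; rewrite !dk//; apply: sq; lra.
  by rewrite subrr mul0r.
- have e0 : (t' - t) * (m - 2 * s) = 0.
    by apply/eqP; rewrite eq_le p2 andbT; rewrite leNgt; apply/negP => q; nra.
  have -> : g (t - s) = g (t' - s) by apply/le_anti; rewrite !dg//; apply: sq; lra.
  by rewrite subrr mulr0.
- apply: mulr_le0; rewrite subr_le0; [apply: dk|apply: dg]; apply: sq; lra.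
Qed.

End convolution.

(** * Green's kernel of (l1^2 - D^2)(l2^2 - D^2) *)

Section green_kernels.
Variable R : realType.
Local Notation mu := (@lebesgue_measure R).
Local Notation itg := (itg (@lebesgue_measure R)).
Local Notation lint := (lint (@lebesgue_measure R)).
Implicit Types (k g h : R -> R) (l : R).

Lemma int_gt0 g : itg g -> (forall x, 0 < g x) -> 0 < lint g.
Proof.
move=> ig g0; rewrite ltNge; apply/negP => /(ge0_int_eq0 ig (fun x => ltW (g0 x))).
move=> [A [mA A0 sA]].
have AT : A = setT.
  by apply/seteqP; split => // x _; apply: sA => /= gx; have := g0 x; rewrite gx ltxx.
have E := @lebesgue_measure_itv R `]-oo, +oo[; rewrite set_itvNyy /= in E.
have : mu A = +oo%E by rewrite AT; exact: E.
by rewrite A0.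
Qed.

(** [ek l] is the causal Green's function of D + l, its reflection that of l - D, and [sk l] that of
    l^2 - D^2 = (l + D)(l - D). *)
Definition ek l : R -> R := fun t => if 0 <= t then expR (- l * t) else 0.
Definition sk l : R -> R := fun t => (2 * l)^-1 * expR (- l * `|t|).

Lemma ek_ge0 l t : 0 <= ek l t.
Proof. by rewrite /ek; case: ifP => // _; exact: expR_ge0. Qed.

(** The exponential distribution supplies integrability and the total mass. *)
Lemma ek_pdf l : 0 < l -> ek l = fun t => l^-1 * exponential_pdf l t.
Proof.
move=> l0; apply/funext => t; rewrite /ek; case: ifPn => t0.
  by rewrite exponential_pdfE// mulKf// gt_eqF.
by rewrite lt0_exponential_pdf ?mulr0// ltNge.
Qed.

Lemma itg_ek l : 0 < l -> itg (ek l) /\ lint (ek l) = l^-1.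
Proof.
move=> l0; have i : itg (exponential_pdf l) by exact: integrable_exponential_pdf.
rewrite ek_pdf//; split; first exact: itgZ.
rewrite intZ//; suff -> : lint (exponential_pdf l) = 1 by rewrite mulr1.
by apply: EFin_inj; rewrite int_EFin// integral_exponential_pdf.
Qed.

Lemma kern_ek l : 0 < l -> kern (ek l).
Proof.
move=> l0; split; last exact: (itg_ek l0).1.
split; first exact: (itg_meas (itg_ek l0).1).
exists 1 => t; rewrite ek_ge0/= /ek; case: ifP => // t0.
by rewrite -expR0 ler_expR mulNr oppr_le0 mulr_ge0 // ltW.
Qed.

Lemma sk_gt0 l t : 0 < l -> 0 < sk l t.
Proof. by move=> l0; apply: mulr_gt0; rewrite ?expR_gt0// invr_gt0 mulr_gt0. Qed.

Lemma kern_sk l : 0 < l -> kern (sk l).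
Proof.
move=> l0; have msk : measurable_fun setT (sk l).
  apply: measurable_funM => //; apply: measurableT_comp => //.
  by apply: measurable_funM => //; exact: measurableT_comp.
have l20 : 0 <= (2 * l)^-1 by rewrite invr_ge0 mulr_ge0 ?ltW.
split; first split => //.
  exists (2 * l)^-1 => t; rewrite ltW ?sk_gt0//= /sk ler_piMr//.
  by rewrite -expR0 ler_expR mulNr oppr_le0 mulr_ge0 // ltW.
have [_ i1] := kern_ek l0; have [_ i2] := kern_rflx (kern_ek l0).
apply: (@itg_le _ _ _ mu _ _ msk (itgZ (2 * l)^-1 (itgD i1 i2))) => t.
rewrite ger0_norm; last exact/ltW/sk_gt0.
rewrite /sk; apply: ler_wpM2l => //; rewrite /rflx.
have [t0|t0] := leP 0 t.
  by rewrite /ek t0 ger0_norm// lerDl; case: ifP => // _; exact: expR_ge0.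
by rewrite {2}/ek oppr_ge0 (ltW t0) ltr0_norm// lerDr ek_ge0.
Qed.

Lemma evdec_sk l : 0 < l -> evdec (sk l).
Proof.
move=> l0 x y xy; rewrite /sk; apply: ler_wpM2l.
  by rewrite invr_ge0 mulr_ge0// ltW.
by rewrite ler_expR !mulNr lerN2 ler_pM2l.
Qed.

(** Both factors are supported on r <= min(t, s), where (t - r) + (s - r) = |t - s| + 2 (min(t, s) -
    r). *)
Lemma ek_ek l t s : 0 < l ->
  lint (fun r => ek l (t - r) * rflx (ek l) (r - s)) = sk l (t - s).
Proof.
move=> l0; have l20 : 0 < 2 * l by rewrite mulr_gt0.
pose m := Num.min t s.
have E r : ek l (t - r) * rflx (ek l) (r - s) =
    expR (- l * `|t - s|) * ek (2 * l) (m - r).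
  rewrite /rflx opprB /ek !subr_ge0 /m le_min.
  case: ifPn => //= rt; last by rewrite mul0r mulr0.
  case: ifPn => //= rs; last by rewrite !mulr0.
  rewrite -!expRD; congr expR.
  by case: (leP t s) => ts; [rewrite ler0_norm ?subr_le0//|
    rewrite ger0_norm ?subr_ge0 1?ltW//]; ring.
rewrite (@eq_int _ (measurableTypeR R) R mu _ _ E); have [i I] := int_reflect m (itg_ek l20).1.
by rewrite intZ// I (itg_ek l20).2 mulrC.
Qed.

(** This factorization serves twice: for the positivity of T, and to differentiate one first-order
    kernel at a time. *)
Lemma conv_sk l g t : 0 < l -> nnbm g ->
  conv (sk l) g t = conv (ek l) (conv (rflx (ek l)) g) t.
Proof.
move=> l0 ng; have ke := kern_ek l0; have kr := kern_rflx ke.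
by rewrite conv_conv// conv.unlock; apply: eq_int => s; rewrite ek_ek.
Qed.

Lemma int_rflx k : itg k -> lint (rflx k) = lint k.
Proof.
move=> ik; have [_ <-] := int_reflect 0 ik.
by apply: eq_int => x; rewrite /rflx sub0r.
Qed.

Lemma int_sk l : 0 < l -> lint (sk l) = (l ^+ 2)^-1.
Proof.
move=> l0; have ke := kern_ek l0; have kr := kern_rflx ke.
rewrite -(conv1 0 (kern_sk l0)) conv_sk//; last exact: nnbm_cst.
rewrite (_ : conv (rflx (ek l)) _ = fun=> l^-1 * 1).
  rewrite convZ ?conv1//; last exact: nnbm_cst.
  by rewrite (itg_ek l0).2 -expr2 exprVn.
by apply/funext => x; rewrite conv1// int_rflx ?(itg_ek l0).2 ?mulr1//; exact: (itg_ek l0).1.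
Qed.

Section T.
Variables l1 l2 : R.
Hypotheses (l10 : 0 < l1) (l20 : 0 < l2).

Definition Tg g := conv (sk l1) (conv (sk l2) g).

Let k1 := kern_sk l10.
Let k2 := kern_sk l20.

Let n2 g : nnbm g -> nnbm (conv (sk l2) g).
Proof. exact: nnbm_conv. Qed.

Lemma nnbm_Tg g : nnbm g -> nnbm (Tg g).
Proof. by move=> ng; apply: nnbm_conv => //; exact: n2. Qed.

Lemma le_Tg g h t : nnbm g -> nnbm h -> (forall x, g x <= h x) -> Tg g t <= Tg h t.
Proof.
by move=> ng nh gh; apply: le_conv; [|exact: n2..|move=> x; exact: le_conv].
Qed.

Lemma TgZ (c : R) g t : 0 <= c -> nnbm g -> Tg (fun x => c * g x) t = c * Tg g t.
Proof.
move=> c0 ng; rewrite /Tg (_ : conv (sk l2) _ = fun x => c * conv (sk l2) g x).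
  by rewrite convZ//; exact: n2.
by apply/funext => x; rewrite convZ.
Qed.

Lemma TgD g h t : nnbm g -> nnbm h -> Tg (fun x => g x + h x) t = Tg g t + Tg h t.
Proof.
move=> ng nh; rewrite /Tg
  (_ : conv (sk l2) _ = fun x => conv (sk l2) g x + conv (sk l2) h x).
  by rewrite convD//; exact: n2.
by apply/funext => x; rewrite convD.
Qed.

Lemma evdec_Tg g : nnbm g -> evdec g -> evdec (Tg g).
Proof.
move=> ng dg; apply: evdec_conv => //; [exact: n2|exact: evdec_sk|].
by apply: evdec_conv => //; exact: evdec_sk.
Qed.

(** A Harnack inequality: by the triangle inequality the kernels at t and t' differ by at most the
    factor e^(l |t - t'|), whatever g is. It later gives equicontinuity, positivity and lower
    profiles. *)
Lemma conv_sk_loglip l g t t' : 0 < l -> nnbm g ->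
  expR (- l * `|t - t'|) * conv (sk l) g t' <= conv (sk l) g t.
Proof.
move=> l0 ng; have kk := kern_sk l0.
rewrite !conv.unlock -intZ; last exact: itg_conv.
apply: le_int.
- by apply: itgZ; exact: itg_conv.
- exact: itg_conv.
move=> s; rewrite mulrA ler_wpM2r ?(nnbm_ge0 _ ng)// /sk mulrCA.
rewrite ler_pM2l ?invr_gt0 ?mulr_gt0// -expRD ler_expR -mulrDr !mulNr lerN2.
rewrite ler_pM2l// (le_trans _ (ler_normD _ _))// le_eqVlt; apply/orP; left.
by apply/eqP; congr `|_|; ring.
Qed.

Lemma Tg_loglip g t t' : nnbm g ->
  expR (- l1 * `|t - t'|) * Tg g t' <= Tg g t.
Proof. by move=> ng; apply: conv_sk_loglip => //; exact: n2. Qed.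

Lemma conv_gt0 l g t : 0 < l -> nnbm g -> (forall x, 0 < g x) -> 0 < conv (sk l) g t.
Proof.
move=> l0 ng g0; rewrite conv.unlock; apply: int_gt0; first by apply: itg_conv => //; exact: kern_sk.
by move=> s; rewrite mulr_gt0 ?sk_gt0.
Qed.

Lemma Tg_gt0 g t : nnbm g -> (forall x, 0 < g x) -> 0 < Tg g t.
Proof.
move=> ng g0; apply: conv_gt0 => //; first exact: n2.
by move=> x; exact: conv_gt0.
Qed.

(** The inverse of the total mass of the kernel of T, hence the bottom of the spectrum of (l1^2 -
    D^2)(l2^2 - D^2). *)
Let gap := (l1 * l2) ^+ 2.

Lemma Tg_L2 g : nnbm g -> itg (fun x => g x ^+ 2) ->
  itg (fun x => Tg g x ^+ 2) /\
  gap ^+ 2 * lint (fun x => Tg g x ^+ 2) <= lint (fun x => g x ^+ 2).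
Proof.
move=> ng ig.
have p1 : 0 < lint (sk l1) by rewrite int_sk ?invr_gt0 ?exprn_gt0.
have p2 : 0 < lint (sk l2) by rewrite int_sk ?invr_gt0 ?exprn_gt0.
have [i2 L2] := conv_L2 k2 ng p2 ig.
have [i1 L1] := conv_L2 k1 (n2 ng) p1 i2.
split=> //; rewrite -ler_pdivlMl ?exprn_gt0 ?mulr_gt0//.
apply: (le_trans L1); rewrite -ler_pdivlMl ?exprn_gt0//; apply: (le_trans L2).
rewrite !int_sk// /gap mulrA ler_wpM2r ?int_ge0//; first by move=> x; exact: sqr_ge0.
by rewrite le_eqVlt; apply/orP; left; apply/eqP; field; rewrite !gt_eqF.
Qed.

Lemma itg_mulTg g h : nnbm g -> nnbm h -> itg (fun x => g x ^+ 2) ->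
  itg (fun x => h x ^+ 2) -> itg (fun x => h x * Tg g x).
Proof.
move=> ng nh ig ih; have [iT _] := Tg_L2 ng ig.
apply: (@itg_le _ _ _ mu _ _ _ (itgD ih iT)).
  exact: (nnbmM nh (nnbm_Tg ng)).1.
move=> x; rewrite ger0_norm ?mulr_ge0 ?(nnbm_ge0 _ nh) ?(nnbm_ge0 _ (nnbm_Tg ng))//.
by have := sqr_ge0 (h x - Tg g x); have := sqr_ge0 (h x + Tg g x); nra.
Qed.

Let U g := conv (rflx (ek l1)) (conv (rflx (ek l2)) g).

(* Tg = U^* U because convolutions commute, which makes Tg positive semidefinite. *)
Let Tg_factor g h : nnbm g -> nnbm h -> itg (fun x => h x * Tg g x) ->
  itg (fun x => U h x * U g x) /\
  lint (fun x => h x * Tg g x) = lint (fun x => U h x * U g x).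
Proof.
move=> ng nh.
have e1 := kern_ek l10; have e2 := kern_ek l20.
have r1 := kern_rflx e1; have r2 := kern_rflx e2.
pose X := conv (rflx (ek l2)) g; have nX : nnbm X by exact: nnbm_conv.
pose Y := conv (rflx (ek l2)) h; have nY : nnbm Y by exact: nnbm_conv.
have E : Tg g = conv (ek l2) (conv (sk l1) X).
  apply/funext => t; rewrite conv_comm// /Tg; congr conv.
  by apply/funext => x; rewrite conv_sk.
rewrite E => i.
have [iY ->] := conv_adjoint e2 (nnbm_conv k1 nX) nh i.
rewrite -/Y in iY *.
have E2 : conv (sk l1) X = conv (ek l1) (U g).
  by apply/funext => t; rewrite conv_sk.
rewrite E2 in iY *.
exact: (conv_adjoint e1 (nnbm_conv r1 nX) nY iY).
Qed.

(** Positivity of <h - g, T (h - g)>, written in expanded form because a difference leaves the class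
    of nonnegative functions. *)
Lemma Tg_psd g h : nnbm g -> nnbm h -> itg (fun x => g x ^+ 2) ->
  itg (fun x => h x ^+ 2) ->
  2 * lint (fun x => h x * Tg g x) <=
  lint (fun x => h x * Tg h x) + lint (fun x => g x * Tg g x).
Proof.
move=> ng nh ig ih.
have [j1 ->] := Tg_factor ng nh (itg_mulTg ng nh ig ih).
have [j2 ->] := Tg_factor nh nh (itg_mulTg nh nh ih ih).
have [j3 ->] := Tg_factor ng ng (itg_mulTg ng ng ig ig).
rewrite -intZ// -intD//; apply: le_int; [exact: itgZ|exact: itgD|].
by move=> x; have := sqr_ge0 (U h x - U g x); nra.
Qed.

(** The operator inequality gap T^2 <= T without spectral calculus: [Tg_psd] with h = gap T g,
    together with the bound 1 / gap for the norm of T on L^2. *)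
Lemma Tg_coercive g : nnbm g -> itg (fun x => g x ^+ 2) ->
  gap * lint (fun x => Tg g x ^+ 2) <= lint (fun x => g x * Tg g x).
Proof.
move=> ng ig; have nT := nnbm_Tg ng; have [iT _] := Tg_L2 ng ig.
have g0 : 0 < gap by rewrite exprn_gt0 ?mulr_gt0.
pose h x := gap * Tg g x.
have nh : nnbm h by apply: nnbmZ => //; exact: ltW.
have ih : itg (fun x => h x ^+ 2).
  by rewrite (_ : (fun x => _) = fun x => gap ^+ 2 * Tg g x ^+ 2); [exact: itgZ|
    apply/funext => x; rewrite /h exprMn].
have P := Tg_psd ng nh ig ih.
have [iTT LTT] := Tg_L2 nT iT.
have iTTT := itg_mulTg nT nT iT iT.
have E1 : lint (fun x => h x * Tg g x) = gap * lint (fun x => Tg g x ^+ 2).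
  by rewrite -intZ//; apply: eq_int => x; rewrite /h -mulrA.
have E2 : lint (fun x => h x * Tg h x) = gap ^+ 2 * lint (fun x => Tg g x * Tg (Tg g) x).
  by rewrite -intZ//; apply: eq_int => x; rewrite /h TgZ ?(ltW g0)//; ring.
have S : gap * lint (fun x => Tg g x * Tg (Tg g) x) <= lint (fun x => Tg g x ^+ 2).
  have : 2 * (gap * lint (fun x => Tg g x * Tg (Tg g) x)) <=
      lint (fun x => Tg g x ^+ 2) + gap ^+ 2 * lint (fun x => Tg (Tg g) x ^+ 2).
    rewrite -!intZ// -?intD//; last 2 first.
    - exact: itgZ.
    - exact: itgZ.
    apply: le_int; [by do 2 apply: itgZ|by apply: itgD => //; exact: itgZ|].
    by move=> x; have := sqr_ge0 (Tg g x - gap * Tg (Tg g) x); nra.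
  lra.
move: P S; rewrite E1 E2 expr2 -mulrA.
set a := lint _; set b := lint _; set c := lint (fun x => g x * _) => P S.
have : gap * (gap * b) <= gap * a by rewrite ler_wpM2l// ltW.
lra.
Qed.

End T.
End green_kernels.

(** * Real powers and Young's inequality *)

Section powers.
Variable R : realType.
Local Notation mu := (@lebesgue_measure R).
Local Notation itg := (itg (@lebesgue_measure R)).
Local Notation lint := (lint (@lebesgue_measure R)).
Implicit Types a b r t : R.

Lemma powR_B1 a r : 0 <= a -> 1 < r -> a `^ (r - 1) * a = a `^ r.
Proof. by move=> a0 r1; rewrite mulrC mulr_powRB1//; lra. Qed.

Lemma powR_B2 a r : 0 <= a -> 2 < r -> a `^ (r - 2) * a = a `^ (r - 1).
Proof.
move=> a0 r2; rewrite -(@powR_B1 a (r - 1))//; last lra.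
by congr (_ `^ _ * _); ring.
Qed.

Lemma powR_B2sqr a r : 0 <= a -> 2 < r -> a `^ (r - 2) * a ^+ 2 = a `^ r.
Proof. by move=> a0 r2; rewrite expr2 mulrA powR_B2// powR_B1//; lra. Qed.

(** Young's inequality for the product of b^2 and a^(r - 2), with conjugate exponents r / 2 and r /
    (r - 2). *)
Lemma powR_young a b r : 0 <= a -> 0 <= b -> 2 < r ->
  a `^ (r - 2) * b ^+ 2 <= 2 / r * b `^ r + (1 - 2 / r) * a `^ r.
Proof.
move=> a0 b0 r2.
have := @conjugate_powR R (b ^+ 2) (a `^ (r - 2)) (r / 2) (r / (r - 2)).
have e1 : (b ^+ 2) `^ (r / 2) = b `^ r.
  by rewrite -powR_mulrn// -powRrM; congr (_ `^ _); field.
have e2 : (a `^ (r - 2)) `^ (r / (r - 2)) = a `^ r.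
  by rewrite -powRrM; congr (_ `^ _); field; rewrite gt_eqF; lra.
rewrite e1 e2 => H; rewrite [leLHS]mulrC; apply: le_trans (H _ _ _ _ _) _.
- exact: sqr_ge0.
- exact: powR_ge0.
- by apply: divr_gt0; lra.
- by apply: divr_gt0; lra.
- by field; rewrite !gt_eqF//; lra.
rewrite le_eqVlt; apply/orP; left; apply/eqP.
by field; rewrite !gt_eqF//; lra.
Qed.

Lemma cvg_powR (u : nat -> R) a r : 0 < a -> u n @[n --> \oo] --> a ->
  u n `^ r @[n --> \oo] --> a `^ r.
Proof.
move=> a0 ua.
have c : {for a, continuous (fun y : R => y `^ r)}.
  apply: differentiable_continuous; apply/derivable1_diffP.
  by apply: derivable_powR; rewrite in_itv/= a0.
exact: (cvg_comp _ _ ua c).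
Qed.

Lemma nnbm_powR (g : R -> R) r : 0 <= r -> nnbm g -> nnbm (fun x => g x `^ r).
Proof.
move=> r0 [mg [M gM]]; split.
  by apply: (measurableT_comp (measurable_powR r)).
exists (M `^ r) => x; have /andP[g0 gM'] := gM x; rewrite powR_ge0/=.
by rewrite ge0_ler_powR// nnegrE// (le_trans g0).
Qed.

(** Makes the envelope of the minimizing sequence integrable: it decays like |x|^(-1/2), and its
    powers above the second are needed. *)
Lemma itg_powD r : 1 < r -> itg (fun x => (1 + `|x|) `^ (- r)).
Proof.
move=> r1; pose f (x : R) : R := (1 + `|x|) `^ (- r); change (itg f).
have f0 x : 0 <= f x by exact: powR_ge0.
have dp (x : R) s : 0 <= x -> is_derive x 1 (fun y => (1 + y) `^ s) (s * (1 + x) `^ (s - 1)).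
  move=> x0; have h : is_derive (1 + x) 1 (fun y : R => y `^ s) (s * (1 + x) `^ (s - 1)).
    apply: DeriveDef; first by apply: derivable_powR; rewrite in_itv/=; lra.
    by rewrite -derive1E powR_derive1// in_itv/=; lra.
  have h2 : is_derive x 1 (cst 1 + id : R -> R) (0 + 1) by exact: is_deriveD.
  have := @is_derive1_comp _ (fun y : R => y `^ s) (cst 1 + id : R -> R) x _ _ h h2.
  by rewrite add0r mulr1.
have cf : continuous f.
  move=> x; have -> : f = (fun y => (1 + y) `^ (- r)) \o (fun y => `|y|) by [].
  apply: continuous_comp; first exact: norm_continuous.
  apply: differentiable_continuous; apply/derivable1_diffP.
  by apply: ex_derive; apply: dp.
apply: (@itg_ge0 _ _ _ mu _ (2 * (r - 1)^-1)) => //.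
  exact: continuous_measurable_fun.
rewrite ge0_symfun_integralT//; last by move=> x; rewrite /f /= normrN.
have -> : [set x : R | 0 <= x] = `[0, +oo[%classic by rewrite set_itvcy.
rewrite EFinM lee_pmul2l//.
have -> : (\int[mu]_(x in `[0%R, +oo[) (f x)%:E =
    \int[mu]_(x in `[0%R, +oo[) ((1 + x) `^ (- r))%:E)%E.
  by apply: eq_integral => x; rewrite inE/= in_itv/= andbT => x0; rewrite /f ger0_norm.
pose F (x : R) : R := - (r - 1)^-1 * (1 + x) `^ (1 - r).
have dF (x : R) : 0 <= x -> is_derive x 1 F ((1 + x) `^ (- r)).
  move=> x0; have h := @is_deriveZ _ _ _ _ (- (r - 1)^-1) x 1 _ (dp x (1 - r) x0).
  have E : (1 + x) `^ (- r) = - (r - 1)^-1 *: ((1 - r) * (1 + x) `^ (1 - r - 1)).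
    rewrite (_ : 1 - r - 1 = - r); last ring.
    by rewrite /GRing.scale/=; field; rewrite gt_eqF//; lra.
  by rewrite E.
rewrite (@ge0_continuous_FTC2y _ _ F 0 0).
- by rewrite /F addr0 powR1 mulr1 sub0e -EFinN opprK.
- by move=> x _; exact: powR_ge0.
- apply: continuous_in_subspaceT => x; rewrite inE/= in_itv/= andbT => x0.
  apply: differentiable_continuous; apply/derivable1_diffP.
  by apply: ex_derive; apply: dp.
- rewrite /F -(mulr0 (- (r - 1)^-1)); apply: cvgMr.
  apply: (@cvg_trans _ (expR (- ((r - 1) * ln (1 + y))) @[y --> +oo])).
    apply: near_eq_cvg; near=> y; rewrite /powR gt_eqF; last by rewrite ltr_pwDl.
    by congr expR; ring.
  apply: (@cvg_comp _ _ _ (fun y : R => (r - 1) * ln (1 + y)) _ _ (+oo%R) _ _ (@cvgr_expR R)).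
  apply/cvgryPge => A; near=> y.
  rewrite mulrC -ler_pdivrMr; last lra.
  rewrite -(expRK (A / (r - 1))) ler_ln ?posrE ?expR_gt0//; last first.
    by rewrite ltr_pwDl//; near: y; exact: nbhs_pinfty_ge.
  apply: (@le_trans _ _ y); last by rewrite lerDr.
  by near: y; exact: nbhs_pinfty_ge.
- by move=> x x0; apply: ex_derive; apply: dF; exact: ltW.
- apply/cvg_at_right_filter; apply: differentiable_continuous; apply/derivable1_diffP.
  by apply: ex_derive; apply: dF.
- move=> x; rewrite in_itv/= andbT => x0; rewrite derive1E.
  by apply: derive_val; apply: dF; exact: ltW.
Unshelve. all: by end_near. Qed.

End powers.

(** * Pointwise compactness and decay of monotone functions *)

Section compactness.
Variable R : realType.
Local Notation mu := (@lebesgue_measure R).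
Local Notation itg := (itg (@lebesgue_measure R)).
Local Notation lint := (lint (@lebesgue_measure R)).

(** Tychonoff's theorem in a product of copies of [0, M]. A neighbourhood in the product topology
    controls finitely many points, hence the finite families [x]. *)
Lemma ptws_cluster (M : R) (y : nat -> R -> R) : (forall n x, 0 <= y n x <= M) ->
  exists w : R -> R, forall (k m : nat) (x : 'I_m -> R) (e : R), 0 < e ->
    exists2 n, (k <= n)%N & forall i, `|w (x i) - y n (x i)| < e.
Proof.
move=> yM; pose X := @prod_topology R (fun=> R).
have cK := @tychonoff R (fun=> R) (fun=> `[0, M]%classic) (fun=> @segment_compact R 0 M).
pose F : set_system X := (fun n => y n : X) @ \oo.
have [w [_ cw]] : [set f : X | forall i, `[0, M]%classic (f i)] `&` cluster F !=set0.
  have PF : ProperFilter F by exact: fmap_proper_filter.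
  apply: (cK F PF).
  by exists 0%N => // n _ i /=; rewrite in_itv/=; exact: yM.
exists w => k m x e e0.
have FA : F [set g : X | exists2 n, (k <= n)%N & g = y n].
  by exists k => // n /= kn; exists n.
have wB : nbhs (w : X) [set g : X | forall i, `|w (x i) - g (x i)| < e].
  have FN : Filter (nbhs (w : X)) by exact: nbhs_filter.
  apply: (@filter_forall X 'I_m (fun i => [set g : X | `|w (x i) - g (x i)| < e]) _ FN) => i.
  have /cvgrPdist_lt /(_ _ e0) := @proj_continuous R (fun=> R) (x i) w.
  exact.
by have [_ [[n kn ->] /= H]] := cw _ _ FA wB; exists n.
Qed.

(** Arzela-Ascoli: closeness on ever finer and longer grids spreads to all points by the common
    Lipschitz constant. The bound [k <= phi k] keeps a minimizing sequence minimizing. *)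
Lemma lipschitz_extract (M L : R) (y : nat -> R -> R) : 0 <= L ->
  (forall n x, 0 <= y n x <= M) ->
  (forall n x x', `|y n x - y n x'| <= L * `|x - x'|) ->
  exists (w : R -> R) (phi : nat -> nat), (forall k, (k <= phi k)%N) /\
    forall x, y (phi k) x @[k --> \oo] --> w x.
Proof.
move=> L0 yM yL; have [w Hw] := ptws_cluster yM; exists w.
have wL x x' : `|w x - w x'| <= L * `|x - x'|.
  apply/ler_addgt0Pr => e e0.
  have [n _ Hn] := Hw 0 2 (fun i => if i == ord0 then x else x') (e / 2)
    (divr_gt0 e0 (ltr0Sn _ _)).
  have := Hn ord0; have := Hn (lift ord0 ord0) => /=.
  have := yL n x x'; rewrite !ltr_norml ler_norml => /andP[? ?] /andP[? ?] /andP[? ?].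
  by rewrite ler_norml; apply/andP; split; lra.
(* The grid has mesh 1 / (k + 1) and runs from -(k + 1) to k + 1, which takes 2 (k + 1)^2 + 1
   points. *)
pose grid (k : nat) (i : 'I_(2 * k.+1 ^ 2).+1) : R := i%:R / k.+1%:R - k.+1%:R.
have /choice[phi Hphi] : forall k, exists n, (k <= n)%N /\
    forall i, `|w (grid k i) - y n (grid k i)| < k.+1%:R^-1.
  move=> k; have [|n kn Hn] := Hw k _ (grid k) k.+1%:R^-1; first by rewrite invr_gt0.
  by exists n.
exists phi; split=> [k|x]; first exact: (Hphi k).1.
apply/cvgrPdist_le => e e0.
have C0 : 0 < 2 * L + 1 by lra.
near=> k.
have k0 : 0 < k.+1%:R :> R by [].
have xk : `|x| <= k.+1%:R.
  apply: (@le_trans _ _ k%:R); last by rewrite ler_nat.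
  by near: k; exact: nbhs_infty_ger.
have ek : (2 * L + 1) * k.+1%:R^-1 <= e.
  rewrite ler_pdivrMr// [leRHS]mulrC -ler_pdivrMr//.
  apply: (@le_trans _ _ k%:R); last by rewrite ler_nat.
  by near: k; exact: nbhs_infty_ger.
pose t := (x + k.+1%:R) * k.+1%:R.
have t0 : 0 <= t by rewrite mulr_ge0//; move: xk; rewrite ler_norml; lra.
have tl : (Num.truncn t < (2 * k.+1 ^ 2).+1)%N.
  rewrite ltnS -(ler_nat R); apply: (@le_trans _ _ t); first by rewrite truncn_le.
  rewrite natrM natrX /t expr2 mulrA ler_wpM2r//.
  by move: xk; rewrite ler_norml; lra.
pose i := Ordinal tl.
have xi : `|x - grid k i| <= k.+1%:R^-1.
  have -> : x - grid k i = (t - (Num.truncn t)%:R) / k.+1%:R.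
    by rewrite /grid /t /=; field; rewrite gt_eqF.
  rewrite normrM (ger0_norm (_ : 0 <= k.+1%:R^-1)) ?invr_ge0//.
  rewrite ler_piMl ?invr_ge0// ger0_norm ?subr_ge0 ?truncn_le//.
  by rewrite lerBlDr; have /ltW := truncnS_gt t; rewrite -natr1 addrC.
have H1 := wL x (grid k i); have H2 := (Hphi k).2 i; have H3 := yL (phi k) x (grid k i).
have H4 : L * `|x - grid k i| <= L * k.+1%:R^-1 by rewrite ler_wpM2l.
apply: le_trans ek; rewrite mulrDl mul1r -mulrA.
have F (p1 p2 p3 p4 a b c : R) : `|p1 - p2| <= a -> `|p2 - p3| < c ->
    `|p4 - p3| <= a -> a <= b -> `|p1 - p4| <= 2 * b + c.
  rewrite !ler_norml ltr_norml => /andP[? ?] /andP[? ?] /andP[? ?] ?.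
  by apply/andP; split; lra.
exact: F H1 H2 H3 H4.
Unshelve. all: by end_near. Qed.

Lemma cvg_conv (k : R -> R) (g_ : nat -> R -> R) (g : R -> R) (M t : R) :
  kern k -> (forall n, nnbm (g_ n)) -> (forall n x, g_ n x <= M) ->
  (forall x, g_ n x @[n --> \oo] --> g x) ->
  conv k (g_ n) t @[n --> \oo] --> conv k g t.
Proof.
move=> kk ng gM gg; rewrite conv.unlock.
apply: (@dominated_int _ _ R mu (fun n s => k (t - s) * g_ n s) _
  (fun s => M * k (t - s)) _ _ _ _).2.
- by move=> n; exact: (itg_meas (itg_conv t kk (ng n))).
- by apply: itgZ; exact: (kern_shiftr t kk).2.
- move=> n s; rewrite ger0_norm; last by rewrite mulr_ge0 ?(kern_ge0 _ kk) ?(nnbm_ge0 _ (ng n)).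
  by rewrite mulrC ler_wpM2r ?(kern_ge0 _ kk).
- by move=> s; apply: cvgMr; exact: gg.
Qed.

(** By monotonicity g is at least [g x] on the interval [-|x|, |x|] of length 2 |x|. *)
Lemma evdec_L2_decay (g : R -> R) x : nnbm g -> evdec g -> itg (fun s => g s ^+ 2) ->
  2 * `|x| * g x ^+ 2 <= lint (fun s => g s ^+ 2).
Proof.
move=> ng dg ig.
pose I := `[- `|x|, `|x|]%classic : set R.
have iI : itg (fun s : R => \1_I s).
  by apply: integrable_indic_itv.
have -> : 2 * `|x| * g x ^+ 2 = lint (fun s => g x ^+ 2 * \1_I s).
  rewrite intZ// mulrC; congr (_ * _); apply: EFin_inj; rewrite int_EFin//.
  rewrite integral_indic//=; last exact: measurable_itv.
  rewrite setIT lebesgue_measure_itv/= lte_fin.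
  case: ifPn => [_|]; first by rewrite -EFinB; congr EFin; ring.
  by rewrite -leNgt => h; congr EFin; have := normr_ge0 x; lra.
refine (@le_int _ (measurableTypeR R) R mu _ _ (itgZ _ iI) ig _).
move=> s; rewrite indicE; case: (boolP (s \in I)) => [|_].
  rewrite inE /I/= in_itv/= -ler_norml mulr1 => sx.
  by rewrite ler_sqr ?nnegrE ?(nnbm_ge0 _ ng)//; exact: dg.
by rewrite mulr0 sqr_ge0.
Qed.

End compactness.

(** * Ground states of the one-dimensional problem *)

Section nehari.
Variable R : realType.
Local Notation mu := (@lebesgue_measure R).
Local Notation itg := (itg (@lebesgue_measure R)).
Local Notation lint := (lint (@lebesgue_measure R)).
Variables q p c l1 l2 : R.
Hypotheses (q2 : 2 < q) (p2 : 2 < p) (c0 : 0 < c) (l10 : 0 < l1) (l20 : 0 < l2).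
Implicit Types w z y : R -> R.

Let q0 : q != 0. Proof. by move: q2 => h; rewrite gt_eqF//; lra. Qed.
Let p0 : p != 0. Proof. by move: p2 => h; rewrite gt_eqF//; lra. Qed.
Let q10 : 0 <= q - 1. Proof. by move: q2 => h; lra. Qed.
Let p10 : 0 <= p - 1. Proof. by move: p2 => h; lra. Qed.
Let q20 : 0 <= q - 2. Proof. by move: q2 => h; lra. Qed.
Let q1 : 1 < q. Proof. by move: q2 => h; lra. Qed.
Let p20 : 0 <= p - 2. Proof. by move: p2 => h; lra. Qed.
Let p1 : 1 < p. Proof. by move: p2 => h; lra. Qed.

Local Notation T := (Tg l1 l2).

Definition nonlin w : R -> R := fun x => c * (w x `^ (q - 1) + w x `^ (p - 1)).
(* At a solution w = T (nonlin w) one has NN w = AA w, and II w is its energy. *)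
Definition aa (r : R) w : R := lint (fun x => w x `^ r).
Definition NN w : R := c * (aa q w + aa p w).
Definition AA w : R := lint (fun x => nonlin w x * T (nonlin w) x).
Definition II w : R := c * ((2^-1 - q^-1) * aa q w + (2^-1 - p^-1) * aa p w).
Definition base w : Prop :=
  [/\ nnbm w, evdec w, itg (fun x => w x `^ q) & itg (fun x => w x `^ p)].

Lemma itg_powR_L2 (r : R) w : 2 < r -> nnbm w -> itg (fun x => w x ^+ 2) ->
  itg (fun x => w x `^ r).
Proof.
move=> r2 nw iw; rewrite (_ : (fun x => _) = fun x => w x ^+ 2 * w x `^ (r - 2)).
  by apply: itgMnnbm => //; apply: nnbm_powR => //; lra.
by apply/funext => x; rewrite mulrC powR_B2sqr ?(nnbm_ge0 _ nw).
Qed.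

Lemma nnbm_nonlin w : nnbm w -> nnbm (nonlin w).
Proof.
move=> nw; apply: nnbmZ; first exact: ltW.
by apply: nnbmD; apply: nnbm_powR.
Qed.

Lemma nonlin_gt0 w x : 0 < w x -> 0 < nonlin w x.
Proof. by move=> w0; rewrite /nonlin mulr_gt0// addr_gt0// powR_gt0. Qed.

Lemma evdec_nonlin w : nnbm w -> evdec w -> evdec (nonlin w).
Proof.
move=> nw dw x y xy; rewrite /nonlin ler_pM2l// lerD//.
all: by rewrite ge0_ler_powR ?nnegrE ?(nnbm_ge0 _ nw) ?dw.
Qed.

Lemma nonlinM w x : nnbm w -> nonlin w x * w x = c * (w x `^ q + w x `^ p).
Proof.
by move=> nw; rewrite /nonlin -mulrA mulrDl !powR_B1 ?(nnbm_ge0 _ nw).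
Qed.

Lemma itg_nonlinM w : base w -> itg (fun x => nonlin w x * w x) /\
  lint (fun x => nonlin w x * w x) = NN w.
Proof.
move=> [nw _ iq ip].
have E : (fun x => nonlin w x * w x) = (fun x => c * (w x `^ q + w x `^ p)).
  by apply/funext => x; exact: nonlinM.
by rewrite E /NN /aa -intD// -intZ; [split=> //; apply: itgZ|]; exact: itgD.
Qed.

(** w^(2 (r - 1)) = w^r w^(r - 2) is an integrable function times a bounded one. This puts
    [nonlin w] in the L^2 theory of T. *)
Lemma itg_nonlin2 w : base w -> itg (fun x => nonlin w x ^+ 2).
Proof.
move=> [nw _ iq ip].
have i (r : R) : 2 < r -> itg (fun x => w x `^ r) ->
    itg (fun x => (w x `^ (r - 1)) ^+ 2).
  move=> r2 ir; rewrite (_ : (fun x => _) = fun x => w x `^ r * w x `^ (r - 2)).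
    by apply: itgMnnbm => //; apply: nnbm_powR => //; lra.
  apply/funext => x; have w0 := nnbm_ge0 x nw.
  by rewrite expr2 -{1}(powR_B2 w0 r2) -(@powR_B1 _ (w x) r)//; [ring|lra].
apply: (@itg_le _ _ _ mu _ _ _ (itgZ (2 * c ^+ 2) (itgD (i q q2 iq) (i p p2 ip)))).
  by apply: (nnbmM (nnbm_nonlin nw) (nnbm_nonlin nw)).1.
move=> x; rewrite ger0_norm ?sqr_ge0// /nonlin.
set a := w x `^ _; set b := w x `^ _.
rewrite exprMn [leRHS](_ : _ = c ^+ 2 * (2 * (a ^+ 2 + b ^+ 2))); last by ring.
rewrite ler_wpM2l ?sqr_ge0//.
by have := sqr_ge0 (a - b); nra.
Qed.

Lemma itg_nonlinT w z : base w -> base z -> itg (fun x => nonlin z x * T (nonlin w) x).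
Proof.
move=> bw bz; have [nw _ _ _] := bw; have [nz _ _ _] := bz.
by apply: itg_mulTg => //; [exact: nnbm_nonlin|exact: nnbm_nonlin|exact: itg_nonlin2..].
Qed.

Lemma base_T w : base w -> base (T (nonlin w)) /\ itg (fun x => T (nonlin w) x ^+ 2).
Proof.
move=> bw; have [nw dw iq ip] := bw; have nf := nnbm_nonlin nw.
have [i2 _] := Tg_L2 l10 l20 nf (itg_nonlin2 bw).
split=> //; split; [exact: nnbm_Tg| |exact: (itg_powR_L2 q2 (nnbm_Tg l10 l20 nf))|
  exact: (itg_powR_L2 p2 (nnbm_Tg l10 l20 nf))].
by apply: evdec_Tg => //; exact: evdec_nonlin.
Qed.

Lemma baseZ (t : R) w : 0 <= t -> base w -> base (fun x => t * w x).
Proof.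
move=> t0 [nw dw iq ip]; split.
- exact: nnbmZ.
- by move=> x y xy; rewrite ler_wpM2l// dw.
- rewrite (_ : (fun x => _) = fun x => t `^ q * w x `^ q); first exact: itgZ.
  by apply/funext => x; rewrite powRM// (nnbm_ge0 _ nw).
- rewrite (_ : (fun x => _) = fun x => t `^ p * w x `^ p); first exact: itgZ.
  by apply/funext => x; rewrite powRM// (nnbm_ge0 _ nw).
Qed.

Lemma aaZ (r t : R) w : 0 <= t -> nnbm w -> itg (fun x => w x `^ r) ->
  aa r (fun x => t * w x) = t `^ r * aa r w.
Proof.
move=> t0 nw ir; rewrite /aa -intZ//; apply: eq_int => x.
by rewrite powRM// (nnbm_ge0 _ nw).
Qed.

(** Division by t^2 and t = e^s turn the equation into phi s = A, to which the intermediate value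
    theorem applies: at [s1] each term is at most A / 2, at [s2] the first term alone equals A. *)
Lemma sum_powR_onto (a b A : R) : 0 < a -> 0 < b -> 0 < A ->
  exists2 t, 0 < t & a * t `^ q + b * t `^ p = t ^+ 2 * A.
Proof.
move=> a0 b0 A0.
pose phi (s : R) : R := a * expR ((q - 2) * s) + b * expR ((p - 2) * s).
pose s2 := ln (A / a) / (q - 2).
pose s1 := Num.min (ln (A / a / 2) / (q - 2)) (ln (A / b / 2) / (p - 2)).
have q2' : 0 < q - 2 by rewrite subr_gt0.
have p2' : 0 < p - 2 by rewrite subr_gt0.
have Aa : 0 < A / a by exact: divr_gt0.
have Ab : 0 < A / b by exact: divr_gt0.
have s12 : s1 <= s2.
  rewrite /s1 ge_min; apply/orP; left; rewrite /s2 ler_pM2r ?invr_gt0//.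
  by rewrite ler_ln ?posrE ?divr_gt0//; lra.
have P1 : phi s1 <= A.
  have h (k e : R) : 0 < k -> 0 < e -> s1 <= ln (A / e / 2) / k ->
      e * expR (k * s1) <= A / 2.
    move=> k0 e0 le1; rewrite mulrC -ler_pdivlMr//.
    rewrite (_ : A / 2 / e = A / e / 2); last by field; rewrite gt_eqF.
    rewrite -[leRHS]lnK ?posrE ?divr_gt0// ler_expR mulrC -ler_pdivlMr//.
  have := h _ _ q2' a0; have := h _ _ p2' b0; rewrite /phi /s1 !ge_min !lexx/= orbT.
  by move=> /(_ isT) ? /(_ isT) ?; lra.
have P2 : A <= phi s2.
  have : a * expR ((q - 2) * s2) = A.
    rewrite /s2 mulrCA divff ?gt_eqF// mulr1 lnK ?posrE// mulrC divfK// gt_eqF//.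
  by rewrite /phi => ->; rewrite lerDl mulr_ge0// ?expR_ge0// ltW.
have cphi : continuous phi.
  have ce (k : R) : continuous (fun s : R => expR (k * s)).
    move=> s; apply: (@continuous_comp _ _ _ (fun s : R => k * s) expR).
      exact: mulrl_continuous.
    exact: continuous_expR.
  by move=> s; apply: cvgD; apply: cvgMr; exact: ce.
have [|s _ <-] := @IVT R phi s1 s2 A s12 (continuous_subspaceT cphi).
  by rewrite (min_idPl _) ?(max_idPr _) ?P1 ?P2// (le_trans P1).
exists (expR s); first exact: expR_gt0.
have E (r : R) : expR s `^ r = expR s ^+ 2 * expR ((r - 2) * s).
  by rewrite -expRM -expRM_natl -expRD; congr expR; ring.
by rewrite !E /phi; ring.
Qed.

(** T (nonlin w) is largest at 0, so a zero there would force [AA w] to vanish; the Harnack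
    inequality carries positivity from 0 to x. *)
Lemma T_gt0 w x : base w -> 0 < AA w -> 0 < T (nonlin w) x.
Proof.
move=> bw A0; have [nw dw _ _] := bw; have nf := nnbm_nonlin nw; have nT := nnbm_Tg l10 l20 nf.
have [[_ dT _ _] _] := base_T bw.
have T0 : 0 < T (nonlin w) 0.
  rewrite ltNge; apply/negP => T0; move: A0; rewrite /AA.
  rewrite (_ : (fun x => _) = (fun=> 0)); first by rewrite int0 ltxx.
  apply/funext => t; have -> : T (nonlin w) t = 0; last by rewrite mulr0.
  apply/le_anti; rewrite (nnbm_ge0 _ nT) andbT (le_trans _ T0)//.
  by apply: dT; rewrite normr0.
apply: lt_le_trans (Tg_loglip l10 l20 x 0 nf).
by rewrite mulr_gt0// expR_gt0.
Qed.

(** [nonlin w] is [omega w] times w: freezing this weight makes the equation linear, and it is the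
    weight of the L^2 distance gained in [improve]. *)
Definition omega w : R -> R := fun x => c * (w x `^ (q - 2) + w x `^ (p - 2)).

(* One step of "solve the linear problem, then rescale onto the Nehari manifold". *)
Lemma improve w : base w -> 0 < AA w -> exists t, let z := T (nonlin w) in
  let y := fun x => t * z x in
  [/\ 0 < t, base y, itg (fun x => y x ^+ 2) /\ t ^+ 2 * AA w = NN y,
      0 < NN y <= AA y &
      NN w <= AA w -> itg (fun x => omega w x * (z x - w x) ^+ 2) /\
        II y + 2^-1 * t ^+ 2 * lint (fun x => omega w x * (z x - w x) ^+ 2) <= II w].
Proof.
move=> bw A0; set z := T (nonlin w); have [bz iz2] := base_T bw.
have [nz dz izq izp] := bz; have [nw dw iwq iwp] := bw.
have pz (r : R) x : 0 < z x `^ r by apply: powR_gt0; exact: T_gt0.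
have [|||t t0 Et] := @sum_powR_onto (c * aa q z) (c * aa p z) (AA w).
- by rewrite mulr_gt0// int_gt0.
- by rewrite mulr_gt0// int_gt0.
- by [].
exists t => /=; set y := fun x => t * z x.
have by_ : base y by apply: baseZ => //; exact: ltW.
have [ny dy iyq iyp] := by_.
have EN : t ^+ 2 * AA w = NN y.
  by rewrite -Et /NN /y !aaZ ?(ltW t0)//; ring.
have iy2 : itg (fun x => y x ^+ 2).
  rewrite (_ : (fun x => _) = fun x => t ^+ 2 * z x ^+ 2); first exact: itgZ.
  by apply/funext => x; rewrite exprMn.
split=> //.
  rewrite -EN mulr_gt0 ?exprn_gt0//=.
  (* Since T (t f w) = y, positivity for the pair t f w, f y reads 2 NN y <= AA y + t^2 AA w, and
     t^2 AA w = NN y by the choice of t. *)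
  have P := @Tg_psd _ _ _ l10 l20 (fun x => t * nonlin w x) (nonlin y)
    (nnbmZ (ltW t0) (nnbm_nonlin nw)) (nnbm_nonlin ny).
  have E1 : (fun x => nonlin y x * T (fun x => t * nonlin w x) x) = (fun x => nonlin y x * y x).
    by apply/funext => x; rewrite TgZ ?(ltW t0)//; exact: nnbm_nonlin.
  have E2 : lint (fun x => t * nonlin w x * T (fun x => t * nonlin w x) x) = t ^+ 2 * AA w.
    rewrite /AA -intZ; last exact: itg_nonlinT.
    by apply: eq_int => x; rewrite TgZ ?(ltW t0)//; [ring|exact: nnbm_nonlin].
  rewrite E1 E2 (itg_nonlinM by_).2 EN in P.
  have := P _ (itg_nonlin2 by_); rewrite -/(AA y) => H.
  suff : 2 * NN y <= AA y + NN y by lra.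
  apply: H; rewrite (_ : (fun x => _) = fun x => t ^+ 2 * nonlin w x ^+ 2).
    by apply: itgZ; exact: itg_nonlin2.
  by apply/funext => x; rewrite exprMn.
move=> NA.
have now : nnbm (omega w).
  by apply: nnbmZ; [exact: ltW|apply: nnbmD; apply: nnbm_powR].
have ioz : itg (fun x => omega w x * z x ^+ 2).
  by under eq_fun do rewrite mulrC; exact: itgMnnbm.
have iA : itg (fun x => nonlin w x * z x) by exact: itg_nonlinT.
have [iN EN'] := itg_nonlinM bw.
have Ew x : omega w x * w x = nonlin w x.
  by rewrite /omega /nonlin -mulrA mulrDl !powR_B2// ?(nnbm_ge0 _ nw).
have Esq : (fun x => omega w x * (z x - w x) ^+ 2) =
    (fun x => omega w x * z x ^+ 2 + (nonlin w x * w x - 2 * (nonlin w x * z x))).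
  by apply/funext => x; rewrite -!Ew; ring.
have isq : itg (fun x => nonlin w x * w x - 2 * (nonlin w x * z x)).
  by apply: itgB => //; exact: itgZ.
split; first by rewrite Esq; exact: itgD.
rewrite Esq intD// intB//; last exact: itgZ.
rewrite intZ// EN' -/(AA w).
(* Young's inequality for w^(r - 2) y^2, integrated. Its right side is NN y - 2 II y + 2 II w. On
   the other hand, expanding the square and using NN w <= AA w bounds the integral of omega (z -
   w)^2 by that of omega z^2 minus AA w; multiplication by t^2 / 2 and t^2 AA w = NN y give the
   claim. *)
have Y : t ^+ 2 * lint (fun x => omega w x * z x ^+ 2) <=
    c * (2 / q * aa q y + (1 - 2 / q) * aa q w) +
    c * (2 / p * aa p y + (1 - 2 / p) * aa p w).
  have iG (r : R) : itg (fun x => y x `^ r) -> itg (fun x => w x `^ r) ->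
      itg (fun x => 2 / r * y x `^ r + (1 - 2 / r) * w x `^ r) /\
      lint (fun x => 2 / r * y x `^ r + (1 - 2 / r) * w x `^ r) =
      2 / r * aa r y + (1 - 2 / r) * aa r w.
    by move=> i j; rewrite intD ?intZ//; [split=> //; apply: itgD|..]; exact: itgZ.
  have [i1 <-] := iG q iyq iwq; have [i2 <-] := iG p iyp iwp.
  rewrite -mulrDr -!intZ// -intD// -intZ; last exact: itgD.
  apply: le_int; [exact: itgZ|apply: itgZ; exact: itgD|].
  move=> x; have -> : t ^+ 2 * (omega w x * z x ^+ 2) =
      c * (w x `^ (q - 2) * y x ^+ 2 + w x `^ (p - 2) * y x ^+ 2).
    by rewrite /omega /y; ring.
  rewrite ler_pM2l// lerD//;
    by apply: powR_young => //; [exact: nnbm_ge0|exact: nnbm_ge0].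
have EI : II y = 2^-1 * NN y - 2^-1 * (c * (2 / q * aa q y) + c * (2 / p * aa p y)).
  by rewrite /II /NN; field; rewrite q0 p0.
have EI' : II w = 2^-1 * (c * ((1 - 2 / q) * aa q w) + c * ((1 - 2 / p) * aa p w)).
  by rewrite /II; field; rewrite q0 p0.
rewrite EI EI' -EN; move: Y NA.
set oz := lint _; set Aw := AA w; set Nw := NN w => Y NA.
have : t ^+ 2 * Nw <= t ^+ 2 * Aw by rewrite ler_wpM2l ?sqr_ge0.
move: Y; rewrite !mulrDr; move: (t ^+ 2) => t2.
move: (c * (2 / q * _)) (c * (2 / p * _)) (c * ((1 - _) * aa q w)) (c * ((1 - _) * aa p w)).
by move=> *; lra.
Qed.

End nehari.

(** * Existence of a minimizer *)

Section ground_state.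
Variable R : realType.
Local Notation mu := (@lebesgue_measure R).
Local Notation itg := (itg (@lebesgue_measure R)).
Local Notation lint := (lint (@lebesgue_measure R)).
Variables q p c l1 l2 : R.
Hypotheses (q2 : 2 < q) (p2 : 2 < p) (c0 : 0 < c) (l10 : 0 < l1) (l20 : 0 < l2).
Implicit Types w z y : R -> R.
Local Notation T := (Tg l1 l2).
Local Notation base := (base q p).
Local Notation ff := (nonlin q p c).
Local Notation NN := (NN q p c).
Local Notation AA := (AA q p c l1 l2).
Local Notation II := (II q p c).
Local Notation omega := (omega q p c).
Let gap := (l1 * l2) ^+ 2.

Let gap0 : 0 < gap. Proof. by rewrite exprn_gt0// mulr_gt0. Qed.

(** The Nehari condition is relaxed to an inequality: this is what [improve] returns for y and what
    its energy estimate requires of w. *)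
Definition admissible w := [/\ base w, 0 < NN w & NN w <= AA w].

Lemma aa_ge0 (r : R) w : 0 <= aa r w.
Proof. by apply: int_ge0 => x; exact: powR_ge0. Qed.

Definition coer : R := Num.min (2^-1 - q^-1) (2^-1 - p^-1).

Lemma coer_gt0 : 0 < coer.
Proof.
rewrite /coer lt_min !subr_gt0; apply/andP; split.
  by rewrite ltf_pV2 ?posrE//; exact: lt_trans q2.
by rewrite ltf_pV2 ?posrE//; exact: lt_trans p2.
Qed.

Lemma II_coer w : coer * NN w <= II w.
Proof.
rewrite /NN /II mulrCA ler_pM2l// mulrDr lerD// ler_wpM2r ?aa_ge0//.
  by rewrite /coer ge_min lexx.
by rewrite /coer ge_min lexx orbT.
Qed.

(** What one application of [improve] adds to admissibility, independently of w; with a bound on the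
    energy these estimates become uniform. *)
Definition regular y := [/\ admissible y, itg (fun x => y x ^+ 2),
  (forall x x', expR (- l1 * `|x - x'|) * y x' <= y x) &
  gap * lint (fun x => y x ^+ 2) <= NN y].

Lemma improve_regular w : base w -> 0 < AA w -> exists y, regular y /\
  (NN w <= AA w -> II y <= II w).
Proof.
move=> bw A0; have [t /=] := improve q2 p2 c0 l10 l20 bw A0.
set z := T (ff w); set y := fun x => t * z x => -[t0 by_ [iy2 EN] /andP[N0 NA] H].
exists y; split; last first.
  move=> NAw; have [_] := H NAw; apply: le_trans; rewrite lerDl.
  rewrite !mulr_ge0 ?invr_ge0 ?sqr_ge0 ?(ltW t0)// int_ge0// => x.
  rewrite mulr_ge0 ?sqr_ge0// mulr_ge0 ?(ltW c0)// addr_ge0 ?powR_ge0//.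
have [nw dw _ _] := bw.
have nf := nnbm_nonlin q2 p2 c0 nw.
split=> //.
- move=> x x'; rewrite mulrCA ler_pM2l//.
  exact: Tg_loglip.
- have [_ iz2] := base_T q2 p2 c0 l10 l20 bw.
  have E : lint (fun x => y x ^+ 2) = t ^+ 2 * lint (fun x => z x ^+ 2).
    by rewrite -intZ//; apply: eq_int => x; rewrite exprMn.
  rewrite E -EN mulrCA ler_pM2l ?exprn_gt0//.
  by apply: Tg_coercive => //; exact: itg_nonlin2.
Qed.

Lemma base_sk : base (sk 1).
Proof.
have k := kern_sk (@ltr01 R).
have i (r : R) : 2 < r -> itg (fun x => sk 1 x `^ r).
  move=> r2; rewrite (_ : (fun x => _) = fun x => sk 1 x * sk 1 x `^ (r - 1)).
    apply: itgMnnbm; first exact: k.2.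
    by apply: nnbm_powR; [lra|exact: k.1].
  by apply/funext => x; rewrite mulrC powR_B1 ?(kern_ge0 _ k)//; lra.
by split; [exact: k.1|exact: evdec_sk|exact: i|exact: i].
Qed.

(** [improve] asks only for AA w > 0 in order to produce an admissible function, so the explicit
    profile [sk 1] can start the process. *)
Lemma regular_ex : exists y, regular y.
Proof.
have b := base_sk; have [nw _ _ _] := b.
have nf := nnbm_nonlin q2 p2 c0 nw.
have [|y [ry _]] := improve_regular b; last by exists y.
apply: int_gt0; first exact: itg_nonlinT.
move=> x; apply: mulr_gt0; first by apply: nonlin_gt0 => //; exact: sk_gt0.
apply: Tg_gt0 => // t; apply: nonlin_gt0 => //; exact: sk_gt0.
Qed.

(* The lower profile prevents vanishing, and the upper one prevents loss of mass at
   infinity. *)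
Lemma regular_bounds (E : R) : exists K m : R, [/\ 0 < K, 0 < m &
  forall y, regular y -> II y <= E -> forall x,
    m * expR (- l1 * `|x|) <= y x /\ y x ^+ 2 <= K * (1 + `|x|)^-1].
Proof.
have c1 := coer_gt0.
have g1 : 0 < 2 * l1 by rewrite mulr_gt0.
pose kap := lint (fun x => expR (- (2 * l1) * `|x|)).
have isk : itg (fun x => expR (- (2 * l1) * `|x|)).
  have [_ i] := kern_sk g1.
  rewrite (_ : (fun x => _) = fun x => 2 * (2 * l1) * sk (2 * l1) x); first exact: itgZ.
  by apply/funext => x; rewrite /sk mulVKf// gt_eqF// mulr_gt0.
have kap0 : 0 < kap by apply: int_gt0 => // x; exact: expR_gt0.
pose B := `|E| / coer / gap.
have B0 : 0 <= B by rewrite !divr_ge0// ltW.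
(* For the maximum M of y and S the integral of y^2, gap S <= NN y <= c (M^(q-2) + M^(p-2)) S. After
   cancelling S, one of the two powers is at least gap / (2 c). *)
have [m m0 Hm] : exists2 m, 0 < m & forall M, 0 < M -> gap <= c * (M `^ (q - 2) + M `^ (p - 2)) -> m <= M.
  pose a := gap / c / 2; have a0 : 0 < a by rewrite !divr_gt0.
  exists (Num.min (a `^ (q - 2)^-1) (a `^ (p - 2)^-1)).
    by rewrite lt_min !powR_gt0.
  move=> M M0; rewrite -ler_pdivrMl// => H; rewrite ge_min.
  have h (r : R) : 2 < r -> a <= M `^ (r - 2) -> a `^ (r - 2)^-1 <= M.
    move=> r2 aM; have r0 : 0 < r - 2 by rewrite subr_gt0.
    have E' : (M `^ (r - 2)) `^ (r - 2)^-1 = M.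
      by rewrite -powRrM divff ?gt_eqF// powRr1// ltW.
    rewrite -[leRHS]E'.
    by rewrite ge0_ler_powR ?nnegrE ?powR_ge0 ?invr_ge0 ?(ltW r0) ?(ltW a0).
  have [/(h _ q2) -> //|/ltW aq] := leP a (M `^ (q - 2)).
  rewrite (h _ p2) ?orbT//; move: H aq; rewrite /a mulrC; lra.
(* B / kap will bound y^2 and B will bound |x| y^2; the last 1 makes the constant positive. *)
exists (B / kap + B + 1), m; split=> //.
  by rewrite ltr_wpDl// addr_ge0// divr_ge0// ltW.
move=> y [[[ny dy iyq iyp] N0 _] iy2 ly gy] yE.
set S := lint _ in gy.
have NE : coer * NN y <= `|E|.
  by rewrite (le_trans (II_coer y))// (le_trans yE)// ler_norm.
have SB : S <= B.
  rewrite /B ler_pdivlMr// mulrC (le_trans gy)// ler_pdivlMr// mulrC//.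
pose M := y 0.
have yM x : y x <= M by apply: dy; rewrite normr0.
have y0 x : 0 <= y x by exact: nnbm_ge0.
have yl x : M * expR (- l1 * `|x|) <= y x by rewrite mulrC -[x in `|x|]subr0 ly.
have M0 : 0 < M.
  rewrite lt_neqAle y0 andbT; apply/eqP => M0; move: N0; rewrite /NN.
  have a0 (r : R) : 2 < r -> aa r y = 0.
    move=> r2; rewrite /aa (_ : (fun x => _) = (fun=> 0)) ?int0//.
    apply/funext => x; have -> : y x = 0 by apply/le_anti; rewrite y0 andbT (le_trans (yM x))// -M0.
    by rewrite powR0// gt_eqF//; lra.
  by rewrite !a0// addr0 mulr0 ltxx.
(* The Harnack profile M e^(-l1 |x|) lies below y; squaring and integrating it bounds the maximum by
   the L^2 norm. *)
have MS : M ^+ 2 * kap <= S.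
  rewrite -intZ//; apply: le_int => //; first exact: itgZ.
  move=> x; apply: (@le_trans _ _ ((M * expR (- l1 * `|x|)) ^+ 2)).
    rewrite exprMn -expRM_natl; apply: ler_wpM2l; first exact: sqr_ge0.
    by rewrite ler_expR; lra.
  by rewrite ler_sqr ?nnegrE// mulr_ge0 ?expR_ge0// ltW.
have S0 : 0 < S by apply: lt_le_trans MS; rewrite mulr_gt0// exprn_gt0.
have mM : m <= M.
  apply: Hm => //; rewrite -(ler_pM2r S0); apply: (le_trans gy).
  have h (r : R) : 2 < r -> itg (fun x => y x `^ r) -> aa r y <= M `^ (r - 2) * S.
    move=> r2 ir; rewrite -intZ//; apply: le_int => //; first exact: itgZ.
    move=> x; rewrite -(@powR_B2sqr _ (y x) r)// ler_wpM2r ?sqr_ge0//.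
    by rewrite ge0_ler_powR ?nnegrE ?(ltW M0)//; lra.
  by rewrite /NN -mulrA ler_pM2l// mulrDl lerD// h.
move=> x; split; first by rewrite (le_trans _ (yl x))// ler_wpM2r ?expR_ge0.
have x1 : 0 < 1 + `|x| by rewrite ltr_wpDr.
rewrite ler_pdivlMr// mulrDr mulr1.
have h1 : y x ^+ 2 <= B / kap.
  rewrite ler_pdivlMr//; apply: le_trans SB; apply: le_trans MS.
  by rewrite ler_pM2r// ler_sqr ?nnegrE ?(ltW M0).
have h2 : y x ^+ 2 * `|x| <= B.
  have := evdec_L2_decay x ny dy iy2; rewrite -/S => h.
  have : 0 <= `|x| * y x ^+ 2 by rewrite mulr_ge0 ?sqr_ge0.
  lra.
lra.
Qed.

Lemma ground_state_ex : exists z, [/\ base z, itg (fun x => z x ^+ 2),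
  (forall x, 0 < z x) & z = T (ff z)].
Proof.
pose V := [set II w | w in admissible].
have V0 v : V v -> 0 <= v.
  move=> [w [_ N0 _] <-]; apply: le_trans (II_coer w).
  by rewrite mulr_ge0// ltW// coer_gt0.
have hV : has_inf V.
  split; first by have [y [ay _ _ _]] := regular_ex; exists (II y), y.
  by exists 0 => v; exact: V0.
pose v := inf V.
have vV w : admissible w -> v <= II w.
  by move=> aw; apply: ge_inf; [exact: hV.2|exists w].
(* Every member of a minimizing sequence is replaced by its improvement, which costs no energy and
   makes it regular. *)
have /choice[y Hy] : forall n, exists y, regular y /\ II y <= v + n.+1%:R^-1.
  move=> n; have n0 : 0 < n.+1%:R^-1 :> R by rewrite invr_gt0.
  have [_ [w aw <-] wv] := inf_adherent n0 hV.
  have [bw N0 NA] := aw.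
  have [y [ry Hy]] := improve_regular bw (lt_le_trans N0 NA).
  by exists y; split=> //; rewrite (le_trans (Hy NA))// ltW.
have [K [m [K0 m0 Km]]] := regular_bounds (v + 1).
have yE n : II (y n) <= v + 1.
  by rewrite (le_trans (Hy n).2)// lerD2l invf_le1// ler1n.
have {}Km n := Km _ (Hy n).1 (yE n).
have y0 n x : 0 <= y n x.
  by have [[[ny _ _ _] _ _] _ _ _] := (Hy n).1; exact: nnbm_ge0.
(* This envelope has integrable q-th and p-th powers, but its square is not integrable; that is why
   [base] stops short of L^2. *)
pose D (x : R) := (K * (1 + `|x|)^-1) `^ 2^-1.
have x1 (x : R) : 0 < 1 + `|x| by rewrite ltr_wpDr.
have KD0 (x : R) : 0 <= K * (1 + `|x|)^-1.
  by apply: mulr_ge0; rewrite ?invr_ge0 ltW.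
have yD n x : y n x <= D x.
  have E' : (y n x ^+ 2) `^ 2^-1 = y n x.
    by rewrite -powR_mulrn// -powRrM divff// powRr1.
  rewrite -[leLHS]E'.
  by rewrite ge0_ler_powR ?nnegrE ?sqr_ge0 ?KD0//; exact: (Km n x).2.
have nD : nnbm D.
  apply: nnbm_powR; first by rewrite invr_ge0.
  split; last first.
    exists K => x; rewrite KD0/= ler_piMr ?(ltW K0)// invf_le1// lerDl//.
  apply: continuous_measurable_fun => x; apply: cvgMr; apply: cvgV; first by rewrite gt_eqF.
  by apply: cvgD; [exact: cvg_cst|exact: norm_continuous].
have DM x : D x <= K `^ 2^-1.
  rewrite ge0_ler_powR ?nnegrE ?KD0 ?invr_ge0 ?(ltW K0)//.
  by rewrite ler_piMr ?(ltW K0)// invf_le1// lerDl.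
have bD : base D.
  have i (r : R) : 2 < r -> itg (fun x => D x `^ r).
    move=> r2; have r1 : 1 < r / 2 by lra.
    rewrite (_ : (fun x => _) = fun x => K `^ (r / 2) * (1 + `|x|) `^ (- (r / 2))).
      by apply: itgZ; exact: itg_powD.
    apply/funext => x; rewrite /D -powRrM (_ : 2^-1 * r = r / 2); last by rewrite mulrC.
    rewrite powRM ?invr_ge0 ?(ltW K0) ?(ltW (x1 x))//.
    by rewrite -(powR_inv1 (ltW (x1 x))) -powRrM mulN1r.
  split=> //; [|exact: i..].
  move=> x x' xx'; rewrite ge0_ler_powR ?nnegrE ?KD0 ?invr_ge0//.
  by rewrite ler_pM2l// lef_pV2 ?posrE ?x1// lerD2l.
(* Harnack's inequality and e^(-s) >= 1 - s, with the uniform bound on y. *)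
have yL n x x' : `|y n x - y n x'| <= l1 * K `^ 2^-1 * `|x - x'|.
  wlog h : x x' / y n x' <= y n x.
    move=> H; have [/H //|/ltW /H] := leP (y n x') (y n x).
    by rewrite distrC (distrC x).
  rewrite ger0_norm ?subr_ge0//; have [_ _ /(_ x' x) ll _] := (Hy n).1.
  rewrite distrC in ll.
  have e1 := expR_ge1Dx (- l1 * `|x - x'|).
  have h1 : (1 + - l1 * `|x - x'|) * y n x <= y n x'.
    by apply: le_trans ll; rewrite ler_wpM2r.
  have h2 : l1 * `|x - x'| * y n x <= l1 * `|x - x'| * K `^ 2^-1.
    apply: ler_wpM2l; first by rewrite mulr_ge0 ?(ltW l10).
    by rewrite (le_trans (yD n x)).
  lra.
have [|||w [phi [kphi yw]]] := @lipschitz_extract R (K `^ 2^-1) (l1 * K `^ 2^-1) y.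
- by rewrite mulr_ge0 ?(ltW l10) ?powR_ge0.
- by move=> n x; rewrite y0 (le_trans (yD n x)).
- exact: yL.
have {}y0 n x := y0 (phi n) x; have {}yD n x := yD (phi n) x.
have {}Km n x := Km (phi n) x; have {}Hy n := Hy (phi n).
have ny n : nnbm (y (phi n)) by have [[[]]] := (Hy n).1.
have w0 x : 0 < w x.
  apply: (@lt_le_trans _ _ (m * expR (- l1 * `|x|))); first by rewrite mulr_gt0 ?expR_gt0.
  by apply: (cvgr_to_ge (yw x)); apply: nearW => n; exact: (Km n x).1.
have wD x : w x <= D x by apply: (cvgr_to_le (yw x)); apply: nearW => n; exact: yD.
have mw : measurable_fun setT w.
  by apply: (measurable_fun_cvg (fun n => (ny n).1)) => x _; exact: yw.
have nw : nnbm w by split=> //; exists (K `^ 2^-1) => x; rewrite ltW//= (le_trans (wD x)).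
have dw : evdec w.
  move=> x x' xx'; apply: (ler_cvg_to (yw x') (yw x)); apply: nearW => n.
  by have [[[_ dy _ _] _ _] _ _ _] := (Hy n).1; exact: dy.
have [_ _ iDq iDp] := bD.
have cvgaa (r : R) : 2 < r -> itg (fun x => D x `^ r) ->
    itg (fun x => w x `^ r) /\ aa r (y (phi n)) @[n --> \oo] --> aa r w.
  move=> r2 ir; apply: (@dominated_int _ _ R mu (fun n x => y (phi n) x `^ r) _ _ _ ir).
  - by move=> n; apply: (nnbm_powR _ (ny n)).1; lra.
  - move=> n x; rewrite ger0_norm ?powR_ge0// ge0_ler_powR ?nnegrE ?powR_ge0//; lra.
  - by move=> x; apply: cvg_powR.
have [iwq cq] := cvgaa q q2 iDq; have [iwp cp] := cvgaa p p2 iDp.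
have bw : base w by [].
have cf x : ff (y (phi n)) x @[n --> \oo] --> ff w x.
  by apply: cvgMr; apply: cvgD; exact: cvg_powR.
have nf n : nnbm (ff (y (phi n))) := nnbm_nonlin q2 p2 c0 (ny n).
have nfD := nnbm_nonlin q2 p2 c0 nD.
have fD n x : ff (y (phi n)) x <= ff D x.
  have h (r : R) : 2 < r -> y (phi n) x `^ (r - 1) <= D x `^ (r - 1).
    by move=> r2; rewrite ge0_ler_powR ?nnegrE ?powR_ge0//; lra.
  by rewrite /ff ler_pM2l// lerD// h.
have [Mf Mf0 HMf] := nnbm_bound nfD.
have fM n x : ff (y (phi n)) x <= Mf by rewrite (le_trans (fD n x))// (le_trans (ler_norm _)).
have cT x : T (ff (y (phi n))) x @[n --> \oo] --> T (ff w) x.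
  have k1 := kern_sk l10; have k2 := kern_sk l20.
  apply: (@cvg_conv _ _ _ _ (conv (sk l2) (fun=> Mf) 0)) => //.
  - by move=> n; exact: nnbm_conv.
  - move=> n t; apply: (@le_trans _ _ (conv (sk l2) (fun=> Mf * 1) t)).
      by apply: le_conv => //; [apply: nnbm_cst; rewrite mulr1 ltW|move=> s; rewrite mulr1].
    rewrite (_ : (fun=> Mf) = (fun=> Mf * 1)); last by rewrite mulr1.
    by rewrite !convZ// ?conv1//; exact: nnbm_cst.
  - by move=> t; apply: (@cvg_conv _ _ _ _ Mf).
have cA : AA (y (phi n)) @[n --> \oo] --> AA w.
  apply: (@dominated_int _ _ R mu (fun n x => ff (y (phi n)) x * T (ff (y (phi n))) x)
    _ (fun x => ff D x * T (ff D) x) _ _ _ _).2.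
  - by move=> n; exact: (nnbmM (nf n) (nnbm_Tg l10 l20 (nf n))).1.
  - exact: itg_nonlinT.
  - move=> n x; rewrite ger0_norm; last first.
      by rewrite mulr_ge0 ?(nnbm_ge0 _ (nf n)) ?(nnbm_ge0 _ (nnbm_Tg l10 l20 (nf n))).
    rewrite ler_pM ?(nnbm_ge0 _ (nf n)) ?(nnbm_ge0 _ (nnbm_Tg l10 l20 (nf n)))//.
    by apply: le_Tg.
  - by move=> x; apply: cvgM.
have cN : NN (y (phi n)) @[n --> \oo] --> NN w by apply: cvgMr; exact: cvgD.
have cI : II (y (phi n)) @[n --> \oo] --> II w.
  by apply: cvgMr; apply: cvgD; apply: cvgMr.
have NAw : NN w <= AA w.
  by apply: (ler_cvg_to cN cA); apply: nearW => n; have [[]] := (Hy n).1.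
have N0 : 0 < NN w.
  rewrite /NN mulr_gt0// addr_gt0//; apply: int_gt0 => // x; exact: powR_gt0.
have Iv : II w <= v.
  apply: (ler_cvg_to cI (_ : (fun n => v + n.+1%:R^-1) n @[n --> \oo] --> v)).
    rewrite -[X in _ --> X]addr0; apply: cvgD; [exact: cvg_cst|exact: cvg_harmonic].
  apply: nearW => n; apply: (le_trans (Hy n).2); rewrite lerD2l lef_pV2 ?posrE//.
  by rewrite ler_nat ltnS.
have A0 := lt_le_trans N0 NAw.
have [t /=] := improve q2 p2 c0 l10 l20 bw A0.
set z := T (ff w); move=> [t0 by_ [iy2 EN] /andP[Ny NAy] /(_ NAw)[iom H]].
have vy := vV _ (And3 by_ Ny NAy).
(* Minimality: II w <= v <= II y, so the energy gained by the step from w to y is at most 0. *)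
have om0 : lint (fun x => omega w x * (z x - w x) ^+ 2) <= 0.
  have : 2^-1 * t ^+ 2 * lint (fun x => omega w x * (z x - w x) ^+ 2) <= 0.
    by have := le_trans H Iv; lra.
  by rewrite pmulr_rle0// mulr_gt0 ?exprn_gt0.
have omw x : 0 < omega w x by rewrite mulr_gt0// addr_gt0// powR_gt0.
have ae : {ae mu, forall x, z x = w x}.
  have := ge0_int_eq0 iom _ om0; move=> /(_ (fun x => mulr_ge0 (ltW (omw x)) (sqr_ge0 _))).
  apply: filterS => x /eqP; rewrite mulf_eq0 gt_eqF//= sqrf_eq0 subr_eq0.
  by move/eqP.
have [bz iz2] := base_T q2 p2 c0 l10 l20 bw; have [nz _ _ _] := bz.
exists z; split=> //; first by move=> x; exact: T_gt0.
(* Minimality gives w = z = T (f w) only almost everywhere. Convolution ignores null sets, so z = T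
   (f z) holds at every point and z is the solution to keep. *)
have E : conv (sk l2) (ff w) = conv (sk l2) (ff z).
  apply/funext => x; rewrite conv.unlock lint.unlock /Rintegral; congr fine.
  have k2 := kern_sk l20.
  apply: ae_eq_integral => //.
  - by apply/measurable_EFinP; exact: (itg_meas (itg_conv x k2 (nnbm_nonlin q2 p2 c0 nw))).
  - by apply/measurable_EFinP; exact: (itg_meas (itg_conv x k2 (nnbm_nonlin q2 p2 c0 nz))).
  - by move: ae; apply: (@filterS _ _ (ae_filter_ringOfSetsType mu)) => s zs _; rewrite /nonlin zs.
by rewrite {1}/z /Tg E.
Qed.

End ground_state.

(** * Exponential decay and the differential equation *)

Section directional_derivatives.
Variables (R : realType) (V : normedModType R).
Implicit Types (f g : V -> R) (x v : V) (a b : R).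

Lemma derD f g x v a b : is_derive x v f a -> is_derive x v g b ->
  is_derive x v (fun y => f y + g y) (a + b).
Proof. by move=> h1 h2; exact: is_deriveD. Qed.

Lemma derB f g x v a b : is_derive x v f a -> is_derive x v g b ->
  is_derive x v (fun y => f y - g y) (a - b).
Proof. by move=> h1 h2; exact: is_deriveB. Qed.

Lemma derM f g x v a b : is_derive x v f a -> is_derive x v g b ->
  is_derive x v (fun y => f y * g y) (a * g x + f x * b).
Proof.
move=> h1 h2; have := @is_deriveM _ _ f g x v a b h1 h2.
by rewrite addrC /GRing.scale/= (mulrC (g x)).
Qed.

Lemma derZ f x v a (c : R) : is_derive x v f a ->
  is_derive x v (fun y => c * f y) (c * a).
Proof. by move=> h; exact: is_deriveZ. Qed.

Lemma derE f x v a b : a = b -> is_derive x v f a -> is_derive x v f b.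
Proof. by move=> ->. Qed.

Lemma der_ext f g x v a : f =1 g -> is_derive x v f a -> is_derive x v g a.
Proof. by move=> /funext ->. Qed.

Lemma der_cst x v (c : R) : is_derive x v (fun=> c) 0.
Proof. exact: is_derive_cst. Qed.

(** Restriction to a line lets the one-variable chain rule prove [der_comp] from directional
    derivability alone. *)
Lemma der_lineP f x v a :
  is_derive x v f a <-> is_derive (0 : R) 1 (fun t => f (x + t *: v)) a.
Proof.
have E : (fun h : R => h^-1 *: ((f \o shift x) (h *: v) - f x)) =
   (fun h : R => h^-1 *: (((fun t : R => f (x + t *: v)) \o shift 0) (h *: (1 : R)) -
     f (x + (0 : R) *: v))).
  apply/funext => h; rewrite /= addr0 scale0r addr0 /GRing.scale/= mulr1.
  by rewrite [_ + x]addrC.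
split=> -[d e]; split.
- by move: d; rewrite /derivable E.
- by move: e; rewrite /derive E.
- by move: d; rewrite /derivable E.
- by move: e; rewrite /derive E.
Qed.

Lemma der_comp f (h : R -> R) x v a b : is_derive x v f a ->
  is_derive (f x) 1 h b -> is_derive x v (fun y => h (f y)) (b * a).
Proof.
move=> /der_lineP hf hh; apply/der_lineP.
have hh' : is_derive (f (x + (0 : R) *: v)) 1 h b by rewrite scale0r addr0.
exact: (@is_derive1_comp R h (fun t : R => f (x + t *: v)) 0).
Qed.

End directional_derivatives.

Lemma der_continuous (R : realType) (f : R -> R) (df : R -> R) :
  (forall x : R, is_derive x 1 f (df x)) -> continuous f.
Proof.
move=> h x; apply: differentiable_continuous; apply/derivable1_diffP.
by apply: ex_derive; exact: h.
Qed.

Lemma der_expRZ (R : realType) (c x : R) :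
  is_derive x 1 (fun y => expR (c * y)) (c * expR (c * x)).
Proof.
have := @der_comp R R _ _ _ _ _ _ (derZ c (is_derive_id x 1)) (is_derive_expR (c * x)).
by rewrite mulr1 mulrC.
Qed.

(** * Differential equations satisfied by the convolutions *)

Section exponential_kernel_ode.
Variable R : realType.
Local Notation mu := (@lebesgue_measure R).
Local Notation itg := (itg (@lebesgue_measure R)).
Local Notation lint := (lint (@lebesgue_measure R)).
Variable l : R.
Hypothesis l0 : 0 < l.
Implicit Types (g : R -> R) (t : R).

(** The convolution at x is e^(-l x) times the integral of e^(l s) g s over s <= x, so the
    fundamental theorem of calculus and the product rule apply. *)
Lemma der_conv_ek g t : nnbm g -> continuous g ->
  is_derive t 1 (conv (ek l) g) (g t - l * conv (ek l) g t).
Proof.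
move=> ng cg; pose h (s : R) := expR (l * s) * g s.
have E x : (fun s => ek l (x - s) * g s) =
    (fun s => expR (- l * x) * h s) \_ `]-oo, x].
  apply/funext => s; rewrite patchE /ek subr_ge0 mem_setE in_itv/=.
  case: ifP => // _; last by rewrite mul0r.
  by rewrite /h mulrA -expRD; congr (expR _ * _); ring.
have ih x : mu.-integrable `]-oo, x] (EFin \o h).
  have := itg_conv x (kern_ek l0) ng; rewrite E => i.
  have : mu.-integrable setT (EFin \o _) := itgZ (expR (l * x)) i.
  rewrite (_ : EFin \o _ = (EFin \o h) \_ `]-oo, x]); first by rewrite -integrable_mkcond.
  apply/funext => s; rewrite /= !patchE; case: ifP => _; last by rewrite mulr0.
  by rewrite mulrA -expRD mulNr subrr expR0 mul1r.
pose F x := (\int[mu]_(s in [set` `]-oo, x]]) h s)%R.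
have EF x : conv (ek l) g x = expR (- l * x) * F x.
  rewrite conv.unlock lint.unlock E -Rintegral_mkcond RintegralZl//.
have ch : continuous h.
  by move=> x; apply: cvgM; [exact: (der_continuous (der_expRZ l))|exact: cg].
have tt1 : t < t + 1 by rewrite ltrDl.
have [dF EF'] := @continuous_FTC1 R h -oo%O t (t + 1) tt1
  (ih _) (ltNyr _) (ch t).
have dF' : is_derive t 1 F (h t) by split => //; rewrite -EF' derive1E.
apply: (@der_ext _ _ (fun x => expR (- l * x) * F x)); first by move=> x; rewrite EF.
apply: derE (derM (der_expRZ (- l) t) dF').
have e : expR (- l * t) * h t = g t by rewrite /h mulrA -expRD mulNr addNr expR0 mul1r.
by rewrite EF e; ring.
Qed.

Lemma conv_rflx k g t : kern k -> nnbm g ->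
  conv (rflx k) g t = conv k (rflx g) (- t).
Proof.
move=> kk ng; have := itg_conv t (kern_rflx kk) ng => i.
rewrite conv.unlock -[LHS](int_reflect 0 i).2; apply: eq_int => s.
by rewrite /rflx sub0r; congr (k _ * _); ring.
Qed.

Lemma der_conv_rek g t : nnbm g -> continuous g ->
  is_derive t 1 (conv (rflx (ek l)) g) (l * conv (rflx (ek l)) g t - g t).
Proof.
move=> ng cg; have ke := kern_ek l0.
have nr : nnbm (rflx g).
  by case: ng => mg [M gM]; split; [exact: measurable_rflx|exists M => x; exact: gM].
have cr : continuous (rflx g).
  by move=> x; apply: continuous_comp; [exact: opp_continuous|exact: cg].
apply: (@der_ext _ _ (fun x => conv (ek l) (rflx g) (- x))).
  by move=> x; rewrite conv_rflx.
rewrite conv_rflx//.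
have := @der_comp R R (fun x => - x) (conv (ek l) (rflx g)) t 1 (- 1) _ _
  (der_conv_ek (- t) nr cr).
have dN : is_derive t 1 (fun x : R => - x) (- 1) by exact: is_deriveNid.
move=> /(_ dN); apply: derE; rewrite /rflx opprK; ring.
Qed.

(** The derivative of [conv (sk l) g], read off from (D + l) (conv (sk l) g) = conv (rflx (ek l))
    g. *)
Definition dsk g : R -> R := fun t => conv (rflx (ek l)) g t - l * conv (sk l) g t.

Lemma continuous_conv_rek g : nnbm g -> continuous g -> continuous (conv (rflx (ek l)) g).
Proof. by move=> ng cg; apply: der_continuous => x; exact: der_conv_rek. Qed.

Lemma der_conv_sk g t : nnbm g -> continuous g ->
  is_derive t 1 (conv (sk l) g) (dsk g t).
Proof.
move=> ng cg; have ke := kern_ek l0; have kr := kern_rflx ke.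
apply: (@der_ext _ _ (conv (ek l) (conv (rflx (ek l)) g))).
  by move=> x; rewrite conv_sk.
rewrite /dsk conv_sk//; apply: der_conv_ek; first exact: nnbm_conv.
exact: continuous_conv_rek.
Qed.

Lemma der_dsk g t : nnbm g -> continuous g ->
  is_derive t 1 (dsk g) (l ^+ 2 * conv (sk l) g t - g t).
Proof.
move=> ng cg.
apply: derE (derB (der_conv_rek t ng cg) (derZ l (der_conv_sk t ng cg))).
rewrite /dsk; ring.
Qed.

(** [rflx (ek l)] is at most 2 l [sk l] pointwise, so the derivative inherits the decay of the
    function. *)
Lemma dsk_le g t : nnbm g -> `|dsk g t| <= 3 * l * conv (sk l) g t.
Proof.
move=> ng; have ke := kern_ek l0; have kr := kern_rflx ke; have ks := kern_sk l0.
have : conv (rflx (ek l)) g t <= 2 * l * conv (sk l) g t.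
  rewrite !conv.unlock -intZ; last exact: itg_conv.
  apply: le_int; [exact: itg_conv|apply: itgZ; exact: itg_conv|].
  move=> s; rewrite mulrA ler_wpM2r ?(nnbm_ge0 _ ng)// /sk mulVKf; last first.
    by rewrite gt_eqF// mulr_gt0.
  rewrite /rflx opprB /ek; case: ifPn => [st|_]; last exact: expR_ge0.
  by rewrite distrC ger0_norm.
have := conv_ge0 t kr ng; have := conv_ge0 t ks ng.
rewrite /dsk ler_norml => ? ? ?; have : 0 <= l * conv (sk l) g t by rewrite mulr_ge0// ltW.
by move=> ?; apply/andP; split; lra.
Qed.

(** The Lipschitz bound on rho makes the weights at s and t differ by at most e^(d |t - s|), which
    leaves a kernel with rate l - d > 0; the constant is its mass. *)
Lemma conv_sk_weight (d : R) (rho : R -> R) t : 0 < d -> d < l ->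
  (forall x y, `|rho x - rho y| <= `|x - y|) -> nnbm (fun x => expR (- d * rho x)) ->
  conv (sk l) (fun x => expR (- d * rho x)) t <= (l * (l - d))^-1 * expR (- d * rho t).
Proof.
move=> d0 dl lip nr; have ks := kern_sk l0.
have ld : 0 < l - d by rewrite subr_gt0.
have kd := kern_sk ld.
have -> : (l * (l - d))^-1 * expR (- d * rho t) =
    lint (fun s => expR (- d * rho t) * ((l - d) / l) * sk (l - d) (t - s)).
  rewrite intZ; last exact: (kern_shiftr t kd).2.
  rewrite (int_reflect t kd.2).2 int_sk//; field.
  by move: l0 => l0'; rewrite !gt_eqF.
rewrite conv.unlock; apply: le_int; [exact: itg_conv|apply: itgZ; exact: (kern_shiftr t kd).2|].
move=> s; rewrite /sk.
have -> : expR (- d * rho t) * ((l - d) / l) * ((2 * (l - d))^-1 * expR (- (l - d) * `|t - s|)) =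
  (2 * l)^-1 * (expR (- d * rho t) * expR (- (l - d) * `|t - s|)).
  by field; move: l0 => l0'; rewrite !gt_eqF.
rewrite -mulrA ler_pM2l ?invr_gt0 ?mulr_gt0// -!expRD ler_expR.
have := lip t s; rewrite ler_norml => /andP[_ h].
have : d * (rho t - rho s) <= d * `|t - s| by rewrite ler_pM2l.
lra.
Qed.

End exponential_kernel_ode.

(** * Decay and derivatives of the ground state *)

Section homoclinic.
Variable R : realType.
Local Notation mu := (@lebesgue_measure R).
Local Notation itg := (itg (@lebesgue_measure R)).
Local Notation lint := (lint (@lebesgue_measure R)).

Lemma loglip_continuous (l M : R) (f : R -> R) : 0 < l ->
  (forall x, 0 <= f x <= M) ->
  (forall x x', expR (- l * `|x - x'|) * f x' <= f x) -> continuous f.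
Proof.
move=> l0 fM ll x.
have lip y y' : `|f y - f y'| <= l * M * `|y - y'|.
  wlog h : y y' / f y' <= f y.
    move=> H; have [/H //|/ltW /H] := leP (f y') (f y).
    by rewrite distrC (distrC y).
  rewrite ger0_norm ?subr_ge0//; have l1 := ll y' y; rewrite distrC in l1.
  have e1 := expR_ge1Dx (- l * `|y - y'|).
  have /andP[f0 fM'] := fM y.
  have h1 : (1 + - l * `|y - y'|) * f y <= f y'.
    by apply: le_trans l1; rewrite ler_wpM2r.
  have h2 : l * `|y - y'| * f y <= l * `|y - y'| * M.
    by apply: ler_wpM2l => //; rewrite mulr_ge0 ?(ltW l0).
  lra.
apply/cvgrPdist_le => e e0.
have M0 : 0 <= M by have /andP[] := fM 0; exact: le_trans.
have L0 : 0 < l * M + 1 by rewrite ltr_wpDl// mulr_ge0// ltW.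
near=> y; apply: (le_trans (lip x y)).
have : `|x - y| <= e / (l * M + 1).
  by near: y; apply: cvgr_dist_le => //; exact: divr_gt0.
rewrite ler_pdivlMr// => h; apply: le_trans h.
by rewrite mulrC ler_wpM2l// lerDl.
Unshelve. all: by end_near. Qed.

Lemma continuous_nnbm_exp (d : R) (rho : R -> R) : 0 < d -> continuous rho ->
  (forall x, 0 <= rho x) -> nnbm (fun x => expR (- d * rho x)).
Proof.
move=> d0 cr r0; split.
  apply: continuous_measurable_fun => x.
  apply: (@continuous_comp _ _ _ (fun x => - d * rho x) expR); last exact: continuous_expR.
  by apply: cvgMr; exact: cr.
exists 1 => x; rewrite expR_ge0/= -expR0 ler_expR mulNr oppr_le0.
by rewrite mulr_ge0// ltW.
Qed.

Lemma minr_norm_lip (r x y : R) : `|Num.min `|x| r - Num.min `|y| r| <= `|x - y|.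
Proof.
have h (a b : R) : Num.min `|a| r <= Num.min `|b| r + `|a - b|.
  have H : `|a| <= `|b| + `|a - b|.
    by have := ler_normD b (a - b); rewrite [b + _]addrC subrK.
  have [h1|h1] := leP `|b| r; first by rewrite ge_min H.
  by rewrite ge_min lerDl normr_ge0 orbT.
rewrite ler_norml; apply/andP; split; have := h x y; have := h y x.
  by rewrite (distrC y x); lra.
by rewrite (distrC y x); lra.
Qed.

Variables q p c l1 l2 : R.
Hypotheses (q2 : 2 < q) (p2 : 2 < p) (c0 : 0 < c) (l10 : 0 < l1) (l20 : 0 < l2).
Local Notation T := (Tg l1 l2).
Local Notation ff := (nonlin q p c).

(** A contraction estimate in a weighted sup norm. Truncating the weight at r makes the supremum of
    z / X r finite beforehand; the bound obtained is independent of r, so r = |x| may be taken at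
    the end. *)
Lemma ground_state_decay (z : R -> R) : nnbm z -> evdec z -> itg (fun x => z x ^+ 2) ->
  z = T (ff z) -> exists d C : R, [/\ 0 < d, d < l1, d < l2 & forall x, z x <= C * expR (- d * `|x|)].
Proof.
move=> nz dz iz zT; pose d := Num.min l1 l2 / 2.
have m0 : 0 < Num.min l1 l2 by rewrite lt_min l10.
have d0 : 0 < d by rewrite divr_gt0.
have dm : d < Num.min l1 l2 by rewrite /d; lra.
have dl1 : d < l1 by rewrite (lt_le_trans dm)// ge_min lexx.
have dl2 : d < l2 by rewrite (lt_le_trans dm)// ge_min lexx orbT.
pose X (r : R) (x : R) := expR (- d * Num.min `|x| r).
have nX r : 0 <= r -> nnbm (X r).
  move=> r0; apply: continuous_nnbm_exp => //.
    move=> x; apply: (@continuous_min _ _ (fun x : R => `|x|) (fun=> r)).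
      exact: norm_continuous.
    exact: cst_continuous.
  by move=> x; rewrite le_min normr_ge0.
pose C := (l1 * (l1 - d))^-1 * (l2 * (l2 - d))^-1.
have C0 : 0 < C by rewrite mulr_gt0// invr_gt0 mulr_gt0// subr_gt0.
have TX r t : 0 <= r -> T (X r) t <= C * X r t.
  move=> r0; have lip := @minr_norm_lip r; have nr := nX r r0.
  have k2 := conv_sk_weight l20 _ d0 dl2 lip nr.
  have n2 := nnbm_conv (kern_sk l20) nr.
  have c2 : 0 <= (l2 * (l2 - d))^-1 by rewrite invr_ge0 mulr_ge0 ?subr_ge0 ?ltW.
  apply: (le_trans (le_conv t (kern_sk l10) n2 (nnbmZ c2 nr) (fun x => k2 x))).
  rewrite convZ//; last exact: kern_sk.
  rewrite mulrC /C mulrAC; apply: ler_wpM2r => //.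
  exact: conv_sk_weight.
have [M Mp zM] := nnbm_bound nz.
have z0 x : 0 <= z x by exact: nnbm_ge0.
have {}zM x : z x <= M by rewrite (le_trans (ler_norm _)).
(* With this e the part e z of the nonlinearity contributes only half of the weighted supremum s,
   and s <= s / 2 + K C can be solved for s. *)
pose e := (2 * C)^-1; have e0 : 0 < e by rewrite invr_gt0 mulr_gt0.
have nf := nnbm_nonlin q2 p2 c0 nz.
have [F F0 fF] := nnbm_bound nf.
have [T0 T00 HT0] : exists2 T0, 0 <= T0 & forall x, T0 <= `|x| -> ff z x <= e * z x.
  pose b := e / c / 2; have b0 : 0 < b by rewrite !divr_gt0.
  pose a := Num.min (b `^ (q - 2)^-1) (b `^ (p - 2)^-1).
  have a0 : 0 < a by rewrite lt_min !powR_gt0.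
  pose S := lint (fun x => z x ^+ 2).
  have S0 : 0 <= S by apply: int_ge0 => x; exact: sqr_ge0.
  have Q0 : 0 <= S / (2 * a ^+ 2) by rewrite divr_ge0// mulr_ge0// sqr_ge0.
  exists (S / (2 * a ^+ 2) + 1); first by rewrite addr_ge0.
  move=> x hx; have x0 : 0 < `|x| by lra.
  have h : S <= `|x| * (2 * a ^+ 2).
    by rewrite -ler_pdivrMr ?mulr_gt0 ?exprn_gt0//; lra.
  have za : z x <= a.
    have H := evdec_L2_decay x nz dz iz; rewrite -/S in H.
    have : 2 * `|x| * z x ^+ 2 <= 2 * `|x| * a ^+ 2 by lra.
    by rewrite ler_pM2l ?mulr_gt0// ler_sqr ?nnegrE// ltW.
  have hr (r : R) : 2 < r -> a <= b `^ (r - 2)^-1 -> z x `^ (r - 1) <= b * z x.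
    move=> r2 ar; have r0 : 0 < r - 2 by rewrite subr_gt0.
    rewrite -powR_B2// ler_wpM2r//.
    have E' : (b `^ (r - 2)^-1) `^ (r - 2) = b.
      by rewrite -powRrM mulVf ?gt_eqF// powRr1// ltW.
    rewrite -[leRHS]E' ge0_ler_powR ?nnegrE ?powR_ge0 ?(ltW r0)//.
    exact: le_trans ar.
  have hq := hr q q2; have hp := hr p p2; rewrite /a !ge_min !lexx/= ?orbT in hq hp.
  rewrite /nonlin; apply: (@le_trans _ _ (c * (b * z x + b * z x))).
    by rewrite ler_pM2l// lerD// ?hq ?hp.
  by rewrite /b le_eqVlt; apply/orP; left; apply/eqP; field; move: c0 => c0'; rewrite gt_eqF.
(* On |x| <= T0 the nonlinearity is at most F while the weight is at least e^(-d T0). *)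
pose K := F * expR (d * T0); have K0 : 0 <= K by rewrite mulr_ge0 ?expR_ge0 ?(ltW F0).
have fzX r x : 0 <= r -> ff z x <= e * z x + K * X r x.
  move=> r0; have [xT|/ltW xT] := leP T0 `|x|.
    by rewrite (le_trans (HT0 x xT))// lerDl mulr_ge0 ?expR_ge0.
  apply: (@le_trans _ _ (K * X r x)); last by rewrite lerDr mulr_ge0 ?(ltW e0).
  apply: (le_trans (ler_norm _)); apply: (le_trans (fF x)).
  rewrite /K -mulrA ler_peMr ?(ltW F0)// -expRD -expR0 ler_expR.
  have : Num.min `|x| r <= T0 by rewrite ge_min xT.
  move=> h; have : d * Num.min `|x| r <= d * T0 by rewrite ler_pM2l.
  lra.
have key r x : 0 <= r -> z x <= 2 * (K * C) * X r x.
  move=> r0; pose V := [set z y / X r y | y in [set: R]].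
  have X0 y : 0 < X r y by exact: expR_gt0.
  have hV : has_sup V.
    split; first by exists (z 0 / X r 0), 0.
    exists (M / expR (- d * r)) => _ [y _ <-].
    apply: ler_pM => //; first by rewrite invr_ge0 ltW.
    rewrite lef_pV2 ?posrE ?expR_gt0// ler_expR !mulNr lerN2 ler_pM2l//.
    by rewrite ge_min lexx orbT.
  pose s := sup V.
  have zs y : z y <= s * X r y.
    by rewrite -ler_pdivrMr//; apply: ub_le_sup; [exact: hV.2|exists y].
  have s0 : 0 <= s.
    by rewrite -(pmulr_lge0 _ (X0 0)); exact: le_trans (zs 0).
  have nz' : nnbm (fun x => e * z x) by apply: nnbmZ => //; exact: ltW.
  have nX' : nnbm (fun x => K * X r x) by apply: nnbmZ => //; exact: nX.
  have st y : z y <= (s / 2 + K * C) * X r y.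
    rewrite {1}zT.
    have nsX : nnbm (fun x => s * X r x) by apply: nnbmZ => //; exact: nX.
    apply: (le_trans (le_Tg l10 l20 y nf (nnbmD nz' nX') (fun x => fzX r x r0))).
    rewrite TgD// !TgZ ?(ltW e0)//; [|exact: nX..].
    have h1 : T z y <= s * (C * X r y).
      apply: (le_trans (le_Tg l10 l20 y nz nsX zs)).
      by rewrite TgZ//; [rewrite ler_wpM2l// TX|exact: nX].
    have h2 : K * T (X r) y <= K * (C * X r y) by rewrite ler_wpM2l// TX.
    have h3 : e * T z y <= e * (s * (C * X r y)) by rewrite ler_pM2l.
    have E' : e * (s * (C * X r y)) = s / 2 * X r y.
      by rewrite /e; field; rewrite gt_eqF.
    by rewrite E' in h3; rewrite mulrDl -[K * C * _]mulrA; apply: lerD.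
  have : s <= s / 2 + K * C.
    apply: ge_sup; first exact: hV.1.
    by move=> _ [y _ <-]; rewrite ler_pdivrMr.
  move=> sK; apply: (le_trans (zs x)); apply: ler_wpM2r; [exact: ltW|lra].
exists d, (2 * (K * C)); split=> // x.
by have := key `|x| x (normr_ge0 x); rewrite /X minxx.
Qed.


Theorem homoclinic_ex : exists W0 W1 W2 W3 : R -> R, exists d C : R,
  [/\ 0 < d, forall t, 0 < W0 t,
    [/\ forall t : R, is_derive t 1 W0 (W1 t), forall t : R, is_derive t 1 W1 (W2 t),
      forall t : R, is_derive t 1 W2 (W3 t) &
      forall t : R, is_derive t 1 W3 ((l1 ^+ 2 + l2 ^+ 2) * W2 t - l1 ^+ 2 * l2 ^+ 2 * W0 t +
         c * (W0 t `^ (q - 1) + W0 t `^ (p - 1)))] &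
    forall t, [/\ W0 t <= C * expR (- d * `|t|), `|W1 t| <= C * expR (- d * `|t|),
      `|W2 t| <= C * expR (- d * `|t|) & `|W3 t| <= C * expR (- d * `|t|)]].
Proof.
have [z [[nz dz _ _] iz z0 zT]] := ground_state_ex q2 p2 c0 l10 l20.
have [d [C [d0 dl1 dl2 zC]]] := ground_state_decay nz dz iz zT.
have nf := nnbm_nonlin q2 p2 c0 nz.
have k1 := kern_sk l10; have k2 := kern_sk l20.
(* The fourth-order equation splits as (l1^2 - D^2) z = g1 and (l2^2 - D^2) g1 = f z, which yields
   the successive derivatives of z. *)
pose g1 := conv (sk l2) (ff z); have ng1 : nnbm g1 by exact: nnbm_conv.
have cz : continuous z.
  have [M M0 zM] := nnbm_bound nz.
  apply: (@loglip_continuous l1 M _ l10) => [x|x x'].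
    by rewrite ltW ?z0//= (le_trans (ler_norm _)).
  by rewrite zT; exact: Tg_loglip.
have cf : continuous (ff z).
  move=> x; apply: cvgMr.
  have h (r : R) : (z y `^ r) @[y --> x] --> z x `^ r.
    have c' : {for z x, continuous (fun y : R => y `^ r)}.
      apply: differentiable_continuous; apply/derivable1_diffP.
      by apply: derivable_powR; rewrite in_itv/= z0.
    exact: (cvg_comp _ _ (cz x) c').
  by apply: cvgD; exact: h.
have cg1 : continuous g1.
  by apply: der_continuous => x; exact: der_conv_sk.
have dW0 (t : R) : is_derive t 1 z (dsk l1 g1 t).
  by rewrite {1}zT; exact: der_conv_sk.
have zE t : conv (sk l1) g1 t = z t by rewrite {1}zT.
exists z, (dsk l1 g1), (fun t => l1 ^+ 2 * z t - g1 t),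
  (fun t => l1 ^+ 2 * dsk l1 g1 t - dsk l2 (ff z) t).
have [M M0 zM] := nnbm_bound nz.
pose K := c * (M `^ (q - 2) + M `^ (p - 2)) * `|C|.
have K0 : 0 <= K by rewrite !mulr_ge0 ?(ltW c0)// addr_ge0 ?powR_ge0.
pose e (t : R) := expR (- d * `|t|); have e0 t : 0 <= e t by exact: expR_ge0.
have ne : nnbm e.
  by apply: continuous_nnbm_exp => //; exact: norm_continuous.
have zC' t : z t <= `|C| * e t.
  by apply: (le_trans (zC t)); rewrite ler_wpM2r// ler_norm.
have fK t : ff z t <= K * e t.
  have zt : z t <= M by rewrite (le_trans (ler_norm _)).
  have h (r : R) : 2 < r -> z t `^ (r - 1) <= M `^ (r - 2) * (`|C| * e t).
    move=> r2; rewrite -powR_B2 ?(ltW (z0 t))//.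
    apply: ler_pM => //; [exact: powR_ge0|exact: ltW|].
    by rewrite ge0_ler_powR ?nnegrE ?(ltW (z0 t)) ?(ltW M0)//; lra.
  rewrite /nonlin /K -!mulrA ler_pM2l// mulrDl lerD// h//.
pose B := (l2 * (l2 - d))^-1.
have B0 : 0 <= B by rewrite invr_ge0 mulr_ge0 ?subr_ge0 ?ltW.
have gK t : g1 t <= K * B * e t.
  apply: (le_trans (le_conv t k2 nf (nnbmZ K0 ne) fK)).
  rewrite convZ// -mulrA ler_wpM2l//.
  apply: (@conv_sk_weight _ _ l20 d (fun x => `|x|) t d0 dl2 _ ne) => x y.
  exact: ler_dist_dist.
have l1' := ltW l10; have l2' := ltW l20.
have KB : 0 <= K * B by rewrite mulr_ge0.
have g0 t : 0 <= g1 t by exact: nnbm_ge0.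
have b1 t : `|dsk l1 g1 t| <= 3 * l1 * (`|C| * e t).
  apply: (le_trans (dsk_le l10 t ng1)); rewrite zE ler_wpM2l//.
  by rewrite mulr_ge0.
have b3 t : `|dsk l2 (ff z) t| <= 3 * l2 * (K * B * e t).
  by apply: (le_trans (dsk_le l20 t nf)); rewrite ler_wpM2l// mulr_ge0.
pose D := (1 + 3 * l1 + l1 ^+ 2 + 3 * l1 ^+ 3) * `|C| + (1 + 3 * l2) * (K * B).
have l12 : 0 <= l1 ^+ 2 by exact: sqr_ge0.
have l13 : 0 <= l1 ^+ 3 by rewrite exprn_ge0.
have a0 t : 0 <= `|C| * e t by rewrite mulr_ge0.
have a1 t : 0 <= K * B * e t by rewrite mulr_ge0.
have DE t : D * e t = `|C| * e t + 3 * l1 * (`|C| * e t) + l1 ^+ 2 * (`|C| * e t) +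
    l1 ^+ 2 * (3 * l1 * (`|C| * e t)) + K * B * e t + 3 * l2 * (K * B * e t).
  by rewrite /D; ring.
exists d, D; split => //.
- split => // t.
  + by apply: derE (der_dsk l10 t ng1 cg1); rewrite zE.
  + exact: (derB (derZ _ (dW0 t)) (der_conv_sk l20 t nf cf)).
  + apply: derE (derB (derZ (l1 ^+ 2) (der_dsk l10 t ng1 cg1)) (der_dsk l20 t nf cf)).
    by rewrite -/g1 zE /nonlin; ring.
- move=> t; rewrite -/(e t) DE.
  have n1 : 0 <= 3 * l1 * (`|C| * e t) by apply: mulr_ge0; [apply: mulr_ge0|].
  have n2 : 0 <= l1 ^+ 2 * (`|C| * e t) by apply: mulr_ge0.
  have n3 : 0 <= l1 ^+ 2 * (3 * l1 * (`|C| * e t)) by apply: mulr_ge0.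
  have n4 : 0 <= 3 * l2 * (K * B * e t) by apply: mulr_ge0; [apply: mulr_ge0|].
  have m1 : l1 ^+ 2 * z t <= l1 ^+ 2 * (`|C| * e t) by rewrite ler_wpM2l.
  have m0 : 0 <= l1 ^+ 2 * z t by rewrite mulr_ge0// ltW.
  have m3 : l1 ^+ 2 * `|dsk l1 g1 t| <= l1 ^+ 2 * (3 * l1 * (`|C| * e t)).
    by rewrite ler_wpM2l.
  have := a0 t; have := a1 t; have := zC' t; have := b1 t; have := b3 t.
  have := gK t; have := g0 t => *; split; [lra|lra|..].
    by rewrite ler_norml; apply/andP; split; lra.
  apply: (le_trans (ler_normB _ _)); rewrite normrM (ger0_norm l12); lra.
Qed.

End homoclinic.

(** * Smooth functions of one variable *)

Section derivative_sequences.
Variable R : realType.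
Implicit Types (a b D : nat -> R -> R) (f g : R -> R).

(** Smoothness with every derivative named, so that supports, bounds and limits can be stated for
    all orders at once. *)
Definition dseq D : Prop := forall k (t : R), is_derive t 1 (D k) (D k.+1 t).

Definition shift_seq D : nat -> R -> R := fun k => D k.+1.

(** The iterated product rule as a sum of 2^k products, without binomial coefficients; this is the
    factor in [leibniz_le]. *)
Fixpoint leibniz k a b : R -> R :=
  if k is k'.+1 then
    fun t => leibniz k' (shift_seq a) b t + leibniz k' a (shift_seq b) t
  else fun t => a 0%N t * b 0%N t.

Lemma dseq_shift D : dseq D -> dseq (shift_seq D).
Proof. by move=> h k t; exact: h. Qed.

Lemma dseq_leibniz a b : dseq a -> dseq b -> dseq (fun k => leibniz k a b).
Proof.
move=> + + k; elim: k a b => [|k IH] a b ha hb t; first exact: derM (ha 0%N t) (hb 0%N t).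
exact: derD (IH _ _ (dseq_shift ha) hb t) (IH _ _ ha (dseq_shift hb) t).
Qed.

Lemma leibniz_le k a b (A B : R) t : (forall j, (j <= k)%N -> `|a j t| <= A) ->
  (forall j, (j <= k)%N -> `|b j t| <= B) -> `|leibniz k a b t| <= 2 ^+ k * (A * B).
Proof.
elim: k a b => [|k IH] a b ha hb /=.
  by rewrite expr0 mul1r normrM ler_pM// ?ha ?hb.
rewrite exprS -mulrA mulr_natl mulr2n (le_trans (ler_normD _ _))// lerD// IH// => j jk.
- by rewrite ha// ltnS.
- by rewrite hb// ltnW// ltnS.
- by rewrite ha// ltnW// ltnS.
- by rewrite hb// ltnS.
Qed.

Lemma leibniz_eq0 k a b t : (forall j, b j t = 0) -> leibniz k a b t = 0.
Proof.
elim: k a b => [|k IH] a b hb /=; first by rewrite hb mulr0.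
by rewrite !IH ?addr0// => j; exact: hb.
Qed.

Lemma cvg_leibniz k a (b : nat -> nat -> R -> R) t :
  (forall j, b n j t @[n --> \oo] --> (if j == 0%N then 1 else 0 : R)) ->
  leibniz k a (b n) t @[n --> \oo] --> a k t.
Proof.
(* The induction shifts b', so it is run for arbitrary limits [c j]. *)
have main k' a' (b' : nat -> nat -> R -> R) (c : nat -> R) :
    (forall j, (fun n => b' n j t) n @[n --> \oo] --> c j) ->
    leibniz k' a' (b' n) t @[n --> \oo] --> leibniz k' a' (fun j => cst (c j)) t.
  elim: k' a' b' c => [|k' IH] a' b' c hb /=; first by apply: cvgMr; exact: hb.
  by apply: cvgD; [exact: (IH _ _ _ hb)|exact: (IH _ _ _ (fun j => hb j.+1))].
move=> hb; have := main k a b _ hb.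
suff -> : leibniz k a (fun j => cst (if j == 0%N then 1 else 0)) t = a k t by [].
elim: k a {b hb} => [|k IH] a /=; first by rewrite mulr1.
by rewrite IH leibniz_eq0 ?addr0.
Qed.

Lemma dseq_coind (S : set (R -> R)) :
  (forall f, S f -> exists2 g, S g & forall t : R, is_derive t 1 f (g t)) ->
  forall f, S f -> exists2 D, dseq D & D 0%N = f.
Proof.
move=> HS f Sf.
have HS' k : S (derive1n k f).
  elim: k => [//|k /HS[g Sg dg]]; rewrite (_ : derive1n _ _ = g)//.
  by apply/funext => t; rewrite derive1nS derive1E; apply: derive_val; exact: dg.
exists (fun k => derive1n k f) => // k t.
have [g Sg dg] := HS _ (HS' k).
rewrite (_ : derive1n k.+1 f t = g t)//.
by rewrite derive1nS derive1E; apply: derive_val; exact: dg.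
Qed.

(** The ring generated by G and the constants. Once it contains the derivatives of its generators it
    is closed under differentiation, hence made of smooth functions. *)
Inductive rgen (G : set (R -> R)) : (R -> R) -> Prop :=
| rgen_base f : G f -> rgen G f
| rgen_cst (c : R) : rgen G (fun=> c)
| rgenD f g : rgen G f -> rgen G g -> rgen G (fun t => f t + g t)
| rgenM f g : rgen G f -> rgen G g -> rgen G (fun t => f t * g t).

Lemma dseq_rgen (G : set (R -> R)) :
  (forall f, G f -> exists2 g, rgen G g & forall t : R, is_derive t 1 f (g t)) ->
  forall f, rgen G f -> exists2 D, dseq D & D 0%N = f.
Proof.
move=> HG; apply: dseq_coind => f rf.
elim: rf => {f}[f Gf|c|f g rf [f' rf' df] rg [g' rg' dg]|f g rf [f' rf' df] rg [g' rg' dg]].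
- exact: HG.
- by exists (fun=> 0); [exact: rgen_cst|move=> t; exact: der_cst].
- by exists (fun t => f' t + g' t); [exact: rgenD|move=> t; exact: derD].
- exists (fun t => f' t * g t + f t * g' t); last by move=> t; exact: derM.
  by apply: rgenD; exact: rgenM.
Qed.

Lemma dseq_unique D (f g : R -> R) k : dseq D -> D k = f ->
  (forall t : R, is_derive t 1 f (g t)) -> D k.+1 = g.
Proof.
move=> dD Df dg; apply/funext => t.
have h1 := dD k t; rewrite Df in h1.
by rewrite -(@derive_val _ _ _ _ _ _ _ h1) (@derive_val _ _ _ _ _ _ _ (dg t)).
Qed.

(** The ring is generated by W0, ..., W3 and all real powers of W0. Positivity of W0 makes these
    powers differentiable within the ring, and the equation keeps the derivative of W3 there. *)
Lemma homoclinic_dseq (q p c l1 l2 : R) (W0 W1 W2 W3 : R -> R) :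
  (forall t, 0 < W0 t) ->
  (forall t : R, is_derive t 1 W0 (W1 t)) -> (forall t : R, is_derive t 1 W1 (W2 t)) ->
  (forall t : R, is_derive t 1 W2 (W3 t)) ->
  (forall t : R, is_derive t 1 W3 (l1 * W2 t - l2 * W0 t +
         c * (W0 t `^ (q - 1) + W0 t `^ (p - 1)))) ->
  exists2 D, dseq D & [/\ D 0%N = W0, D 1%N = W1, D 2%N = W2, D 3%N = W3 &
    forall t, D 4%N t = l1 * W2 t - l2 * W0 t + c * (W0 t `^ (q - 1) + W0 t `^ (p - 1))].
Proof.
move=> W00 d0 d1 d2 d3.
pose P (s : R) : R -> R := fun t => W0 t `^ s.
pose G : set (R -> R) := [set f | f = W0 \/ [\/ f = W1, f = W2, f = W3 | exists s, f = P s]].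
have GW0 : rgen G W0 by apply: rgen_base; left.
have GW1 : rgen G W1 by apply: rgen_base; right; constructor 1.
have GW2 : rgen G W2 by apply: rgen_base; right; constructor 2.
have GW3 : rgen G W3 by apply: rgen_base; right; constructor 3.
have GP s : rgen G (P s) by apply: rgen_base; right; constructor 4; exists s.
have GZ (k : R) f : rgen G f -> rgen G (fun t => k * f t).
  by move=> h; apply: rgenM => //; exact: rgen_cst.
have [D dD D0] : exists2 D, dseq D & D 0%N = W0.
  apply: (dseq_rgen _ GW0) => f [->|[->|->|->|[s ->]]].
  - by exists W1.
  - by exists W2.
  - by exists W3.
  - exists (fun t => (l1 * W2 t + (- l2) * W0 t) + c * (P (q - 1) t + P (p - 1) t)).
      by apply: rgenD; [apply: rgenD; exact: GZ|apply: GZ; exact: rgenD].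
    by move=> t; apply: derE (d3 t); rewrite /P; ring.
  - exists (fun t => s * P (s - 1) t * W1 t); first by apply: rgenM => //; exact: GZ.
    move=> t; exact: (der_comp (d0 t) (is_derive1_powR _ (W00 t))).
have D1 := dseq_unique dD D0 d0; have D2 := dseq_unique dD D1 d1.
have D3 := dseq_unique dD D2 d2; have D4 := dseq_unique dD D3 d3.
by exists D => //; split=> // t; rewrite D4.
Qed.

(** The functions t^(-k) e^(-1/t) span a space closed under differentiation; [theta 0] is the usual
    flat function. *)
Definition theta k : R -> R := fun t => if 0 < t then t ^- k * expR (- t^-1) else 0.

(** The exponential series gives e^(1/t) >= t^(-(k+2)) / (k+2)!: k powers absorb the prefactor and
    two remain, enough for a zero derivative at 0. *)
Lemma theta_le k (t : R) : `|theta k t| <= (k.+2`!)%:R * `|t| ^+ 2.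
Proof.
rewrite /theta; case: ifPn => [t0|_]; last by rewrite normr0 mulr_ge0// exprn_ge0.
have ti : 0 < t^-1 by rewrite invr_gt0.
have t2 : 0 <= t ^+ 2 by exact: sqr_ge0.
rewrite ger0_norm ?mulr_ge0 ?expR_ge0 ?invr_ge0 ?exprn_ge0 ?(ltW t0)//.
rewrite expRN ler_pdivrMr ?expR_gt0// gtr0_norm//.
have := expR_ge1Dxn k.+1 (ltW ti) => h.
have {h} : t^-1 ^+ k.+2 / (k.+2`!)%:R <= expR t^-1 by apply: le_trans h; rewrite lerDr.
rewrite ler_pdivrMr ?ltr0n ?fact_gt0// => h.
have -> : t ^- k = t ^+ 2 * t^-1 ^+ k.+2.
  rewrite !exprS exprVn expr0 mulr1; field; rewrite ?expf_neq0 ?gt_eqF//.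
have -> : (k.+2)`!%:R * t ^+ 2 * expR t^-1 = t ^+ 2 * (expR t^-1 * (k.+2)`!%:R) by ring.
by rewrite ler_wpM2l.
Qed.

Lemma der_sqr_bound (C : R) f : (forall t, `|f t| <= C * `|t| ^+ 2) ->
  is_derive (0 : R) 1 f 0.
Proof.
move=> fC; have f0 : f 0 = 0.
  by apply/eqP; have := fC 0; rewrite normr0 expr0n/= mulr0 normr_le0.
have C0 : 0 <= C by have := fC 1; rewrite normr1 expr1n mulr1; exact: le_trans.
have cv : (fun h : R => h^-1 *: ((f \o shift 0) (h *: (1 : R)) - f 0)) h @[h --> 0^'] --> (0 : R).
  apply/cvgr0Pnorm_le => e e0; near=> h.
  have h0 : h != 0 by near: h; exact: nbhs_dnbhs_neq.
  rewrite /= f0 subr0 addr0 /GRing.scale/= mulr1 normrM normfV.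
  rewrite ler_pdivrMl ?normr_gt0// (le_trans (fC h))// expr2 mulrA mulrC.
  rewrite ler_wpM2l//.
  have : `|h| <= e / (C + 1).
    near: h; apply: dnbhs0_le; apply: divr_gt0 => //; lra.
  rewrite ler_pdivlMr; last lra.
  by have := normr_ge0 h; lra.
split; first by apply/cvg_ex; exists 0.
exact/cvg_lim.
Unshelve. all: by end_near. Qed.

Lemma der_theta k (t : R) :
  is_derive t 1 (theta k) (- k%:R * theta k.+1 t + theta k.+2 t).
Proof.
have [t0|t0|->] := ltgtP t 0.
- have th0 j : theta j t = 0 by rewrite /theta ltNge ltW.
  rewrite !th0 mulr0 addr0.
  refine (@near_eq_is_derive _ _ _ (fun=> 0) (theta k) _ _ _ _ (der_cst t 1 0)).
    near=> s; rewrite /theta ifF//; apply/negbTE; rewrite -leNgt ltW//.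
    by near: s; exact: lt_nbhsl.
- have tn0 : t != 0 by rewrite gt_eqF.
  have dV : is_derive t 1 (fun s : R => s^-1) (- t ^- 2).
    have := @is_deriveV R id t 1 1 tn0 (is_derive_id t 1).
    by rewrite /GRing.scale/= mulr1.
  have dE : is_derive t 1 (fun s : R => expR (- s^-1)) (expR (- t^-1) * t ^- 2).
    have := der_comp (derZ (-1) dV) (is_derive_expR _).
    by rewrite !mulN1r opprK; apply: der_ext => s; rewrite mulN1r.
  have dX : is_derive t 1 (fun s : R => s^-1 ^+ k) (k%:R * t^-1 ^+ k.-1 * - t ^- 2).
    have := @is_deriveX _ _ (fun s : R => s^-1) k t 1 _ dV.
    rewrite /GRing.scale/=; apply: der_ext => s.
    by elim: (k) => [|j IH]; rewrite ?expr0// !exprS -IH.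
  have E : - k%:R * theta k.+1 t + theta k.+2 t =
      k%:R * t^-1 ^+ k.-1 * - t ^- 2 * expR (- t^-1) + t^-1 ^+ k * (expR (- t^-1) * t ^- 2).
    rewrite /theta t0.
    case: k {dX} => [|k]; rewrite /= !exprS ?expr0 ?exprVn; field; rewrite ?expf_neq0 ?tn0 //.
  rewrite E; refine (near_eq_is_derive _ (derM dX dE)).
  near=> s; rewrite /theta ifT ?exprVn//.
  by near: s; exact: lt_nbhsr.
- have th0 j : theta j 0 = 0 by rewrite /theta ltxx.
  rewrite !th0 mulr0 addr0.
  exact: (der_sqr_bound (theta_le k)).
Unshelve. all: by end_near. Qed.

Lemma theta_dseq : exists2 D, dseq D & [/\ D 0%N = theta 0 & forall k t, t <= 0 -> D k t = 0].
Proof.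
pose G : set (R -> R) := [set f | exists k, f = theta k].
have [D dD D0] : exists2 D, dseq D & D 0%N = theta 0.
  apply: (@dseq_rgen G); last by apply: rgen_base; exists 0%N.
  move=> f [k ->]; exists (fun t => - k%:R * theta k.+1 t + theta k.+2 t).
    apply: rgenD; last by apply: rgen_base; exists k.+2.
    by apply: rgenM; [exact: rgen_cst|apply: rgen_base; exists k.+1].
  exact: der_theta.
exists D => //; split=> // k.
(* The derivatives supplied by [dseq_rgen] are not explicit. They vanish for t < 0 by locality, then
   at 0 by continuity. *)
have neg : forall t, t < 0 -> D k t = 0.
  elim: k => [t t0|k IH t t0]; first by rewrite D0 /theta ltNge ltW.
  have h1 := dD k t.
  have h2 : is_derive t 1 (D k) 0.
    refine (@near_eq_is_derive _ _ _ (fun=> 0) (D k) _ _ _ _ (der_cst t 1 0)).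
    by near=> s; rewrite IH//; near: s; exact: lt_nbhsl.
  by rewrite -(@derive_val _ _ _ _ _ _ _ h1) (@derive_val _ _ _ _ _ _ _ h2).
move=> t; rewrite le_eqVlt => /orP[/eqP ->|]; last exact: neg.
have c := der_continuous (dD k).
apply/eqP; rewrite -normr_le0; apply/ler_addgt0Pr => e e0; rewrite add0r.
have : \forall s \near (0 : R)^'-, `|D k 0 - D k s| <= e.
  by have /cvg_at_left_filter /cvgrPdist_le /(_ _ e0) := c 0.
move=> H; near (0 : R)^'- => s.
have s0 : s < 0 by near: s; exact: nbhs_left_lt.
have : `|D k 0 - D k s| <= e by near: s.
by rewrite (neg s s0) subr0.
Unshelve. all: by end_near. Qed.

End derivative_sequences.

(** * Lebesgue measure on R^n *)

Section lebesgue_rV_theory.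
Variable R : realType.
Implicit Types n : nat.
Local Notation leb n := (lebesgue_rV R n).

(** For the product sigma-algebra: f is the limit of f composed with rounding down to a grid of mesh
    1 / (m + 1), and such a composition takes countably many values, on half-open cubes. *)
Lemma continuous_measurable_rV n (f : 'rV[R]_n -> R) : continuous f ->
  measurable_fun setT f.
Proof.
move=> cf.
pose rho m (x : 'rV[R]_n) : 'rV[R]_n :=
  \row_i ((Num.floor (x ord0 i * m.+1%:R))%:~R / m.+1%:R).
apply: (@measurable_fun_cvg _ _ _ setT (fun m => f \o rho m)) => [m|x _].
  move=> _ Y mY; rewrite setTI.
  pose A (k : 'rV[int]_n) (i : 'I_n) : set (measurableTypeR R) :=
    `[(k ord0 i)%:~R / m.+1%:R, (k ord0 i + 1)%:~R / m.+1%:R[%classic.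
  pose F (k : 'rV[int]_n) : set 'rV[R]_n :=
    if pselect (Y (f (\row_i ((k ord0 i)%:~R / m.+1%:R)))) then
      [set x | forall i, A k i (x ord0 i)] else set0.
  have -> : (f \o rho m) @^-1` Y = \bigcup_k F k.
    apply/seteqP; split=> [x /= Yx|x [k _]].
      exists (\row_i Num.floor (x ord0 i * m.+1%:R)) => //; rewrite /F.
      case: pselect => [_ i|]; last first.
        by case; move: Yx; congr (Y (f _)); apply/rowP => i; rewrite !mxE.
      rewrite /A /= in_itv/= !mxE ler_pdivrMr// ltr_pdivlMr//.
      exact: floor_itv.
    rewrite /F; case: pselect => // Yk Ax /=; move: (Yk); congr (Y (f _)).
    apply/rowP => i; rewrite !mxE; congr (_%:~R / _); apply/esym/floor_def.
    by have := Ax i; rewrite /A /= in_itv/= ler_pdivrMr// ltr_pdivlMr.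
  apply: countable_bigcupT_measurable; first exact: countableP.
  have mA k : measurable [set x : 'rV[R]_n | forall i, A k i (x ord0 i)].
    by apply: measurable_rV_box => i; exact: measurable_itv.
  by move=> k; rewrite /F; case: pselect => [?|?]; [exact: mA|exact: measurable0].
apply: (cvg_comp (fun m => rho m x) f _ (cf x)).
apply/cvg_ballP => e e0; near=> m; split=> // i j.
rewrite (ord1 i) /ball/= mxE.
have m0 : 0 < m.+1%:R :> R by [].
have -> : x ord0 j - (Num.floor (x ord0 j * m.+1%:R))%:~R / m.+1%:R =
  (x ord0 j * m.+1%:R - (Num.floor (x ord0 j * m.+1%:R))%:~R) / m.+1%:R.
  by field; rewrite gt_eqF.
have /andP[h1 h2] := floor_itv (x ord0 j * m.+1%:R).
rewrite ger0_norm ?divr_ge0 ?subr_ge0// ltr_pdivrMr//.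
apply: (@lt_le_trans _ _ 1); first by rewrite ltrBlDr addrC -[1]/(1%:~R) -intrD.
rewrite mulrC -ler_pdivrMr// div1r; apply: (@le_trans _ _ m%:R); last by rewrite ler_nat.
by near: m; exact: nbhs_infty_ger.
Unshelve. all: by end_near. Qed.

Lemma measurable_rV_shift n (v : 'rV[R]_n) : measurable_fun setT (fun x : 'rV[R]_n => x + v).
Proof.
apply: measurable_fun_rVP => i.
rewrite (_ : _ \o _ = fun x => rV_coord i x + v ord0 i); last first.
  by apply/funext => x; rewrite /rV_coord /= mxE.
apply: (@measurable_funD _ _ R); last exact: measurable_cst.
exact: measurable_rV_coord.
Qed.

(** Induction on the dimension: the line handles the first coordinate, the induction hypothesis each
    section. *)
Lemma lebesgue_rV_shift n (v : 'rV[R]_n) (B : set 'rV[R]_n) : measurable B ->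
  leb n ((fun x => x + v) @^-1` B) = leb n B.
Proof.
elim: n v B => [|n IH] v B mB.
  congr (leb 0 _); apply/seteqP; split=> x /=; suff -> : x + v = x by [].
  - by apply/rowP => -[].
  - by apply/rowP => -[].
rewrite /= /lebesgue_rV_succ /pushforward /product_measure1.
pose v' := (rV_uncons v).2; pose v0 := v ord0 ord0.
have mB' : measurable (@rV_cons R n @^-1` B).
  by rewrite -[X in measurable X]setTI; exact: measurable_rV_cons.
rewrite -[RHS](@preserving_ge0 _ _ R (@lebesgue_measure R)
  (fun x : measurableTypeR R => x + v0 : measurableTypeR R)); last first.
- by move=> x; exact: measure_ge0.
- exact: measurable_fun_xsection.
- by move=> A mA; exact: (lebesgue_measure_shift v0 mA).
- exact: measurable_funD.
apply: eq_integral => a _ /=.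
pose S := xsection (@rV_cons R n @^-1` B) (a + v0 : measurableTypeR R).
have mS : measurable S by exact: measurable_xsection.
transitivity (leb n ((fun x => x + v') @^-1` S)); last exact: IH.
congr (leb n _); apply/seteqP; split=> x; rewrite /S /xsection /= !inE /=;
  suff -> : rV_cons (a, x) + v = rV_cons ((a + v0 : measurableTypeR R), x + v') by [].
- apply/rowP => i; rewrite mxE; have [j ->|->] := unliftP ord0 i.
    by rewrite !rV_consS /= !mxE.
  by rewrite !rV_cons0.
- apply/rowP => i; rewrite mxE; have [j ->|->] := unliftP ord0 i.
    by rewrite !rV_consS /= !mxE.
  by rewrite !rV_cons0.
Qed.

Lemma int_rV_shift n (v : 'rV[R]_n) (f : 'rV[R]_n -> R) : itg (leb n) f ->
  itg (leb n) (fun x => f (x + v)) /\ lint (leb n) (fun x => f (x + v)) = lint (leb n) f.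
Proof.
apply: preserving_int; first exact: measurable_rV_shift.
by move=> A; exact: lebesgue_rV_shift.
Qed.

Definition box n (r : R) : set 'rV[R]_n := [set x | forall i, `|x ord0 i| <= r].

Arguments box n r : clear implicits.

Lemma measurable_box n (r : R) : measurable (box n r).
Proof.
rewrite (_ : box n r = [set x | forall i, (fun=> `[- r, r]%classic : set R) i (x ord0 i)]).
  apply: (@measurable_rV_box R n (fun=> `[- r, r]%classic)) => i.
  exact: measurable_itv.
by apply/seteqP; split=> x /= h i; have := h i; rewrite /= in_itv/= ler_norml.
Qed.

Lemma lebesgue_box n (r : R) : 0 <= r -> leb n (box n r) = ((2 * r) ^+ n)%:E.
Proof.
move=> r0.
rewrite (_ : box n r = [set x | forall i, (fun=> `[- r, r]%classic : set R) i (x ord0 i)]).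
  rewrite (@lebesgue_rV_box R n (fun=> `[- r, r]%classic)); last first.
    by move=> i; exact: measurable_itv.
  rewrite (eq_bigr (fun=> (2 * r)%:E)).
    rewrite prodEFin; congr EFin; by rewrite prodr_const card_ord.
  move=> i _; rewrite lebesgue_measure_itv/= lte_fin.
  case: ifPn => [_|]; first by rewrite -EFinB; congr EFin; ring.
  by rewrite -leNgt => h; congr EFin; lra.
by apply/seteqP; split=> x /= h i; have := h i; rewrite /= in_itv/= ler_norml.
Qed.

Lemma itg_box n (r : R) : 0 <= r -> itg (leb n) (\1_(box n r)) /\
  lint (leb n) (\1_(box n r)) = (2 * r) ^+ n.
Proof.
move=> r0; have mb : measurable (box n r) by exact: measurable_box.
have E : (\int[leb n]_x (\1_(box n r) x)%:E = ((2 * r) ^+ n)%:E)%E.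
  by rewrite integral_indic// setIT; exact: lebesgue_box.
have i : itg (leb n) (\1_(box n r)).
  by apply: (@itg_ge0 _ _ _ _ _ ((2 * r) ^+ n)) => //; rewrite E.
by split=> //; apply: EFin_inj; rewrite int_EFin.
Qed.

Lemma itg_bounded_box n (r M : R) (f : 'rV[R]_n -> R) : measurable_fun setT f ->
  (forall x, `|f x| <= M) -> (forall x, f x != 0 -> box n r x) -> itg (leb n) f.
Proof.
move=> mf fM fb; have [i _] := @itg_box n _ (normr_ge0 r).
apply: itg_le mf (itgZ M i) _ => x; have [->|fx] := eqVneq (f x) 0.
  by rewrite normr0 mulr_ge0// (le_trans _ (fM x)).
rewrite indicE mem_set ?mulr1// => j.
exact: le_trans (fb x fx j) (ler_norm r).
Qed.

(* Translation invariance: the difference quotients of g have zero integral. *)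
Lemma int_partial_eq0 n (g g' : 'rV[R]_n -> R) (i : 'I_n) (r M : R) :
  measurable_fun setT g -> (forall x, is_derive x (delta_mx ord0 i) g (g' x)) ->
  (forall x, `|g x| <= M) -> (forall x, `|g' x| <= M) ->
  (forall x, g x != 0 -> box n r x) -> itg (leb n) g' /\ lint (leb n) g' = 0.
Proof.
move=> mg dg gM gM' gb; pose e : 'rV[R]_n := delta_mx ord0 i.
have ig : itg (leb n) g by exact: itg_bounded_box gb.
pose h (m : nat) : R := m.+1%:R^-1.
have h0 m : 0 < h m by rewrite invr_gt0.
have h1 m : h m <= 1 by rewrite invf_le1// ler1n.
pose G m x := (h m)^-1 * (g (x + h m *: e) - g x).
have iG m : itg (leb n) (G m) /\ lint (leb n) (G m) = 0.
  have [i1 e1] := int_rV_shift (h m *: e) ig.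
  split; first by apply: itgZ; exact: itgB.
  by rewrite intZ ?intB// ?e1 ?subrr ?mulr0//; exact: itgB.
have cG x : G m x @[m --> \oo] --> g' x.
  have [/cvg_ex[l hl] <-] := dg x; rewrite /derive (cvg_lim _ hl)//.
  have ch : h m @[m --> \oo] --> (0 : R)^'.
    apply: (@cvg_trans _ (within (fun y : R => y != 0) (nbhs (0 : R)))) => //.
    move=> A; rewrite /within/= => HA.
    have := @cvg_harmonic R; move=> /(_ _ HA).
    rewrite !near_simpl; apply: filterS => m; apply.
    by rewrite gt_eqF.
  have := cvg_comp _ _ ch hl; apply: cvg_trans; apply: near_eq_cvg; apply: nearW => m /=.
  by rewrite /G /GRing.scale/= [h m *: e + x]addrC.
(* As h m <= 1, the quotient vanishes outside the box enlarged by 1; inside, the mean value theorem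
   bounds it by M. *)
have bG m x : `|G m x| <= M * \1_(box n (`|r| + 1)) x.
  have M0 : 0 <= M := le_trans (normr_ge0 _) (gM x).
  have [inb|nb] := pselect (box n (`|r| + 1) x); last first.
    have g0 (t : R) : `|t| <= 1 -> g (x + t *: e) = 0.
      move=> t1; apply/eqP/negPn/negP => /gb H; apply: nb => j.
      have := H j; rewrite !mxE /= => Hj.
      have tj : `|t * (i == j)%:R| <= 1.
        by case: eqP => _; rewrite ?mulr1 ?mulr0 ?normr0.
      have := ler_normD (x ord0 j + t * (i == j)%:R) (- (t * (i == j)%:R)).
      rewrite addrK normrN => H1; have := ler_norm r.
      by rewrite eq_sym in Hj; lra.
    have gx : g x = 0 by have := g0 0; rewrite scale0r addr0; apply; rewrite normr0.
    rewrite /G gx g0; last by rewrite ger0_norm ?(ltW (h0 m)).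
    by rewrite subrr mulr0 normr0 mulr_ge0.
  rewrite indicE mem_set// mulr1 /G.
  pose phi (t : R) := g (x + t *: e).
  have dphi (t : R) : is_derive t 1 phi (g' (x + t *: e)).
    have := (der_lineP g (x + t *: e) e (g' (x + t *: e))).1 (dg _) => H.
    apply/der_lineP; apply: der_ext H => u; rewrite /phi.
    have -> : u *: (1 : R) = u by rewrite /GRing.scale/= mulr1.
    by rewrite scalerDl addrA.
  have cphi : {within `[0, h m], continuous phi}.
    by apply: continuous_subspaceT; exact: der_continuous dphi.
  have [c _ Ec] := MVT (h0 m) (fun t _ => dphi t) cphi.
  rewrite /phi subr0 scale0r addr0 in Ec; rewrite Ec mulrC mulfK ?gt_eqF//.
have mG m : measurable_fun setT (G m) by exact: itg_meas (iG m).1.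
have iB : itg (leb n) (fun x => M * \1_(box n (`|r| + 1)) x).
  by apply: itgZ; apply: (@itg_box n _ _).1; rewrite addr_ge0.
have [i' c'] := dominated_int mG iB bG cG.
split=> //.
have := cvg_lim (@Rhausdorff R) c'; move=> <-.
by rewrite (_ : (fun m => _) = (fun=> 0)); [rewrite lim_cst|apply/funext => m; rewrite (iG m).2].
Qed.

End lebesgue_rV_theory.

Arguments box {R} n r.

(** * Radial functions *)

Section radial.
Variables (R : realType) (n : nat).
Local Notation V_ := 'rV[R]_n.
Implicit Types (x y : 'rV[R]_n) (V : R -> R).
Local Notation leb := (lebesgue_rV R n).
Local Notation e_ i := (delta_mx ord0 i : 'rV[R]_n).

Definition sqn (x : V_) : R := \sum_(i < n) x ord0 i ^+ 2.

(* Radial functions through the Emden-Fowler variable t = ln |x|^2. *)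
Definition rad (V : R -> R) (x : V_) : R := if sqn x == 0 then 0 else V (ln (sqn x)).

Lemma sqn_ge0 x : 0 <= sqn x.
Proof. by apply: sumr_ge0 => i _; exact: sqr_ge0. Qed.

Lemma coord_sqn x i : x ord0 i ^+ 2 <= sqn x.
Proof.
rewrite /sqn (bigD1 i)//= lerDl sumr_ge0// => j _; exact: sqr_ge0.
Qed.

Lemma sqn_eq0 x : (sqn x == 0) = (x == 0).
Proof.
apply/idP/eqP => [/eqP s0|->]; last first.
  by rewrite /sqn big1// => i _; rewrite mxE expr0n.
apply/rowP => i; rewrite mxE; apply/eqP; rewrite -sqrf_eq0 eq_le sqr_ge0 andbT.
by rewrite -s0 coord_sqn.
Qed.

Lemma sqn_gt0 x : x != 0 -> 0 < sqn x.
Proof. by move=> x0; rewrite lt_neqAle sqn_ge0 eq_sym sqn_eq0 x0. Qed.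

Lemma der_coord (x v : V_) i : is_derive x v (fun y : V_ => y ord0 i) (v ord0 i).
Proof.
apply/der_lineP.
apply: (@der_ext _ _ (fun t : R => x ord0 i + v ord0 i * t)).
  by move=> t; rewrite !mxE mulrC.
have := derD (der_cst (0 : R) 1 (x ord0 i)) (derZ (v ord0 i) (is_derive_id (0 : R) 1)).
by rewrite add0r mulr1.
Qed.

Lemma der_sqn x i : is_derive x (e_ i) sqn (2 * x ord0 i).
Proof.
have H (j : 'I_n) : is_derive x (e_ i) (fun y : V_ => y ord0 j ^+ 2) (2 * x ord0 j * (i == j)%:R).
  have := derM (der_coord x (e_ i) j) (der_coord x (e_ i) j).
  have -> : e_ i ord0 j * x ord0 j + x ord0 j * e_ i ord0 j = 2 * x ord0 j * (i == j)%:R.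
    by rewrite !mxE /= (eq_sym j); ring.
  by apply: der_ext => y; rewrite expr2.
have E : \sum_(j < n) (2 * x ord0 j * (i == j)%:R) = 2 * x ord0 i.
  rewrite (bigD1 i)//= eqxx mulr1 big1 ?addr0// => j.
  by rewrite eq_sym => /negbTE ->; rewrite mulr0.
have := @is_derive_sum _ _ _ n (fun j (y : V_) => y ord0 j ^+ 2) x (e_ i) _ H.
by rewrite E; apply: der_ext => y; rewrite fct_sumE.
Qed.

Lemma continuous_sqn : continuous sqn.
Proof.
suff H (s : seq 'I_n) : continuous (fun y : V_ => \sum_(i <- s) y ord0 i ^+ 2).
  exact: (H (index_enum 'I_n)).
elim: s => [|j s IH].
  have -> : (fun y : V_ => \sum_(i <- [::]) y ord0 i ^+ 2) = (fun=> 0).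
    by apply/funext => y; rewrite big_nil.
  exact: cst_continuous.
have -> : (fun y : V_ => \sum_(i <- j :: s) y ord0 i ^+ 2) =
    (fun y => y ord0 j * y ord0 j + \sum_(i <- s) y ord0 i ^+ 2).
  by apply/funext => y; rewrite big_cons expr2.
move=> x; have c := @coord_continuous R 1 n ord0 j x.
exact: (cvgD (cvgM c c) (IH x)).
Qed.

Lemma near_sqn_neq0 x : x != 0 -> \forall y \near x, sqn y != 0.
Proof.
move=> /sqn_gt0 x0; near=> y; rewrite gt_eqF//.
by near: y; have /cvgr_gt := @continuous_sqn x; exact.
Unshelve. all: by end_near. Qed.

Lemma near_sqn_small (r : R) : \forall y \near (0 : V_), sqn y = 0 \/ ln (sqn y) <= r.
Proof.
near=> y; have [->|y0] := eqVneq (sqn y) 0; [by left|right].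
have s0 : 0 < sqn y by rewrite lt_neqAle sqn_ge0 eq_sym y0.
rewrite -(expRK r) ler_ln ?posrE ?expR_gt0// ltW//.
near: y; have := @continuous_sqn 0; rewrite /continuous_at.
have -> : sqn 0 = 0 by apply/eqP; rewrite sqn_eq0.
by move=> /cvgr_lt; apply; exact: expR_gt0.
Unshelve. all: by end_near. Qed.

(** At the origin t = ln |x|^2 tends to -oo, so vanishing of V near -oo makes [rad V] vanish in a
    neighbourhood of 0. *)
Definition admissible_at (x : V_) (V : R -> R) : Prop :=
  x != 0 \/ exists r : R, forall t, t <= r -> V t = 0.

Lemma near_rad0 V : (exists r : R, forall t, t <= r -> V t = 0) ->
  \forall y \near (0 : V_), 0 = rad V y.
Proof.
move=> [r Vr]; near=> y; rewrite /rad.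
have [//|h] : sqn y = 0 \/ ln (sqn y) <= r by near: y; exact: near_sqn_small.
  by move=> ->; rewrite eqxx.
by case: ifP => // _; rewrite Vr.
Unshelve. all: by end_near. Qed.

Lemma continuous_rad V x : continuous V -> admissible_at x V -> {for x, continuous (rad V)}.
Proof.
move=> cV aV; have [x0|x0] := eqVneq x 0.
  case: aV => [|Vr]; first by rewrite x0 eqxx.
  have E : rad V 0 = 0 by rewrite /rad (_ : sqn 0 == 0) ?sqn_eq0.
  rewrite x0; suff : rad V y @[y --> (0 : V_)] --> rad V 0 by [].
  rewrite E; have N := near_rad0 Vr.
  exact: (cvg_trans (near_eq_cvg N) (cvg_cst (0 : R))).
have c : {for x, continuous (fun y => V (ln (sqn y)))}.
  apply: (@continuous_comp _ _ _ (fun y => ln (sqn y)) V); last exact: cV.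
  apply: (@continuous_comp _ _ _ sqn (@ln R)); first exact: continuous_sqn.
  by apply: continuous_ln; exact: sqn_gt0.
have E : rad V x = V (ln (sqn x)) by rewrite /rad sqn_eq0 (negbTE x0).
suff : rad V y @[y --> x] --> rad V x by [].
rewrite E.
have N : \forall y \near x, V (ln (sqn y)) = rad V y.
  by near=> y; rewrite /rad ifN//; near: y; exact: near_sqn_neq0.
exact: (cvg_trans (near_eq_cvg N) c).
Unshelve. all: by end_near. Qed.

(** The i-th partial derivative of ln |x|^2 is 2 x_i / |x|^2, that is 2 x_i e^(-t). *)
Definition radD (V1 : R -> R) : R -> R := fun t => 2 * (expR (- t) * V1 t).

Lemma der_rad V V1 x i : (forall t : R, is_derive t 1 V (V1 t)) -> admissible_at x V ->
  admissible_at x V1 -> is_derive x (e_ i) (rad V) (x ord0 i * rad (radD V1) x).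
Proof.
move=> dV aV aV1; have [x0|x0] := eqVneq x 0.
  case: aV => [|Vr]; first by rewrite x0 eqxx.
  rewrite x0 mxE mul0r.
  refine (near_eq_is_derive _ (der_cst (0 : V_) (e_ i) 0)).
  exact: near_rad0.
have s0 := sqn_gt0 x0.
refine (near_eq_is_derive (f := fun y => V (ln (sqn y))) _ _).
  near=> y; rewrite /rad ifN//; near: y; exact: near_sqn_neq0.
have := der_comp (der_comp (der_sqn x i) (is_derive1_ln s0)) (dV (ln (sqn x))).
apply: derE; rewrite /rad (gt_eqF s0) /radD expRN lnK ?posrE//; ring.
Unshelve. all: by end_near. Qed.

(** The analogue of [dseq_coind]. Derivatives are known on A only, which suffices because A is open
    and derivatives are local. *)
Lemma class_C_coind (A : set V_) (G : set (V_ -> R)) : open A ->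
  (forall f, G f -> (forall x, A x -> {for x, continuous f}) /\
     forall i, exists2 g, G g & forall x, A x -> is_derive x (e_ i) f (g x)) ->
  forall f, G f -> forall k, class_C k A f.
Proof.
move=> oA HG f Gf k.
have P (s : seq 'I_n) : exists2 g, G g & forall x, A x -> partials s f x = g x.
  elim: s => [|i s [g Gg Eg]]; first by exists f.
  have [_ /(_ i)[g' Gg' dg']] := HG _ Gg; exists g' => // x Ax.
  rewrite /partials /= -/(partials s f) /partial.
  rewrite (@near_eq_derive _ _ _ _ g); first by apply: derive_val; exact: dg'.
  by near=> y; apply: Eg; near: y; exact: open_nbhs_nbhs.
move=> s x Ax; have [g Gg Eg] := P s; have [cg dg] := HG _ Gg.
have nE : \forall y \near x, g y = partials s f y.
  by near=> y; rewrite Eg//; near: y; exact: open_nbhs_nbhs.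
split=> [_|_ i].
  suff : partials s f y @[y --> x] --> partials s f x by [].
  by rewrite Eg//; exact: (cvg_trans (near_eq_cvg nE) (cg x Ax)).
have [g' _ dg'] := dg i.
by apply: (near_eq_derivable nE); apply: ex_derive; exact: dg'.
Unshelve. all: by end_near. Qed.

Definition expD (m : nat) (V : R -> R) : R -> R := fun t => expR (- m%:R * t) * V t.

(** The algebra generated by the coordinates and the functions |x|^(-2m) D_k(ln |x|^2), closed under
    partial derivatives. *)
Inductive radgen (D : nat -> R -> R) : (V_ -> R) -> Prop :=
| radgen_coord i : radgen D (fun x => x ord0 i)
| radgen_cst (c : R) : radgen D (fun=> c)
| radgen_rad m k : radgen D (rad (expD m (D k)))
| radgenD f g : radgen D f -> radgen D g -> radgen D (fun x => f x + g x)
| radgenM f g : radgen D f -> radgen D g -> radgen D (fun x => f x * g x).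

Lemma der_expD m V V1 (t : R) : is_derive t 1 V (V1 t) ->
  is_derive t 1 (expD m V) (- m%:R * expD m V t + expD m V1 t).
Proof. by move=> dV; apply: derE (derM (der_expRZ _ t) dV); rewrite /expD; ring. Qed.

Lemma radE V V' x : (forall t, V t = V' t) -> rad V x = rad V' x.
Proof. by move=> /funext ->. Qed.

Lemma radDl V V' x : rad (fun t => V t + V' t) x = rad V x + rad V' x.
Proof. by rewrite /rad; case: ifP; rewrite ?addr0. Qed.

Lemma radZ (c : R) V x : rad (fun t => c * V t) x = c * rad V x.
Proof. by rewrite /rad; case: ifP; rewrite ?mulr0. Qed.

Lemma class_C_rad (A : set V_) D k : open A -> dseq D ->
  (forall x j, A x -> admissible_at x (D j)) -> class_C k A (rad (D 0%N)).
Proof.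
move=> oA dD aD.
have -> : rad (D 0%N) = rad (expD 0 (D 0%N)).
  by apply/funext => x; apply: radE => t; rewrite /expD oppr0 mul0r expR0 mul1r.
apply: (@class_C_coind A (radgen D)) => //; last exact: radgen_rad.
have dE m j (t : R) := der_expD m (dD j t).
have aE x m j : A x -> admissible_at x (expD m (D j)).
  move=> Ax; have [x0|[r h]] := aD x j Ax; [by left|right; exists r => t tr].
  by rewrite /expD h// mulr0.
move=> f; elim => {f} [j|c|m j|f g rf [cf df] rg [cg dg]|f g rf [cf df] rg [cg dg]].
- split=> [x _|i]; first exact: coord_continuous.
  exists (fun=> e_ i ord0 j); first exact: radgen_cst.
  by move=> x _; exact: der_coord.
- split=> [x _|i]; first exact: cst_continuous.
  by exists (fun=> 0); [exact: radgen_cst|move=> x _; exact: der_cst].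
- split=> [x Ax|i].
    by apply: continuous_rad; [exact: der_continuous (dE m j)|exact: aE].
  exists (fun x => x ord0 i * (2 * (- m%:R * rad (expD m.+1 (D j)) x + rad (expD m.+1 (D j.+1)) x))).
    apply: radgenM; first exact: radgen_coord.
    apply: radgenM; first exact: radgen_cst.
    apply: radgenD; last exact: radgen_rad.
    by apply: radgenM; [exact: radgen_cst|exact: radgen_rad].
  move=> x Ax; apply: derE (@der_rad _ _ x i (dE m j) (aE x m j Ax) _).
    congr (_ * _); rewrite -radZ -radDl -radZ; apply: radE => t; rewrite /radD /expD.
    have -> : - m.+1%:R * t = - t + - m%:R * t by rewrite -natr1; ring.
    by rewrite expRD; ring.
  have [x0|[r h]] := aE x m j Ax; first by left.
  have [x0|[r' h']] := aE x m j.+1 Ax; first by left.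
  right; exists (Num.min r r') => t; rewrite le_min => /andP[tr tr'].
  by rewrite h// h'// mulr0 addr0.
- split=> [x Ax|i]; first exact: (cvgD (cf x Ax) (cg x Ax)).
  have [f' rf' df'] := df i; have [g' rg' dg'] := dg i.
  exists (fun x => f' x + g' x); first exact: radgenD.
  by move=> x Ax; exact: (derD (df' x Ax) (dg' x Ax)).
- split=> [x Ax|i]; first exact: (cvgM (cf x Ax) (cg x Ax)).
  have [f' rf' df'] := df i; have [g' rg' dg'] := dg i.
  exists (fun x => f' x * g x + f x * g' x); first by apply: radgenD; exact: radgenM.
  by move=> x Ax; exact: (derM (df' x Ax) (dg' x Ax)).
Qed.

(** The terms with 4 come from x_i^2, whose sum cancels one factor |x|^(-2); the term with n comes
    from differentiating the factor x_i of the gradient. *)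
Definition lapV (V1 V2 : R -> R) : R -> R :=
  fun t => expR (- t) * (4 * (V2 t - V1 t) + 2 * n%:R * V1 t).

Lemma laplacian_rad V V1 V2 x : (forall t : R, is_derive t 1 V (V1 t)) ->
  (forall t : R, is_derive t 1 V1 (V2 t)) ->
  (exists r : R, forall t, t <= r -> V t = 0 /\ V1 t = 0 /\ V2 t = 0) ->
  laplacian (rad V) x = rad (lapV V1 V2) x.
Proof.
move=> d1 d2 [r Vr].
have a0 y : admissible_at y V by right; exists r => t /Vr[].
have a1 y : admissible_at y V1 by right; exists r => t /Vr[_ []].
have a2 y : admissible_at y V2 by right; exists r => t /Vr[_ []].
have dV (t : R) : is_derive t 1 (radD V1) (2 * (expR (- t) * (V2 t - V1 t))).
  have := derZ 2 (derM (der_expRZ (-1) t) (d2 t)).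
  have E (s : R) : expR (-1 * s) = expR (- s) by rewrite mulN1r.
  rewrite !E => h; apply: (@der_ext R R (fun s : R => 2 * (expR (-1 * s) * V1 s))).
    by move=> s; rewrite E.
  by apply: derE h; ring.
have aD y : admissible_at y (radD V1).
  by right; exists r => t /Vr[_ [h _]]; rewrite /radD h !mulr0.
have aD' y : admissible_at y (fun t => 2 * (expR (- t) * (V2 t - V1 t))).
  by right; exists r => t /Vr[_ [h h']]; rewrite h h' subr0 !mulr0.
have E i : partial i (partial i (rad V)) x = rad (radD V1) x +
    x ord0 i ^+ 2 * rad (radD (fun t => 2 * (expR (- t) * (V2 t - V1 t)))) x.
  have -> : partial i (rad V) = fun y => y ord0 i * rad (radD V1) y.
    apply/funext => y; apply: derive_val; exact: der_rad.
  have := derM (der_coord x (e_ i) i) (der_rad i dV (aD x) (aD' x)).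
  case=> _ e; rewrite /partial e !mxE !eqxx /= mul1r; ring.
rewrite /laplacian (eq_bigr _ (fun i _ => E i)) big_split/= sumr_const card_ord.
rewrite -mulr_suml -/(sqn x) -[_ *+ n]mulr_natl.
rewrite /rad; case: (eqVneq (sqn x) 0) => [_|s0] /=; first by rewrite !mulr0 addr0.
rewrite /radD /lapV; set t := ln _.
have s0' : 0 < sqn x by rewrite lt_neqAle sqn_ge0 eq_sym s0.
have Es : sqn x * expR (- t) = 1 by rewrite expRN lnK ?posrE// divff.
have -> : sqn x * (2 * (expR (- t) * (2 * (expR (- t) * (V2 t - V1 t))))) =
   (sqn x * expR (- t)) * (4 * (expR (- t) * (V2 t - V1 t))) by ring.
by rewrite Es; ring.
Qed.

(** Vanishing for t <= -r gives smoothness at the origin, vanishing for t >= r a bounded support. *)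
Lemma test_rad D : dseq D -> (exists r : R, forall k t, r <= `|t| -> D k t = 0) ->
  test_function (rad (D 0%N)).
Proof.
move=> dD [r Dr]; split.
  move=> k; apply: class_C_rad => //; first exact: openT.
  move=> x j _; right; exists (- `|r|) => t tr; apply: Dr.
  have := ler_norm r; have := ler_norm (- t); rewrite normrN; lra.
pose e : R := Num.sqrt (expR r).
have cB : compact [set v : V_ | forall i, `[- e, e]%classic (v ord0 i)].
  by apply: (@rV_compact R n (fun=> `[- e, e]%classic)) => i; exact: segment_compact.
apply: subclosed_compact cB _; first exact: closed_closure.
have cK : closed [set x : V_ | sqn x <= expR r].
  by apply: (@preimage_closed _ _ sqn [set s | s <= expR r]); [move=> x _; exact: continuous_sqn|
    exact: closed_le].
apply: (@subset_trans _ [set x : V_ | sqn x <= expR r]).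
  rewrite [X in _ `<=` X](closure_id _).1//; apply: closureS => x /=.
  rewrite /rad; case: (eqVneq (sqn x) 0) => [_|s0]; first by rewrite eqxx.
  have s0' : 0 < sqn x by rewrite lt_neqAle sqn_ge0 eq_sym s0.
  apply: contraNle => h; apply/eqP/Dr.
  rewrite (le_trans _ (ler_norm _))// -(expRK r) ler_ln ?posrE ?expR_gt0//.
  exact: ltW.
move=> x /= h i; rewrite in_itv/= -ler_norml /e -sqrtr_sqr ler_wsqrtr//.
exact: le_trans (coord_sqn x i) h.
Qed.

End radial.

(** * Test functions and Green's formula *)

Section test_functions.
Variables (R : realType) (n : nat).
Local Notation V_ := 'rV[R]_n.
Local Notation leb := (lebesgue_rV R n).
Local Notation e_ i := (delta_mx ord0 i : 'rV[R]_n).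
Implicit Types (x y : V_) (phi b : V_ -> R).

Lemma test_derive phi s i x : test_function phi ->
  is_derive x (e_ i) (partials s phi) (partials (i :: s) phi x).
Proof.
move=> [C _]; have [_ /(_ (ltnSn _) i) d] := C (size s).+1 s x Logic.I.
by split.
Qed.

Lemma test_continuous phi s : test_function phi -> continuous (partials s phi).
Proof. by move=> [C _] x; have [/(_ (leqnn _))] := C (size s) s x Logic.I. Qed.

Lemma partials_support phi s x : partials s phi x != 0 -> closure [set y | phi y != 0] x.
Proof.
move=> sx; apply: contrapT => nx; move: sx; apply/negP; rewrite negbK.
have oU : open (~` closure [set y | phi y != 0]).
  by apply: closed_openC; exact: closed_closure.
have H (t : seq 'I_n) y : (~` closure [set y | phi y != 0]) y -> partials t phi y = 0.
  elim: t y => [|i t IH] y ny.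
    apply/eqP/negPn/negP => py; apply: ny; exact: subset_closure.
  rewrite /partials /= -/(partials t phi) /partial.
  rewrite (@near_eq_derive _ _ _ _ (fun=> 0)); first exact: derive_cst.
  by near=> z; apply: IH; near: z; exact: open_nbhs_nbhs.
by apply/eqP; exact: H.
Unshelve. all: by end_near. Qed.

Lemma test_bounded phi : test_function phi -> exists r : R, forall s,
  (exists M : R, forall x, `|partials s phi x| <= M) /\
  (forall x, partials s phi x != 0 -> box n r x).
Proof.
move=> tp; have [_ cK] := tp.
have [r [_ Hr]] := compact_bounded cK.
exists (r + 1) => s; split; last first.
  move=> x /partials_support Kx i.
  have : `|x| <= r + 1 by apply: (Hr (r + 1)) => //; rewrite ltrDl.
  apply: le_trans.
  have -> : `|x| = mx_norm x by []. rewrite mx_normrE.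
  exact: (@le_bigmax _ _ _ _ (fun ij : 'I_1 * 'I_n => `|x ij.1 ij.2|) (ord0, i)).
have := compact_bounded (continuous_compact (continuous_subspaceT (@test_continuous phi s tp)) cK).
move=> [M [_ HM]]; exists (`|M| + 1) => x.
have [->|/partials_support Kx] := eqVneq (partials s phi x) 0.
  by rewrite normr0 addr_ge0.
apply: (HM (`|M| + 1)); last by exists x.
by rewrite (le_lt_trans (ler_norm _))// ltrDl.
Qed.

Lemma test_measurable phi s : test_function phi -> measurable_fun setT (partials s phi).
Proof. by move=> tp; apply: continuous_measurable_rV; exact: test_continuous. Qed.

Lemma itg_test phi b s t : test_function phi -> test_function b ->
  itg leb (fun x => partials s b x * partials t phi x).
Proof.
move=> tp tb; have [r Hr] := test_bounded tp; have [r' Hr'] := test_bounded tb.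
have [M HM] := (Hr t).1; have [M' HM'] := (Hr' s).1.
apply: (@itg_bounded_box _ _ r (M' * M)).
- by apply: measurable_funM; exact: test_measurable.
- by move=> x; rewrite normrM ler_pM.
- by move=> x; rewrite mulf_eq0 negb_or => /andP[_ /(Hr t).2].
Qed.

(** The product of the two functions has compact support, so its partial derivative integrates to 0
    by [int_partial_eq0]. *)
Lemma int_by_parts phi b s t i : test_function phi -> test_function b ->
  lint leb (fun x => partials (i :: s) b x * partials t phi x) =
  - lint leb (fun x => partials s b x * partials (i :: t) phi x).
Proof.
move=> tp tb; have [r Hr] := test_bounded tp; have [r' Hr'] := test_bounded tb.
have [M HM] := (Hr t).1; have [M' HM'] := (Hr' s).1.
have [K HK] := (Hr (i :: t)).1; have [K' HK'] := (Hr' (i :: s)).1.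
have M0 : 0 <= M := le_trans (normr_ge0 _) (HM 0).
have M0' : 0 <= M' := le_trans (normr_ge0 _) (HM' 0).
have K0 : 0 <= K := le_trans (normr_ge0 _) (HK 0).
have K0' : 0 <= K' := le_trans (normr_ge0 _) (HK' 0).
pose G x := partials (i :: s) b x * partials t phi x +
    partials s b x * partials (i :: t) phi x.
have [_] : itg leb G /\ lint leb G = 0.
  apply: (@int_partial_eq0 R n (fun x => partials s b x * partials t phi x) _ i r
    (M' * M + (K' * M + M' * K))).
  - exact: itg_meas (itg_test s t tp tb).
  - move=> x; exact: derM (test_derive s i x tb) (test_derive t i x tp).
  - move=> x; rewrite normrM; apply: (le_trans (ler_pM _ _ (HM' x) (HM x))) => //.
    by rewrite lerDl addr_ge0// mulr_ge0.
  - move=> x; rewrite (le_trans (ler_normD _ _))// !normrM.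
    apply: (@le_trans _ _ (K' * M + M' * K)); first by rewrite lerD// ler_pM.
    by rewrite lerDr mulr_ge0.
  - by move=> x; rewrite mulf_eq0 negb_or => /andP[_ /(Hr t).2].
rewrite /G intD; [|exact: itg_test..].
by move/eqP; rewrite addr_eq0 => /eqP.
Qed.

Lemma green phi b : test_function phi -> test_function b ->
  lint leb (fun x => b x * laplacian phi x) = lint leb (fun x => laplacian b x * phi x).
Proof.
move=> tp tb.
have S (F : 'I_n -> V_ -> R) : (forall i, itg leb (F i)) ->
    lint leb (fun x => \sum_(i < n) F i x) = \sum_(i < n) lint leb (F i).
  move=> iF; suff [_] : itg leb (fun x => \sum_(i <- index_enum 'I_n) F i x) /\
     lint leb (fun x => \sum_(i <- index_enum 'I_n) F i x) = \sum_(i <- index_enum 'I_n) lint leb (F i) by [].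
  elim: (index_enum 'I_n) => [|j s [IH1 IH2]].
    rewrite big_nil (_ : (fun x => _) = (fun=> 0)); last by apply/funext => x; rewrite big_nil.
    by split; [exact: itg0|exact: int0].
  rewrite big_cons (_ : (fun x => _) = (fun x => F j x + \sum_(i <- s) F i x)).
    by split; [exact: itgD|rewrite intD// IH2].
  by apply/funext => x; rewrite big_cons.
rewrite (_ : (fun x => _) = (fun x => \sum_(i < n) partials [::] b x * partials [:: i; i] phi x)); last first.
  by apply/funext => x; rewrite /laplacian mulr_sumr.
rewrite [RHS](_ : _ = lint leb (fun x => \sum_(i < n) partials [:: i; i] b x * partials [::] phi x)); last first.
  by apply: eq_int => x; rewrite /laplacian mulr_suml.
rewrite !S; [|by move=> i; exact: itg_test..].
by apply: eq_bigr => i _; rewrite !int_by_parts// opprK.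
Qed.

End test_functions.

(** * Integrability of the borderline radial weight *)

Section radial_integrals.
Variables (R : realType) (n : nat).
Local Notation V_ := 'rV[R]_n.
Local Notation leb := (lebesgue_rV R n).

Lemma measurable_sqn : measurable_fun setT (@sqn R n).
Proof. by apply: continuous_measurable_rV; exact: continuous_sqn. Qed.

Lemma measurable_rad (V : R -> R) : measurable_fun setT V -> measurable_fun setT (@rad R n V).
Proof.
move=> mV.
apply: (measurableT_comp (f := fun s : R => if s == 0 then 0 else V (ln s)) _ measurable_sqn).
apply: measurable_fun_ifT => //.
  by apply: measurable_fun_eqr.
by apply: measurableT_comp => //; exact: measurable_ln.
Qed.

(** In x this is |x|^(-n) e^(-d |t|): the scale-invariant weight, integrable at neither end by
    itself, with decay at both. *)
Definition Jw (d : R) : R -> R := fun t => expR (- (n%:R / 2) * t - d * `|t|).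

Lemma measurable_Jw d : measurable_fun setT (Jw d).
Proof.
apply: measurableT_comp => //; apply: measurable_funB; first exact: measurable_funM.
by apply: measurable_funM => //; exact: measurableT_comp.
Qed.

Lemma box_sqn (t : R) (x : V_) : 0 < sqn x -> ln (sqn x) <= t -> box n (expR (t / 2)) x.
Proof.
move=> s0 st i; rewrite -(ger0_norm (expR_ge0 (t / 2))) -ler_sqr ?nnegrE//.
rewrite !real_normK ?num_real// -expRM_natl mulrC divfK//.
apply: le_trans (coord_sqn x i) _.
by rewrite -[leLHS]lnK ?posrE// ler_expR.
Qed.

(* Dyadic decomposition of the space into the shells k - 1 < ln |x|^2 <= k. *)
Lemma itg_Jw (d : R) : 0 < d -> itg leb (rad (Jw d)).
Proof.
move=> d0; pose N2 : R := n%:R / 2.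
have N20 : 0 <= N2 by rewrite divr_ge0.
pose K := expR (N2 + d); pose Bx t := box n (expR (t / 2) : R).
(* The first term serves the shells with t >= 0, the second those with t < 0. Each shell is enlarged
   to a box whose volume cancels the factor e^(-n t / 2) and leaves e^(-d k); K pays for rounding t
   to an integer. *)
pose f (k : nat) (x : V_) : R :=
  K * (expR (- N2 * k%:R - d * k%:R) * \1_(Bx k%:R) x +
       expR (N2 * k%:R - d * k%:R) * \1_(Bx (- k%:R)) x).
have iB (t : R) := itg_box n (expR_ge0 (t / 2)).
have i1 k : itg leb (fun x => expR (- N2 * k%:R - d * k%:R) * \1_(Bx k%:R) x).
  by apply: itgZ; case: (iB (k%:R : R)).
have i2 k : itg leb (fun x => expR (N2 * k%:R - d * k%:R) * \1_(Bx (- k%:R)) x).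
  by apply: itgZ; case: (iB (- k%:R : R)).
have fi k : itg leb (f k) by apply: itgZ; exact: itgD.
have f0 k x : 0 <= f k x by rewrite mulr_ge0 ?expR_ge0// addr_ge0// mulr_ge0 ?expR_ge0.
pose rho := expR (- d); pose A := K * 2 ^+ n * 2.
have fv k : lint leb (f k) = A * rho ^+ k.
  rewrite /f (intZ K (itgD (i1 k) (i2 k))) (intD (i1 k) (i2 k)) (intZ _ (iB _).1) (intZ _ (iB _).1).
  rewrite (iB _).2 (iB _).2 !exprMn /A /rho -!expRM_natl.
  have e1 : expR (- N2 * k%:R - d * k%:R) * (2 ^+ n * expR (n%:R * (k%:R / 2))) =
      2 ^+ n * expR (k%:R * - d).
    by rewrite mulrCA -expRD; congr (_ * expR _); rewrite /N2; field.
  have e2 : expR (N2 * k%:R - d * k%:R) * (2 ^+ n * expR (n%:R * (- k%:R / 2))) =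
      2 ^+ n * expR (k%:R * - d).
    by rewrite mulrCA -expRD; congr (_ * expR _); rewrite /N2; field.
  by rewrite e1 e2; ring.
have mJ : measurable_fun setT (@rad R n (Jw d)) by apply: measurable_rad; exact: measurable_Jw.
have J0 x : 0 <= @rad R n (Jw d) x by rewrite /rad; case: ifP => // _; exact: expR_ge0.
have JE x : exists k, rad (Jw d) x <= f k x.
  rewrite /rad; have [s0|s0] := eqVneq (sqn x) 0; first by exists 0%N.
  have s0' : 0 < sqn x by rewrite lt_neqAle sqn_ge0 eq_sym s0.
  set t := ln (sqn x).
  have [t0|t0] := leP 0 t.
    exists (Num.truncn t).+1; set k := (Num.truncn t).+1.
    have kt : t <= k%:R by apply: ltW; exact: truncnS_gt.
    have tk : k%:R - 1 <= t by rewrite /k -natr1 addrK truncn_le.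
    have kx : Bx k%:R x by exact: box_sqn.
    rewrite /f !indicE (mem_set kx) mulr1.
    apply: (@le_trans _ _ (K * expR (- N2 * k%:R - d * k%:R))).
      rewrite /K /Jw -expRD ler_expR ger0_norm// -/N2.
      have : N2 * (k%:R - 1) <= N2 * t by rewrite ler_wpM2l.
      have : d * (k%:R - 1) <= d * t by rewrite ler_pM2l.
      lra.
    by rewrite ler_pM2l ?expR_gt0// lerDl mulr_ge0 ?expR_ge0.
  exists (Num.truncn (- t)); set k := Num.truncn (- t).
  have t0' : 0 <= - t by rewrite oppr_ge0 ltW.
  have kt : k%:R <= - t by rewrite truncn_le.
  have tk : - t <= k%:R + 1 by rewrite natr1 ltW// truncnS_gt.
  have kx : Bx (- k%:R) x by apply: box_sqn => //; rewrite -/t lerNr.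
  rewrite /f !indicE (mem_set kx) mulr1.
  apply: (@le_trans _ _ (K * expR (N2 * k%:R - d * k%:R))).
    rewrite /K /Jw -expRD ler_expR ltr0_norm// -/N2.
    have : N2 * (- t) <= N2 * (k%:R + 1) by rewrite ler_wpM2l.
    have : d * k%:R <= d * (- t) by rewrite ler_pM2l.
    lra.
  by rewrite ler_pM2l ?expR_gt0// lerDr mulr_ge0 ?expR_ge0.
have rho1 : 0 < 1 - rho by rewrite subr_gt0 expR_lt1 oppr_lt0.
apply: (@itg_ge0 _ _ _ _ _ (A / (1 - rho))) => //.
apply: (@le_trans _ _ (\int[leb]_x (\sum_(0 <= k <oo) (f k x)%:E))%E).
  apply: ge0_le_integral => //.
  - by move=> x _; rewrite lee_fin.
  - exact/measurable_EFinP.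
  - apply: ge0_emeasurable_sum => //; first by move=> k x _; rewrite lee_fin.
    by move=> k _; apply/measurable_EFinP; exact: itg_meas (fi k).
  - move=> x _; have [k Jk] := JE x.
    apply: (@le_trans _ _ (\sum_(0 <= j < k.+1) (f j x)%:E)%E).
      rewrite big_nat_recr//= (@le_trans _ _ (f k x)%:E) ?lee_fin//.
      by rewrite leeDr// sume_ge0// => j _; rewrite lee_fin.
    by apply: nneseries_lim_ge => j _; rewrite lee_fin.
rewrite integral_nneseries//; last 2 first.
- by move=> k; apply/measurable_EFinP; exact: itg_meas (fi k).
- by move=> k x _; rewrite lee_fin.
apply: lime_le; first by apply: is_cvg_nneseries => k _ _; apply: integral_ge0 => x _; rewrite lee_fin.
apply: nearW => m; rewrite (eq_bigr (fun k => (A * rho ^+ k)%:E)); last first.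
  by move=> k _; rewrite -int_EFin// fv.
rewrite sumEFin lee_fin -mulr_sumr ler_wpM2l//.
  by rewrite /A !mulr_ge0 ?expR_ge0// exprn_ge0.
rewrite -[leRHS]mul1r ler_pdivlMr//.
suff -> : (\sum_(0 <= i < m) rho ^+ i) * (1 - rho) = 1 - rho ^+ m.
  by rewrite gerBl exprn_ge0 ?expR_ge0.
elim: m => [|m IH]; first by rewrite big_geq// mul0r expr0 subrr.
by rewrite big_nat_recr//= mulrDl IH exprS; ring.
Qed.

End radial_integrals.

(** * Cutoffs *)

Section cutoffs.
Variable R : realType.
Implicit Types (a b D : nat -> R -> R).

Lemma leibniz_eq0l k a b t : (forall j, a j t = 0) -> leibniz k a b t = 0.
Proof.
elim: k a b => [|k IH] a b ha /=; first by rewrite ha mul0r.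
by rewrite !IH ?addr0// => j; exact: ha.
Qed.

Lemma dseq_affine D (a b : R) : dseq D -> dseq (fun k t => a ^+ k * D k (a * t + b)).
Proof.
move=> dD k t.
have da : is_derive t 1 (fun s : R => a * s + b) a.
  by apply: derE (derD (derZ a (is_derive_id t 1)) (der_cst t 1 b)); rewrite mulr1 addr0.
by apply: derE (derZ (a ^+ k) (der_comp da (dD k (a * t + b)))); rewrite exprS; ring.
Qed.

Lemma dseqZ D (c : R) : dseq D -> dseq (fun k t => c * D k t).
Proof. by move=> dD k t; exact: derZ. Qed.

Lemma dseq_expR (c : R) : dseq (fun k t => c ^+ k * expR (c * t)).
Proof.
by move=> k t; apply: derE (derZ (c ^+ k) (der_expRZ c t)); rewrite exprS; ring.
Qed.

(** The product of [theta 0] at 1 - t and at 1 + t; the factor e^2 normalizes the value at 0, since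
    [theta 0 1] is e^(-1). *)
Lemma dseq_bump : exists2 Y, dseq Y &
  Y 0%N 0 = 1 /\ forall k (t : R), 1 <= `|t| -> Y k t = 0.
Proof.
have [D dD [D0 Dn]] := @theta_dseq R.
pose a j t := (-1) ^+ j * D j (-1 * t + 1).
pose b j t := 1 ^+ j * D j (1 * t + 1).
exists (fun k t => expR 2 * leibniz k a b t).
  by apply: dseqZ; apply: dseq_leibniz; exact: dseq_affine.
split.
  rewrite /= /a /b !mulr0 !add0r !expr0 !mul1r D0 /theta ltr01 expr0 invr1 !mul1r.
  by rewrite -!expRD -[RHS]expR0; congr expR; ring.
move=> k t; rewrite ler_normr => /orP[t1|t1].
  by rewrite leibniz_eq0l ?mulr0// => j; rewrite /a Dn ?mulr0//; lra.
by rewrite leibniz_eq0 ?mulr0// => j; rewrite /b Dn ?mulr0//; lra.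
Qed.

(** Dilating the bump to Y(t / (n + 1)) gives each derivative a factor 1 / (n + 1): bounds stay
    uniform and all derivatives of positive order tend to 0. *)
Lemma cutoff_dseq (m : nat) : exists (X : nat -> nat -> R -> R) (B : R),
  [/\ forall n, dseq (X n), forall n k t, n.+1%:R <= `|t| -> X n k t = 0,
      forall n k t, (k <= m)%N -> `|X n k t| <= B &
      forall k t, X n k t @[n --> \oo] --> (if k == 0%N then 1 else 0 : R)].
Proof.
have [Y dY [Y0 Yn]] := dseq_bump.
have Ycont k : continuous (Y k) by exact: der_continuous (dY k).
have Yb k : exists B : R, forall t, `|Y k t| <= B.
  have := compact_bounded (continuous_compact (continuous_subspaceT (Ycont k))
    (@segment_compact R (-1) 1)).
  move=> [M [_ HM]]; exists (`|M| + 1) => t.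
  have [t1|t1] := leP 1 `|t|; first by rewrite Yn// normr0 addr_ge0.
  apply: (HM (`|M| + 1)); first by rewrite (le_lt_trans (ler_norm _))// ltrDl.
  by exists t => //=; rewrite in_itv/= -ler_norml ltW.
have [B HB] : exists B : R, forall k t, (k <= m)%N -> `|Y k t| <= B.
  elim: m => [|m [B HB]].
    by have [B HB] := Yb 0%N; exists B => k t; rewrite leqn0 => /eqP ->.
  have [B' HB'] := Yb m.+1; exists (Num.max B B') => k t.
  rewrite leq_eqVlt => /orP[/eqP ->|]; first by rewrite le_max HB' orbT.
  by rewrite ltnS => /(HB k t) h; rewrite le_max h.
pose h (n : nat) : R := n.+1%:R^-1.
have h0 n : 0 < h n by rewrite invr_gt0.
have h1 n : h n <= 1 by rewrite invf_le1// ler1n.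
exists (fun n k t => h n ^+ k * Y k (h n * t + 0)), B; split.
- by move=> n; exact: dseq_affine.
- move=> n k t nt; rewrite Yn ?mulr0// addr0 normrM gtr0_norm//.
  by rewrite /h mulrC ler_pdivlMr ?mul1r.
- move=> n k t km; rewrite normrM (@le_trans _ _ (1 * B))//; last by rewrite mul1r.
  by rewrite ler_pM// ?HB// normrX exprn_ile1// gtr0_norm.
- move=> k t.
  have ch : h n @[n --> \oo] --> (0 : R) by exact: cvg_harmonic.
  have ct : h n * t + 0 @[n --> \oo] --> (0 : R).
    rewrite -[X in _ --> X](_ : 0 * t + 0 = 0); last by ring.
    exact: (cvgD (cvgM ch (cvg_cst t)) (cvg_cst (0 : R))).
  have cY : Y k (h n * t + 0) @[n --> \oo] --> Y k 0.
    exact: (cvg_comp (fun n => h n * t + 0) (Y k) ct (Ycont k 0)).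
  case: k cY => [|k] cY.
    rewrite /= -Y0; have N : \forall n \near \oo, Y 0%N (h n * t + 0) = h n ^+ 0 * Y 0%N (h n * t + 0).
      by apply: nearW => n; rewrite expr0 mul1r.
    exact: (cvg_trans (near_eq_cvg N) cY).
  have cX : h n ^+ k.+1 @[n --> \oo] --> (0 : R).
    elim: k {cY} => [|k IH].
      by rewrite (_ : (fun n => _) = h)//; apply/funext => n; rewrite expr1.
    rewrite (_ : (fun n => _) = (fun n => h n * h n ^+ k.+1)).
      by rewrite -[X in _ --> X](mulr0 (0 : R)); exact: (cvgM ch IH).
    by apply/funext => n; rewrite exprS.
  by rewrite -[X in _ --> X](mul0r (Y k.+1 0)); exact: (cvgM cX cY).
Qed.

End cutoffs.

(** * Radial functions with power weights: Laplacians, limits, L^p norms *)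

Section weighted_radial.
Variables (R : realType) (n : nat).
Local Notation V_ := 'rV[R]_n.
Local Notation leb := (lebesgue_rV R n).

(** [rad (expw k V)] is |x|^(-2k) V(ln |x|^2). *)
Definition expw (k : R) (V : R -> R) : R -> R := fun t => expR (- k * t) * V t.

Lemma measurable_expw k V : measurable_fun setT V -> measurable_fun setT (expw k V).
Proof.
by move=> mV; apply: measurable_funM => //; apply: measurableT_comp => //; exact: measurable_funM.
Qed.

Lemma laplacian_expw (k : R) Z (x : V_) : dseq Z ->
  (exists r : R, forall j t, t <= r -> Z j t = 0) ->
  laplacian (rad (expw k (Z 0%N))) x =
  rad (expw (k + 1) (fun t => 4 * Z 2%N t + (2 * n%:R - 4 - 8 * k) * Z 1%N t +
     k * (4 * k + 4 - 2 * n%:R) * Z 0%N t)) x.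
Proof.
move=> dZ [r Zr].
have dE := dseq_expR (- k).
pose V := fun j => leibniz j (fun j t => (- k) ^+ j * expR (- k * t)) Z.
have dV : dseq V by exact: dseq_leibniz.
have V0 : V 0%N = expw k (Z 0%N) by apply/funext => t; rewrite /V /expw /= expr0 mul1r.
have Vr j t : t <= r -> V j t = 0 by move=> tr; apply: leibniz_eq0 => i; exact: Zr.
rewrite -V0 (laplacian_rad x (dV 0%N) (dV 1%N)); last first.
  by exists r => t tr; rewrite !Vr.
apply: radE => t; rewrite /lapV /V /expw /= /shift_seq.
have -> : - (k + 1) * t = - t + - k * t by ring.
by rewrite expRD !exprS expr0; ring.
Qed.

Lemma test_expw (k : R) Z : dseq Z -> (exists r : R, forall j t, r <= `|t| -> Z j t = 0) ->
  test_function (rad (expw k (Z 0%N)) : V_ -> R).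
Proof.
move=> dZ [r Zr].
pose V := fun j => leibniz j (fun j t => (- k) ^+ j * expR (- k * t)) Z.
have dV : dseq V by apply: dseq_leibniz => //; exact: dseq_expR.
have V0 : V 0%N = expw k (Z 0%N) by apply/funext => t; rewrite /V /expw /= expr0 mul1r.
rewrite -V0; apply: test_rad => //; exists r => j t tr.
by apply: leibniz_eq0 => i; exact: Zr.
Qed.

Lemma cvg_rad (F : nat -> R -> R) G k (x : V_) : (forall t, F m t @[m --> \oo] --> G t) ->
  rad (expw k (F m)) x @[m --> \oo] --> rad (expw k G) x.
Proof.
move=> FG; rewrite /rad; case: ifP => _; first exact: cvg_cst.
exact: (cvgM (cvg_cst _) (FG _)).
Qed.

(** On a box t = ln |x|^2 <= |x|^2 <= n r^2, so for k <= n / 2 the surplus factor e^((n/2 - k) t)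
    over [Jw] is bounded. *)
Lemma rad_Jw_bound (k d C : R) (F : R -> R) (x : V_) (r : R) :
  k <= n%:R / 2 -> (forall t, `|F t| <= C * expR (- d * `|t|)) -> box n r x ->
  `|rad (expw k F) x| <= C * expR ((n%:R / 2 - k) * (n%:R * r ^+ 2)) * rad (Jw n d) x.
Proof.
move=> kn FC xr; have C0 : 0 <= C.
  by have := FC 0; rewrite normr0 mulr0 expR0 mulr1; exact: le_trans.
rewrite /rad; case: (eqVneq (sqn x) 0) => [_|s0]; first by rewrite normr0 mulr0.
have s0' : 0 < sqn x by rewrite lt_neqAle sqn_ge0 eq_sym s0.
rewrite /expw normrM gtr0_norm ?expR_gt0//; set t := ln _.
apply: (@le_trans _ _ (expR (- k * t) * (C * expR (- d * `|t|)))).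
  by rewrite ler_wpM2l ?expR_ge0.
rewrite mulrCA -mulrA ler_wpM2l// /Jw -!expRD ler_expR.
have tn : t <= n%:R * r ^+ 2.
  apply: (@le_trans _ _ (sqn x)).
    by have := expR_ge1Dx t; rewrite /t lnK ?posrE//; lra.
  rewrite /sqn; apply: (@le_trans _ _ (\sum_(i < n) r ^+ 2)).
    apply: ler_sum => i _; rewrite -[leLHS]real_normK ?num_real//.
    by rewrite lerXn2r ?nnegrE// (le_trans (normr_ge0 _) (xr i)).
  by rewrite sumr_const card_ord mulr_natl.
have : (n%:R / 2 - k) * t <= (n%:R / 2 - k) * (n%:R * r ^+ 2) by rewrite ler_wpM2l// subr_ge0.
lra.
Qed.

Lemma dominated_rad (k d C r M : R) (F : nat -> R -> R) (G : R -> R) (phi : V_ -> R) :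
  0 < d -> k <= n%:R / 2 -> (forall m, measurable_fun setT (F m)) ->
  (forall m t, `|F m t| <= C * expR (- d * `|t|)) ->
  (forall t, F m t @[m --> \oo] --> G t) ->
  measurable_fun setT phi -> (forall x, `|phi x| <= M) -> (forall x, phi x != 0 -> box n r x) ->
  itg leb (fun x => rad (expw k G) x * phi x) /\
  lint leb (fun x => rad (expw k (F m)) x * phi x) @[m --> \oo] -->
  lint leb (fun x => rad (expw k G) x * phi x).
Proof.
move=> d0 kn mF FC FG mphi phiM phir.
have M0 : 0 <= M := le_trans (normr_ge0 _) (phiM 0).
set K := C * expR ((n%:R / 2 - k) * (n%:R * r ^+ 2)).
apply: (@dominated_int _ _ _ _ _ _ (fun x => M * (K * rad (Jw n d) x))).
- move=> m; apply: measurable_funM => //; apply: measurable_rad; exact: measurable_expw.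
- by do 2 apply: itgZ; exact: itg_Jw.
- move=> m x; have [->|px] := eqVneq (phi x) 0.
    rewrite mulr0 normr0 !mulr_ge0 ?expR_ge0//.
      by have := FC 0%N 0; rewrite normr0 mulr0 expR0 mulr1; exact: le_trans.
    by rewrite /rad; case: ifP => // _; exact: expR_ge0.
  rewrite normrM mulrC ler_pM//; exact: rad_Jw_bound (FC m) (phir x px).
- move=> x; have c := @cvg_rad F G k x FG.
  exact: (cvgM c (cvg_cst (phi x))).
Qed.

Lemma rad_powR (k s : R) (F : R -> R) (x : V_) : s != 0 ->
  `|rad (expw k F) x| `^ s = rad (expw (k * s) (fun t => `|F t| `^ s)) x.
Proof.
move=> s0; rewrite /rad; case: ifP => _; first by rewrite normr0 powR0.
rewrite /expw normrM gtr0_norm ?expR_gt0// powRM ?expR_ge0//.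
by rewrite -expRM; congr (expR _ * _); ring.
Qed.

Lemma cvg_powR0 (u : nat -> R) (s : R) : 0 < s -> (forall m, 0 <= u m) ->
  u m @[m --> \oo] --> (0 : R) -> u m `^ s @[m --> \oo] --> (0 : R).
Proof.
move=> s0 u0 cu; apply/cvgr0Pnorm_le => e e0.
have es0 : 0 < e `^ s^-1 by exact: powR_gt0.
have /cvgr0Pnorm_le /(_ _ es0) := cu; apply: filterS => m.
rewrite !ger0_norm ?powR_ge0// => h.
have := ge0_ler_powR (ltW s0) (u0 m) (powR_ge0 _ _) h.
by rewrite -powRrM mulVf ?gt_eqF// powRr1// ltW.
Qed.

Section Lp_radial.
Variables (k s d C : R).
Hypotheses (s0 : 0 < s) (ks : k * s = n%:R / 2) (d0 : 0 < d).

(** The relation k s = n / 2 is the scaling for which the s-th power carries exactly the weight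
    |x|^(-n) of [Jw]. *)
Lemma rad_powR_le (F : R -> R) (x : V_) : (forall t, `|F t| <= C * expR (- d * `|t|)) ->
  `|rad (expw k F) x| `^ s <= C `^ s * rad (Jw n (s * d)) x.
Proof.
move=> FC; have C0 : 0 <= C.
  by have := FC 0; rewrite normr0 mulr0 expR0 mulr1; exact: le_trans.
rewrite rad_powR ?gt_eqF// /rad; case: ifP => _; first by rewrite mulr0.
rewrite /expw ks; set t := ln _.
have := ge0_ler_powR (ltW s0) (normr_ge0 _) (le_trans (normr_ge0 _) (FC t)) (FC t).
rewrite powRM ?expR_ge0// -expRM => h.
apply: (@le_trans _ _ (expR (- (n%:R / 2) * t) * (C `^ s * expR (- d * `|t| * s)))).
  by rewrite ler_wpM2l ?expR_ge0.
rewrite mulrCA ler_wpM2l ?powR_ge0// /Jw -expRD ler_expR.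
rewrite le_eqVlt; apply/orP; left; apply/eqP; ring.
Qed.

Lemma measurable_radw (F : R -> R) : measurable_fun setT F ->
  measurable_fun setT (@rad R n (expw k F)).
Proof. by move=> mF; apply: measurable_rad; exact: measurable_expw. Qed.

Lemma itg_rad_powR (F : R -> R) : measurable_fun setT F ->
  (forall t, `|F t| <= C * expR (- d * `|t|)) ->
  itg leb (fun x => `|rad (expw k F) x| `^ s).
Proof.
move=> mF FC; apply: (@itg_le _ _ _ _ _ (fun x => C `^ s * rad (Jw n (s * d)) x)).
- apply: (measurableT_comp (measurable_powR s)); apply: measurableT_comp => //.
  exact: measurable_radw.
- by apply: itgZ; apply: itg_Jw; exact: mulr_gt0.
- by move=> x; rewrite ger0_norm ?powR_ge0//; exact: rad_powR_le.
Qed.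

Lemma Lnorm_rad (F : R -> R) : measurable_fun setT F ->
  (forall t, `|F t| <= C * expR (- d * `|t|)) ->
  ('N[leb]_(s%:E)[EFin \o rad (expw k F)] =
   (lint leb (fun x => `|rad (expw k F) x| `^ s) `^ s^-1)%:E)%E.
Proof.
move=> mF FC; rewrite unlock /Lnorm -poweR_EFin; congr poweR.
by rewrite int_EFin//; exact: itg_rad_powR.
Qed.

Lemma Lp_rad (F : R -> R) : measurable_fun setT F ->
  (forall t, `|F t| <= C * expR (- d * `|t|)) -> rad (expw k F) \in Lfun leb s%:E.
Proof.
move=> mF FC; rewrite inE; apply/andP; split; rewrite inE/=; first exact: measurable_radw.
by rewrite /finite_norm Lnorm_rad// ltry.
Qed.

Lemma Lp_cvg_rad (F : nat -> R -> R) : (forall m, measurable_fun setT (F m)) ->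
  (forall m t, `|F m t| <= C * expR (- d * `|t|)) -> (forall t, F m t @[m --> \oo] --> 0) ->
  'N[leb]_(s%:E)[EFin \o rad (expw k (F m))]%E @[m --> \oo] --> 0%E.
Proof.
move=> mF FC F0.
have E : (fun m => 'N[leb]_(s%:E)[EFin \o rad (expw k (F m))]%E) =
  (fun m => (lint leb (fun x => `|rad (expw k (F m)) x| `^ s) `^ s^-1)%:E).
  by apply/funext => m; rewrite Lnorm_rad.
rewrite E; apply/fine_cvgP; split; first exact: nearW.
apply: cvg_powR0; first by rewrite invr_gt0.
  by move=> m; apply: int_ge0 => x; exact: powR_ge0.
rewrite -(@int0 _ _ R leb).
apply: (@dominated_int _ _ _ _ _ _ (fun x => C `^ s * rad (Jw n (s * d)) x) _ _ _ _).2.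
- by move=> m; exact: itg_meas (itg_rad_powR (mF m) (FC m)).
- by apply: itgZ; apply: itg_Jw; exact: mulr_gt0.
- by move=> m x; rewrite ger0_norm ?powR_ge0//; exact: rad_powR_le.
- move=> x; apply: cvg_powR0 => //; rewrite -[X in _ --> X](@normr0 _ R).
  apply: cvg_norm; have := @cvg_rad F (fun=> 0) k x F0.
  rewrite (_ : rad _ x = 0)//; rewrite /rad /expw; case: ifP => // _.
  by rewrite mulr0.
Qed.

End Lp_radial.

End weighted_radial.

(** * The radial solution *)

Section profile.
Variable R : realType.

(* In the variable t = ln |x|^2 and with g = (n - 4) / 2, the bilaplacian of
   |x|^(- g) W(t) is |x|^(- g - 4) times 16 (W'''' - (2a + 1) W'' + a^2 W). *)
Lemma profile_ex (n : nat) (beta mu : R) : (5 <= n)%N -> 0 < beta < 4 ->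
  - (n%:R - 2) ^+ 2 <= mu < (n%:R * (n%:R - 4) / 4) ^+ 2 ->
  exists (W : nat -> R -> R) (d C : R), let a := n%:R * (n%:R - 4) / 16 in
  [/\ dseq W, 0 < d, forall t, 0 < W 0%N t,
    forall j t, (j <= 4)%N -> `|W j t| <= C * expR (- d * `|t|) &
    forall t, 16 * (W 4%N t - (2 * a + 1) * W 2%N t + a ^+ 2 * W 0%N t) =
      mu * W 0%N t + (W 0%N t `^ (q_exp n beta - 1) + W 0%N t `^ (crit_exp R n - 1))].
Proof.
move=> hn /andP[b0 b4] /andP[mu1 mu2].
set N : R := n%:R in mu1 mu2 *; pose a := N * (N - 4) / 16.
have N5 : 5 <= N by rewrite /N (ler_nat R 5).
have N4 : 0 < N - 4 by lra.
have q2 : 2 < q_exp n beta by rewrite /q_exp -/N ltr_pdivlMr//; lra.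
have p2 : 2 < crit_exp R n by rewrite /crit_exp -/N ltr_pdivlMr//; lra.
have a0 : 0 < a by rewrite /a divr_gt0// mulr_gt0//; lra.
(* S and P are the sum and the product of l1^2 and l2^2. The discriminant of X^2 - S X + P is ((N -
   2)^2 + mu) / 4, and P > 0 says mu < (4 a)^2. *)
pose S := 2 * a + 1; pose P := a ^+ 2 - mu / 16.
have P0 : 0 < P.
  by move: mu2; rewrite /P (_ : N * (N - 4) / 4 = 4 * a) /a; [rewrite exprMn; lra|field].
pose D := S ^+ 2 - 4 * P.
have D0 : 0 <= D.
  rewrite (_ : D = ((N - 2) ^+ 2 + mu) / 4); last by rewrite /D /S /P /a; field.
  by rewrite divr_ge0//; lra.
pose r := Num.sqrt D; have r2 : r ^+ 2 = D by rewrite sqr_sqrtr.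
have r0 : 0 <= r by rewrite sqrtr_ge0.
have S0 : 0 < S by rewrite /S; lra.
have rS : r < S by rewrite -(ltr_pXn2r (ltn0Sn 1)) ?nnegrE// ?(ltW S0)// r2 /D; lra.
pose l1 := Num.sqrt ((S + r) / 2); pose l2 := Num.sqrt ((S - r) / 2).
have l10 : 0 < l1 by rewrite sqrtr_gt0; lra.
have l20 : 0 < l2 by rewrite sqrtr_gt0; lra.
have e1 : l1 ^+ 2 = (S + r) / 2 by rewrite sqr_sqrtr//; lra.
have e2 : l2 ^+ 2 = (S - r) / 2 by rewrite sqr_sqrtr//; lra.
have ES : l1 ^+ 2 + l2 ^+ 2 = S by rewrite e1 e2; field.
have EP : l1 ^+ 2 * l2 ^+ 2 = P.
  have -> : l1 ^+ 2 * l2 ^+ 2 = (S ^+ 2 - r ^+ 2) / 4 by rewrite e1 e2; field.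
  by rewrite r2 /D; field.
have c0 : 0 < 16^-1 :> R by rewrite invr_gt0.
have [W0 [W1 [W2 [W3 [d [C [d0 W00 [h0 h1 h2 h3] hb]]]]]]] :=
  homoclinic_ex q2 p2 c0 l10 l20.
have h3' : forall t : R, is_derive t 1 W3 (S * W2 t - P * W0 t +
    16^-1 * (W0 t `^ (q_exp n beta - 1) + W0 t `^ (crit_exp R n - 1))).
  by move=> t; have := h3 t; rewrite ES EP.
have [W dW [w0 w1 w2 w3 w4]] := homoclinic_dseq W00 h0 h1 h2 h3'.
have C0 : 0 < C.
  have := lt_le_trans (W00 0) (let: And4 h _ _ _ := hb 0 in h).
  by rewrite pmulr_lgt0// expR_gt0.
(* The 1 keeps K >= C for orders up to 3; the other terms bound the fourth derivative through the
   equation. *)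
pose K := C * (1 + S + P + 16^-1 * (C `^ (q_exp n beta - 2) + C `^ (crit_exp R n - 2))).
have CK : C <= K.
  rewrite /K ler_pMr//; have := powR_ge0 C (q_exp n beta - 2).
  have := powR_ge0 C (crit_exp R n - 2); lra.
exists W, d, K; split=> //.
- by move=> t; rewrite w0.
- move=> j t; set E := expR _; have E0 : 0 < E by exact: expR_gt0.
  have [b0' b1 b2 b3] := hb t.
  have E1 : E <= 1 by rewrite /E expR_le1 mulNr oppr_le0 mulr_ge0// ltW.
  have CE : C * E <= K * E by rewrite ler_pM2r.
  have WC : W0 t <= C by apply: le_trans b0' _; rewrite ger_pMr.
  have pw s : 2 < s -> W0 t `^ (s - 1) <= C `^ (s - 2) * (C * E).
    move=> s2; rewrite -powR_B2 ?(ltW (W00 t))// ler_pM ?powR_ge0 ?(ltW (W00 t))//.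
    by apply: ge0_ler_powR; rewrite ?nnegrE ?(ltW C0) ?(ltW (W00 t))//; lra.
  case: j => [|[|[|[|[|//]]]]] _.
  + by rewrite w0 gtr0_norm// (le_trans b0').
  + by rewrite w1 (le_trans b1).
  + by rewrite w2 (le_trans b2).
  + by rewrite w3 (le_trans b3).
  + rewrite w4; have pq := pw _ q2; have pp := pw _ p2.
    have pq0 := powR_ge0 (W0 t) (q_exp n beta - 1).
    have pp0 := powR_ge0 (W0 t) (crit_exp R n - 1).
    apply: (@le_trans _ _ (S * (C * E) + P * (C * E) + 16^-1 * (C `^ (q_exp n beta - 2) * (C * E)
       + C `^ (crit_exp R n - 2) * (C * E)))).
      rewrite (le_trans (ler_normD _ _))//; apply: lerD.
        rewrite (le_trans (ler_normB _ _))// lerD// normrM gtr0_norm// ler_pM2l//.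
        by rewrite gtr0_norm.
      by rewrite ger0_norm ?mulr_ge0 ?addr_ge0 ?(ltW c0)// ler_pM2l// lerD.
    have -> : K * E = C * E + (S * (C * E) + P * (C * E) + 16^-1 * (C `^ (q_exp n beta - 2) * (C * E)
       + C `^ (crit_exp R n - 2) * (C * E))) by rewrite /K; ring.
    by rewrite lerDr mulr_ge0 ?(ltW C0) ?(ltW E0).
- by move=> t; rewrite w4 w2 w0 -/N -/a /S /P; field.
Qed.

End profile.

(** * The solution on R^n and its membership in D^{2,2} *)

Section radial_solution.
Variables (R : realType) (n : nat).
Hypothesis n5 : (5 <= n)%N.
Local Notation V_ := 'rV[R]_n.
Local Notation leb := (lebesgue_rV R n).
Local Notation g := ((n%:R - 4) / 4 : R).
Variables (W : nat -> R -> R) (d C : R).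
Hypotheses (dW : dseq W) (d0 : 0 < d).
Hypothesis WC : forall j t, (j <= 4)%N -> `|W j t| <= C * expR (- d * `|t|).

Definition lapW (Z : nat -> R -> R) (j : nat) : R -> R :=
  fun t => 4 * (Z j.+2 t + Z j.+1 t - g * (g + 1) * Z j t).

(** This is 16 (D^2 + D - a)(D^2 - D - a) with a = g (g + 1): the first-order terms for the weights
    g and g + 1 are opposite, so odd derivatives cancel. *)
Definition bilapW (Z : nat -> R -> R) : R -> R :=
  fun t => 16 * (Z 4%N t - (2 * (g * (g + 1)) + 1) * Z 2%N t + (g * (g + 1)) ^+ 2 * Z 0%N t).

Definition solU : V_ -> R := rad (expw g (W 0%N)).
Definition solV : V_ -> R := rad (expw (g + 1) (lapW W 0%N)).

Lemma n_ge5 : 5 <= n%:R :> R.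
Proof. by rewrite (ler_nat R 5). Qed.

Lemma dseq_lapW Z : dseq Z -> dseq (lapW Z).
Proof.
move=> dZ j t.
have h := derZ 4 (derB (derD (dZ j.+2 t) (dZ j.+1 t)) (derZ (g * (g + 1)) (dZ j t))).
by apply: derE h.
Qed.

Lemma laplacian_radW Z (x : V_) : dseq Z -> (exists r : R, forall j t, t <= r -> Z j t = 0) ->
  laplacian (rad (expw g (Z 0%N))) x = rad (expw (g + 1) (lapW Z 0%N)) x.
Proof.
move=> dZ Zr; rewrite laplacian_expw//; apply: radE => t.
by rewrite /expw /lapW; congr (_ * _); field.
Qed.

Lemma laplacian_lapW Z (x : V_) : dseq Z -> (exists r : R, forall j t, t <= r -> Z j t = 0) ->
  laplacian (rad (expw (g + 1) (lapW Z 0%N))) x = rad (expw (g + 2) (bilapW Z)) x.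
Proof.
move=> dZ [r Zr]; rewrite laplacian_expw; first last.
- by exists r => j t tr; rewrite /lapW !Zr// !mulr0 subr0 addr0 mulr0.
- exact: dseq_lapW.
apply: radE => t; rewrite /expw /lapW /bilapW.
have -> : g + 1 + 1 = g + 2 by ring.
by congr (_ * _); field.
Qed.

Lemma measurable_dseq (Z : nat -> R -> R) j : dseq Z -> measurable_fun setT (Z j).
Proof.
by move=> dZ; apply: continuous_measurable_fun; exact: der_continuous (dZ j).
Qed.

Lemma lapW_le Z (c : R) t : (forall j, (j <= 2)%N -> `|Z j t| <= c) ->
  `|lapW Z 0%N t| <= 4 * (2 + g * (g + 1)) * c.
Proof.
move=> Zc; have n5' := n_ge5.
have a0 : 0 <= g * (g + 1) by rewrite mulr_ge0//; lra.
rewrite /lapW normrM ger0_norm// -[leRHS]mulrA ler_pM2l//.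
rewrite (le_trans (ler_normB _ _))// normrM (ger0_norm a0).
have h1 := ler_normD (Z 2%N t) (Z 1%N t).
have h2 := Zc 2%N isT; have h3 := Zc 1%N isT.
have : g * (g + 1) * `|Z 0%N t| <= g * (g + 1) * c by rewrite ler_wpM2l// Zc.
lra.
Qed.

Lemma bilapW_le Z (c : R) t : (forall j, (j <= 4)%N -> `|Z j t| <= c) ->
  `|bilapW Z t| <= 16 * (2 + 2 * (g * (g + 1)) + (g * (g + 1)) ^+ 2) * c.
Proof.
move=> Zc; have n5' := n_ge5.
have a0 : 0 <= g * (g + 1) by rewrite mulr_ge0//; lra.
rewrite /bilapW; set a := g * (g + 1) in a0 *.
have a1 : 0 <= 2 * a + 1 by lra.
have a2 : 0 <= a ^+ 2 by exact: sqr_ge0.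
rewrite normrM ger0_norm// -[leRHS]mulrA ler_pM2l//.
rewrite (le_trans (ler_normD _ _))// [`|a ^+ 2 * _|]normrM (ger0_norm a2).
have := ler_normB (Z 4%N t) ((2 * a + 1) * Z 2%N t); rewrite normrM (ger0_norm a1) => h1.
have h2 := Zc 4%N isT.
have h3 : (2 * a + 1) * `|Z 2%N t| <= (2 * a + 1) * c by rewrite ler_wpM2l// Zc.
have : a ^+ 2 * `|Z 0%N t| <= a ^+ 2 * c by rewrite ler_wpM2l// Zc.
lra.
Qed.

Lemma approximation_ex : exists (Z : nat -> nat -> R -> R) (c : R),
  [/\ forall m, dseq (Z m), forall m, exists r : R, forall j t, r <= `|t| -> Z m j t = 0,
    forall m j t, (j <= 4)%N -> `|Z m j t| <= c * expR (- d * `|t|) &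
    forall j t, Z m j t @[m --> \oo] --> W j t].
Proof.
have [X [B [dX X0 XB Xc]]] := cutoff_dseq R 4.
have B0 : 0 <= B := le_trans (normr_ge0 _) (XB 0%N 0%N 0 isT).
have C0 : 0 <= C.
  by have := WC 0 (isT : (0 <= 4)%N); rewrite normr0 mulr0 expR0 mulr1; exact: le_trans.
exists (fun m j => leibniz j W (X m)), (16 * (C * B)); split.
- by move=> m; exact: dseq_leibniz.
- by move=> m; exists m.+1%:R => j t tm; apply: leibniz_eq0 => i; exact: X0.
- move=> m j t j4.
  apply: (@le_trans _ _ (2 ^+ j * (C * expR (- d * `|t|) * B))).
    by apply: leibniz_le => i ij; [apply: WC|apply: XB]; exact: leq_trans ij j4.
  have -> : 16 * (C * B) * expR (- d * `|t|) = 2 ^+ 4 * (C * expR (- d * `|t|) * B) by ring.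
  rewrite ler_wpM2r ?mulr_ge0 ?expR_ge0//.
  by apply: ler_weXn2l => //; lra.
- by move=> j t; apply: cvg_leibniz => i; exact: Xc.
Qed.

Lemma rad_expwB k F G (x : V_) :
  rad (expw k F) x - rad (expw k G) x = rad (expw k (fun t => F t - G t)) x.
Proof.
by rewrite /rad; case: ifP => _; [rewrite subrr|rewrite /expw mulrBr].
Qed.

Lemma D22_sol : D22_laplacian solU solV.
Proof.
have n5' := n_ge5.
have [Z [c [dZ Zr Zc ZW]]] := approximation_ex.
have Zr' m : exists r : R, forall j t, t <= r -> Z m j t = 0.
  have [r Hr] := Zr m; exists (- `|r|) => j t tr; apply: Hr.
  have := ler_norm r; have := ler_norm (- t); rewrite normrN; lra.
(* Both u in L^(2N/(N-4)) and its Laplacian in L^2 sit at the scaling k s = n / 2 of the radial L^p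
   lemmas. *)
have gs : g * crit_exp R n = n%:R / 2 by rewrite /crit_exp; field; lra.
have gs' : (g + 1) * 2 = n%:R / 2 :> R by field.
have p0 : 0 < crit_exp R n by rewrite /crit_exp divr_gt0 ?mulr_gt0//; lra.
have K0 : 0 <= 4 * (2 + g * (g + 1)).
  by have : 0 <= g * (g + 1); [rewrite mulr_ge0//; lra|lra].
have lW t : `|lapW W 0%N t| <= 4 * (2 + g * (g + 1)) * C * expR (- d * `|t|).
  by rewrite -mulrA; apply: lapW_le => j j2; apply: WC; exact: leq_trans j2 _.
have lZ m t : `|lapW (Z m) 0%N t| <= 4 * (2 + g * (g + 1)) * c * expR (- d * `|t|).
  by rewrite -mulrA; apply: lapW_le => j j2; apply: Zc; exact: leq_trans j2 _.
have mlap Y : dseq Y -> measurable_fun setT (lapW Y 0%N).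
  by move=> dY; exact: measurable_dseq (dseq_lapW dY).
split.
- exact: (Lp_rad p0 gs d0 (measurable_dseq 0 dW) (fun t => WC t (isT : (0 <= 4)%N))).
- exact: (Lp_rad _ gs' d0 (mlap _ dW) lW).
exists (fun m => rad (expw g (Z m 0%N))); split.
- by move=> m; exact: test_expw.
- have -> : (fun m => 'N[leb]_(2%:E)[EFin \o (laplacian (rad (expw g (Z m 0%N))) \- solV)%R]%E) =
      (fun m => 'N[leb]_(2%:E)[EFin \o
         rad (expw (g + 1)%R (fun t => lapW (Z m) 0%N t - lapW W 0%N t)%R)]%E).
    apply/funext => m; congr ('N[leb]_(2%:E)[EFin \o _]%E).
    by apply/funext => x; rewrite /= laplacian_radW// rad_expwB.
  apply: (Lp_cvg_rad (d := d) (C := 4 * (2 + g * (g + 1)) * c + 4 * (2 + g * (g + 1)) * C)) => //.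
  + by move=> m; apply: measurable_funB; exact: mlap.
  + by move=> m t; rewrite mulrDl (le_trans (ler_normB _ _))// lerD.
  + move=> t; rewrite -[X in _ --> X](subrr (lapW W 0%N t)).
    apply: (cvgB _ (cvg_cst _)); rewrite /lapW.
    apply: (cvgM (cvg_cst _)); apply: cvgB; first exact: cvgD.
    exact: (cvgM (cvg_cst _)).
- have -> : (fun m => 'N[leb]_((crit_exp R n)%:E)[EFin \o (rad (expw g (Z m 0%N)) \- solU)%R]%E) =
      (fun m => 'N[leb]_((crit_exp R n)%:E)[EFin \o
         rad (expw g (fun t => Z m 0%N t - W 0%N t)%R)]%E).
    apply/funext => m; congr ('N[leb]_(_)[EFin \o _]%E).
    by apply/funext => x; rewrite /= rad_expwB.
  apply: (Lp_cvg_rad (d := d) (C := c + C)) => //.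
  + by move=> m; apply: measurable_funB; exact: measurable_dseq.
  + by move=> m t; rewrite mulrDl (le_trans (ler_normB _ _))// lerD// (Zc, WC).
  + move=> t; rewrite -[X in _ --> X](subrr (W 0%N t)).
    exact: (cvgB (ZW 0%N t) (cvg_cst _)).
Qed.

Lemma class_C_sol : class_C 4 (~` [set 0]) solU.
Proof.
pose V := fun j => leibniz j (fun j t => (- g) ^+ j * expR (- g * t)) W.
have -> : solU = rad (V 0%N).
  by rewrite /solU; congr rad; apply/funext => t; rewrite /V /expw /= expr0 mul1r.
apply: class_C_rad.
- by apply: closed_openC; exact: accessible_closed_set1 (hausdorff_accessible (@norm_hausdorff _ _)) _.
- by apply: dseq_leibniz => //; exact: dseq_expR.
- by move=> x j /eqP x0; left.
Qed.

Hypothesis W0 : forall t, 0 < W 0%N t.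

Lemma sol_gt0 x : x != 0 -> 0 < solU x.
Proof.
by move=> x0; rewrite /solU /rad sqn_eq0 (negbTE x0) mulr_gt0 ?expR_gt0.
Qed.

Lemma sol_nontrivial : ~ {ae leb, forall x, solU x = 0}.
Proof.
move=> [A [mA A0 HA]].
(* The cube [1, 2]^n has measure 1 and avoids the origin, so u is positive on it. *)
pose B := [set x : V_ | forall i, (fun=> `[1, 2]%classic : set R) i (x ord0 i)].
have mI : measurable (`[1, 2]%classic : set (measurableTypeR R)) by exact: measurable_itv.
have mB : measurable B by apply: (@measurable_rV_box R n (fun=> `[1, 2]%classic)).
have : (leb B <= leb A)%E.
  apply: le_measure; rewrite ?inE//.
  move=> x Bx; apply: HA => /= /eqP; rewrite gt_eqF//; apply: sol_gt0.
  apply/eqP => x0; have := Bx (Ordinal (leq_trans (ltn0Sn 4) n5)).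
  by rewrite x0 /= mxE in_itv/= ler10.
rewrite A0 (@lebesgue_rV_box R n (fun=> `[1, 2]%classic))// big1.
  by rewrite leNgt lte01.
move=> i _; rewrite lebesgue_measure_itv/= lte_fin ifT; last lra.
by rewrite -EFinB; congr EFin; lra.
Qed.

(** * The weak formulation *)

Section weak_form.
Variables (beta mu : R).
Local Notation q := (q_exp n beta).
Local Notation p := (crit_exp R n).
Hypotheses (q2 : 2 < q).
Hypothesis WE : forall t, bilapW W t = mu * W 0%N t + (W 0%N t `^ (q - 1) + W 0%N t `^ (p - 1)).

Lemma p_gt2 : 2 < p.
Proof. by have := n_ge5; rewrite /crit_exp => ?; rewrite ltr_pdivlMr; lra. Qed.

Lemma test_laplacian (phi : V_ -> R) : test_function phi ->
  measurable_fun setT (laplacian phi) /\ exists r M : R,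
  [/\ forall x, `|laplacian phi x| <= M, forall x, laplacian phi x != 0 -> box n r x,
      forall x, `|phi x| <= M & forall x, phi x != 0 -> box n r x].
Proof.
move=> tp; split.
  apply: measurable_sum => i.
  exact: (test_measurable [:: i; i] tp).
have [r Hr] := test_bounded tp; have [M HM] := (Hr [::]).1.
have /choice[K HK] i := (Hr [:: i; i]).1.
have K0 i : 0 <= K i := le_trans (normr_ge0 _) (HK i 0).
exists r, (M + \sum_i K i); split.
- move=> x; rewrite (le_trans (ler_norm_sum _ _ _))//.
  apply: (@le_trans _ _ (\sum_i K i)); first by apply: ler_sum => i _; exact: HK.
  by rewrite lerDr (le_trans (normr_ge0 _) (HM 0)).
- move=> x; apply: contraNP => nb; apply/eqP/big1 => i _.
  by apply/eqP/negPn/negP => /((Hr [:: i; i]).2 x).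
- by move=> x; rewrite (le_trans (HM x))// lerDl sumr_ge0.
- by move=> x; exact: (Hr [::]).2.
Qed.

(** Green's formula holds for the cutoffs, and both sides converge because g + 1 and g + 2 are at
    most n / 2; no boundary term survives at the origin. *)
Lemma int_bilap (phi : V_ -> R) : test_function phi ->
  [/\ itg leb (fun x => solV x * laplacian phi x),
      itg leb (fun x => rad (expw (g + 2) (bilapW W)) x * phi x) &
      lint leb (fun x => solV x * laplacian phi x) =
      lint leb (fun x => rad (expw (g + 2) (bilapW W)) x * phi x)].
Proof.
move=> tp; have n5' := n_ge5.
have [ml [r [M [lM lr pM pr]]]] := test_laplacian tp.
have [Z [c [dZ Zr Zc ZW]]] := approximation_ex.
have Zr' m : exists r : R, forall j t, t <= r -> Z m j t = 0.
  have [r' Hr] := Zr m; exists (- `|r'|) => j t tr; apply: Hr.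
  have := ler_norm r'; have := ler_norm (- t); rewrite normrN; lra.
have k1 : g + 1 <= n%:R / 2 :> R by lra.
have k2 : g + 2 <= n%:R / 2 :> R by lra.
have [i1 c1] : itg leb (fun x => solV x * laplacian phi x) /\
    lint leb (fun x => rad (expw (g + 1) (lapW (Z m) 0%N)) x * laplacian phi x) @[m --> \oo] -->
    lint leb (fun x => solV x * laplacian phi x).
  apply: (@dominated_rad R n (g + 1) d (4 * (2 + g * (g + 1)) * c) r M) => //.
  - by move=> m; exact: measurable_dseq (dseq_lapW (dZ m)).
  - move=> m t; rewrite -mulrA; apply: lapW_le => j j2; apply: Zc; exact: leq_trans j2 _.
  - move=> t; rewrite /lapW.
    apply: (cvgM (cvg_cst _)); apply: cvgB; first exact: cvgD.
    exact: (cvgM (cvg_cst _)).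
have [i2 c2] : itg leb (fun x => rad (expw (g + 2) (bilapW W)) x * phi x) /\
    lint leb (fun x => rad (expw (g + 2) (bilapW (Z m))) x * phi x) @[m --> \oo] -->
    lint leb (fun x => rad (expw (g + 2) (bilapW W)) x * phi x).
  apply: (@dominated_rad R n (g + 2) d (16 * (2 + 2 * (g * (g + 1)) + (g * (g + 1)) ^+ 2) * c) r M) => //.
  - move=> m; apply: measurable_funM => //; apply: measurable_funD; last first.
      by apply: measurable_funM => //; exact: measurable_dseq.
    apply: measurable_funB; first exact: measurable_dseq.
    by apply: measurable_funM => //; exact: measurable_dseq.
  - move=> m t; rewrite -mulrA; apply: bilapW_le => j j4; exact: Zc.
  - move=> t; rewrite /bilapW.
    apply: (cvgM (cvg_cst _)); apply: cvgD; last exact: (cvgM (cvg_cst _)).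
    by apply: cvgB => //; exact: (cvgM (cvg_cst _)).
  - exact: (test_measurable [::] tp).
split=> //.
(* The Laplacian of the cut-off function is itself a radial test function, so [green] applies to it
   and phi. *)
have E m : lint leb (fun x => rad (expw (g + 1) (lapW (Z m) 0%N)) x * laplacian phi x) =
    lint leb (fun x => rad (expw (g + 2) (bilapW (Z m))) x * phi x).
  rewrite green//; first by apply: eq_int => x; rewrite laplacian_lapW.
  apply: test_expw; first exact: dseq_lapW.
  by have [r' Hr] := Zr m; exists r' => j t tr; rewrite /lapW !Hr// !mulr0 subr0 addr0 mulr0.
rewrite (funext E) in c1.
exact: (cvg_unique (@Rhausdorff R) c1 c2).
Qed.

Lemma euclid_expR (x : V_) : sqn x != 0 -> euclid x = expR (ln (sqn x) / 2).
Proof.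
move=> s0; have s0' : 0 < sqn x by rewrite lt_neqAle sqn_ge0 eq_sym s0.
have -> : euclid x = Num.sqrt (expR (ln (sqn x))) by rewrite lnK.
have -> : ln (sqn x) = 2%:R * (ln (sqn x) / 2) by field.
by rewrite expRM_natl sqrtr_sqr ger0_norm ?expR_ge0//; congr expR; field.
Qed.

(** With g r = (n - b) / 2 one has g (r - 1) + b / 2 = g + 2, so every nonlinear term carries the
    same power of |x| as the bilaplacian. At the origin both sides are 0 by the convention in
    [rad]. *)
Lemma weak_term (b r : R) (x : V_) (y : R) : 2 < r -> g * r = (n%:R - b) / 2 ->
  `|solU x| `^ (r - 2) * solU x * y / euclid x `^ b =
  rad (expw (g + 2) (fun t => W 0%N t `^ (r - 1))) x * y.
Proof.
move=> r2 gr; rewrite /solU /rad; case: (eqVneq (sqn x) 0) => [_|s0].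
  by rewrite mulr0 !mul0r.
rewrite euclid_expR// /expw; set t := ln _.
have Wt := W0 t; have e0 := expR_gt0 (- g * t).
rewrite gtr0_norm ?mulr_gt0// powR_B2 ?mulr_ge0 ?(ltW e0) ?(ltW Wt)//.
rewrite powRM ?(ltW e0) ?(ltW Wt)// -!expRM -expRN.
have -> : - (g + 2) * t = - g * t * (r - 1) + - (t / 2 * b).
  have -> : - g * t * (r - 1) = - (g * r) * t + g * t by ring.
  by rewrite gr; field.
by rewrite expRD; ring.
Qed.

Lemma weak_itg (phi : V_ -> R) (r : R) : 2 <= r -> test_function phi ->
  itg leb (fun x => rad (expw (g + 2) (fun t => W 0%N t `^ (r - 1))) x * phi x).
Proof.
move=> r2 tp; have n5' := n_ge5.
have [_ [s [M [_ _ pM ps]]]] := test_laplacian tp.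
have C0 : 0 <= C.
  by have := WC 0 (isT : (0 <= 4)%N); rewrite normr0 mulr0 expR0 mulr1; exact: le_trans.
(* A constant sequence reduces [dominated_rad] to its integrability part. *)
apply: (@dominated_rad R n (g + 2) d (C `^ (r - 2) * C) s M (fun=> fun t => W 0%N t `^ (r - 1)) _ _ d0 _ _ _ _ _ pM ps).1.
- lra.
- by move=> _; apply: (measurableT_comp (measurable_powR _)); exact: measurable_dseq.
- move=> _ t; have Wt := WC t (isT : (0 <= 4)%N); rewrite gtr0_norm// in Wt.
  rewrite ger0_norm ?powR_ge0// -mulrA.
  have -> : W 0%N t `^ (r - 1) = W 0%N t `^ (r - 2) * W 0%N t.
    have -> : r - 1 = r - 2 + 1 by ring.
    by rewrite powRD ?powRr1 ?(gt_eqF (W0 t)) ?implybT// ltW.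
  rewrite ler_pM ?powR_ge0 ?(ltW (W0 t))//.
  apply: ge0_ler_powR; rewrite ?nnegrE ?(ltW (W0 t))//; first lra.
  apply: (le_trans Wt); rewrite ler_piMr// expR_le1 mulNr oppr_le0; apply: mulr_ge0 => //; exact: ltW.
- by move=> t; exact: cvg_cst.
- exact: (test_measurable [::] tp).
Qed.

Lemma weak_sol : weak_solution mu beta solU.
Proof.
exists solV; first exact: D22_sol.
move=> phi tp; have n5' := n_ge5.
have p2 := p_gt2.
have [i1 i2 e12] := int_bilap tp.
(* The values r = q and r = p give the two nonlinear terms; r = 2, where the power is 1, gives the
   Rellich term. *)
pose h r x := rad (expw (g + 2) (fun t => W 0%N t `^ (r - 1))) x * phi x.
have ih r : 2 <= r -> itg leb (h r) by move=> r2; exact: weak_itg.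
have E0 x : solU x * phi x / euclid x ^+ 4 = h 2 x.
  rewrite /h /solU /rad; case: (eqVneq (sqn x) 0) => [_|s0]; first by rewrite !mul0r.
  rewrite euclid_expR// /expw; set t := ln _.
  rewrite -expRM_natl -expRN (_ : 2 - 1 = 1); last by ring.
  rewrite powRr1 ?(ltW (W0 t))//.
  have -> : - (g + 2) * t = - g * t + - (4%:R * (t / 2)) by field.
  by rewrite expRD; ring.
have Eq x : `|solU x| `^ (q - 2) * solU x * phi x / euclid x `^ beta = h q x.
  by apply: weak_term => //; rewrite /q_exp; field; lra.
have Ep x : `|solU x| `^ (p - 2) * solU x * phi x = h p x.
  have H : g * p = (n%:R - 0) / 2 by rewrite /crit_exp; field; lra.
  by have := weak_term x (phi x) p2 H; rewrite powRr0 divr1.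
have EB x : rad (expw (g + 2) (bilapW W)) x * phi x = mu * h 2 x + (h q x + h p x).
  rewrite /h /rad; case: ifP => _; first by rewrite !mul0r mulr0 !addr0.
  rewrite /expw WE (_ : 2 - 1 = 1); last by ring.
  by rewrite powRr1 ?(ltW (W0 _))//; ring.
have L f : \int[leb]_x f x = lint leb f by rewrite lint.unlock.
rewrite !L (eq_int _ Eq) (eq_int _ Ep) (@eq_int _ _ _ _ _ (fun x => solV x * laplacian phi x - mu * h 2 x)); last first.
  by move=> x; rewrite E0.
rewrite intB//; last by apply: itgZ; exact: ih.
rewrite e12 (eq_int _ EB) intD ?intD ?intZ; try exact: ih.
- by rewrite addrAC subrr add0r.
- by apply: ih; exact: ltW.
- by apply: ih; exact: ltW.
- by apply: itgZ; exact: ih.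
- by apply: itgD; apply: ih; exact: ltW.
Qed.

End weak_form.

End radial_solution.

Theorem theorem3p1 (R : realType) (N : nat) (beta mu : R)
  (hN : (5 <= N)%N) (hbeta : 0 < beta < 4)
  (hmu : - (N%:R - 2) ^+ 2 <= mu < (N%:R * (N%:R - 4) / 4) ^+ 2) :
  exists u : 'rV[R]_N -> R,
    [/\ D22 u,
        class_C 4 (~` [set 0]) u,
        ~ {ae lebesgue_rV R N, forall x, u x = 0} &
        weak_solution mu beta u].
Proof.
have [W [d [C [dW d0 W0 WC WE]]]] := profile_ex hN hbeta hmu.
have N5 : 5 <= N%:R :> R by rewrite (ler_nat R 5).
have q2 : 2 < q_exp N beta.
  by rewrite /q_exp ltr_pdivlMr; [case/andP: hbeta => *|]; lra.
exists (solU W); split.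
- by exists (solV W); exact: D22_sol WC.
- exact: class_C_sol.
- exact: sol_nontrivial.
- apply: (weak_sol hN dW d0 WC W0 q2) => t.
  rewrite -WE /bilapW; congr (16 * _).
  have -> : (N%:R - 4) / 4 * ((N%:R - 4) / 4 + 1) = N%:R * (N%:R - 4) / 16 :> R by field.
  by [].
Qed.
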